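(* Let $d\ge 1$ and let $p=(p^{(i)},\,i\in[d])$ be an offspring distribution of $d$ types with mean matrix $M$. Assume that $M$ is primitive, that $p$ is critical and non-singular, and that $p$ is aperiodic. Let $a$ be the positive left eigenvector of $M$ for the eigenvalue $1$, normalized by $\sum_{i\in[d]}a_i=1$. Let $(k(n),\,n\in\mathbb{N}^* )$ be a sequence of elements of $\mathbb{N}^d$ with $\lim_{n\to\infty}|k(n)|=+\infty$ and $\lim_{n\to\infty}k(n)/|k(n)|=a$, where $|k(n)|=\sum_{i\in[d]}k_i(n)$. Let $\alpha$ be a probability distribution on $[d]$, let $\tau$ be a multi-type Galton-Watson tree with offspring distribution $p$ and root type distribution $\alpha$, and let $\tau_n$ be distributed as $\tau$ conditionally on $\{|\tau|=k(n)\}$ (for those $n$ for which this event has positive probability). Then $(\tau_n)$ converges in distribution, as $n\to\infty$ and for the local topology on the set $\mathbb{T}$ of marked trees, to the multi-type Kesten's tree $\tau^*$ associated with the offspring distribution $p$ and the root type distribution $\alpha$.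
   Context: Notation: $\mathbb{N}=\{0,1,2,\dots\}$, $\mathbb{N}^*=\{1,2,\dots\}$, $[d]=\{1,\dots,d\}$, $\langle\cdot,\cdot\rangle$ is the usual scalar product, $\mathbf 1=(1,\dots,1)$. Marked trees. Let $\widehat{\mathcal U}=\bigcup_{n\ge0}(\mathbb{N}^* )^n$ be the set of finite words of positive integers, with $(\mathbb{N}^* )^0=\{\widehat\emptyset\}$. A tree is a subset $\hat{\mathbf t}$ of $\widehat{\mathcal U}$ that contains $\widehat\emptyset$, is closed under taking prefixes (ancestors), and such that for every $\hat u\in\hat{\mathbf t}$ there is $k_{\hat u}[\hat{\mathbf t}]\in\mathbb{N}$ with: for all $\ell\in\mathbb{N}^*$, $\hat u\ell\in\hat{\mathbf t}$ iff $1\le\ell\le k_{\hat u}[\hat{\mathbf t}]$. A marked tree $\mathbf t$ is a set of pairs $u=(\hat u,\mathcal M(u))$ with $\hat u\in\widehat{\mathcal U}$ and $\mathcal M(u)\in[d]$ (the type of $u$) such that $\{\hat u:u\in\mathbf t\}$ is a tree and each $\hat u$ carries only one type. $\mathbb{T}$ is the set of marked trees, $\emptyset_{\mathbf t}$ is the root, the height $|u|$ of $u$ is the length of the word $\hat u$, $k_u[\mathbf t]$ is the number of children of $u$, $k_u^{(i)}[\mathbf t]$ is the number of children of $u$ of type $i$, and $k_u(\mathbf t)=(k_u^{(i)}[\mathbf t],i\in[d])$. The vector $|\mathbf t|=(|\mathbf t^{(i)}|,i\in[d])$ gives the number $|\mathbf t^{(i)}|$ of individuals of each type $i$. Let $r_h(\mathbf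 t)=\{u\in\mathbf t:|u|\le h\}$. The local topology on $\mathbb{T}$ is that of the ultrametric $d(\mathbf t,\mathbf t')=2^{-\max\{h\in\mathbb N:\,r_h(\mathbf t)=r_h(\mathbf t')\}}$ (equal to $0$ if $\mathbf t=\mathbf t'$, and with $\max\emptyset=-1$); thus $\mathbf t_n\to\mathbf t$ iff for every $h$, $r_h(\mathbf t_n)=r_h(\mathbf t)$ for all large $n$. Offspring distribution. An offspring distribution of $d$ types is $p=(p^{(i)},i\in[d])$ with each $p^{(i)}$ a probability distribution on $\mathbb{N}^d$. Let $X_i=(X_i^{(j)},j\in[d])$ have law $p^{(i)}$; the generating function is $f=(f^{(1)},\dots,f^{(d)})$ with $f^{(i)}(s)=\mathbb{E}[\prod_j s_j^{X_i^{(j)}}]$ for $s\in[0,1]^d$, and the mean matrix is $M=(m_{ij})$, $m_{ij}=\mathbb{E}[X_i^{(j)}]\in[0,+\infty]$. $p$ is non-singular if $f$ is not the map $s\mapsto Ms$. $M$ is primitive if all $m_{ij}$ are finite and some power $M^n$, $n\in\mathbb N^*$, has all entries positive; then $M$ has a simple positive eigenvalue $\rho$ of maximal modulus with positive left and right eigenvectors, and $p$ is critical if $\rho=1$. In that case $a$ and $a^*$ denote the positive left and right eigenvectors of $M$ with $\langle a,\mathbf 1\rangle=\langle a,a^*\rangle=1$. $p$ is aperiodic if the smallest subgroup of $\mathbb{Z}^d$ containing $\bigcup_{i=1}^d(\mathrm{supp}(p^{(i)})-\mathrm{supp}(p^{(i)}))$ is $\mathbb{Z}^d$, where $\mathrm{supp}(p^{(i)})=\{k:p^{(i)}(k)>0\}$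 and $A-B=\{x-y:x\in A,y\in B\}$. Galton-Watson tree. A $\mathbb{T}$-valued random variable $\tau$ is a multi-type Galton-Watson tree with offspring distribution $p$ and root type distribution $\alpha$ if for all $h\in\mathbb{N}$ and all $\mathbf t\in\mathbb{T}$ of height at most $h$, $$\mathbb{P}(r_h(\tau)=\mathbf t)=\alpha(\mathcal M(\emptyset_{\mathbf t}))\prod_{u\in\mathbf t,\,|u|<h}\frac{k_u^{(1)}[\mathbf t]!\cdots k_u^{(d)}[\mathbf t]!}{k_u[\mathbf t]!}\,p^{(\mathcal M(u))}(k_u(\mathbf t)).$$ Kesten's tree. Set $\hat p^{(i)}(k)=\frac{\langle k,a^*\rangle}{a^*_i}p^{(i)}(k)$ for $k\in\mathbb N^d$, and $\hat\alpha(i)=\alpha(i)a_i^*/\langle\alpha,a^*\rangle$. The multi-type Kesten's tree $\tau^*$ associated with $p$ and $\alpha$ is the random marked tree constructed as follows: individuals are normal or special; the root is special with type of law $\hat\alpha$; a normal individual of type $i$ produces only normal children, whose numbers by types have law $p^{(i)}$; a special individual of type $i$ produces children whose numbers by types have law $\hat p^{(i)}$, and one of these children, chosen with probability proportional to $a^*_j$ where $j$ is its type, is special, the others being normal. Individuals reproduce independently given their type and status, and (as in the Galton-Watson tree) given the numbers of children of each type, the children's types are arranged in uniformly random order. *)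

(* Defs.v *)
From HB Require Import structures.
From mathcomp Require Import all_boot all_order all_algebra finmap.
From mathcomp Require Import complex.
From mathcomp Require Import all_classical all_reals all_analysis.

Set Implicit Arguments.
Unset Strict Implicit.
Unset Printing Implicit Defensive.

Import Order.TTheory GRing.Theory Num.Theory.
Import numFieldNormedType.Exports.

Local Open Scope card_scope.
Local Open Scope classical_set_scope.
Local Open Scope ring_scope.

(* Words are sequences over [nat], whereas labels of children are positive: the
   equivalence below holds for every [l : nat], so it excludes the letter 0. *)
Definition is_tree (S : set (seq nat)) : Prop :=
  [/\ S [::],
      forall v w, prefix v w -> S w -> S v
    & forall w, S w -> exists k, forall l, S (rcons w l) <-> (1 <= l <= k)%N].

Definition is_marked_tree (E : Type) (t : set (seq nat * E)) : Prop :=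
  is_tree (fst @` t) /\ forall u v, t u -> t v -> u.1 = v.1 -> u = v.

Record mtree (E : Type) : Type := MTree {
  nodes :> seq nat * E -> Prop;
  nodesP : is_marked_tree nodes }.

Lemma mtree_eq (E : Type) (t t' : mtree E) : nodes t = nodes t' -> t = t'.
Proof.
by case: t t' => [t tP] [t' t'P] /= e; subst t'; congr MTree; exact: Prop_irrelevance.
Qed.

Definition height_le (E : Type) (h : nat) (t : mtree E) : Prop :=
  forall u, t u -> (size u.1 <= h)%N.

Lemma restr_subproof (E : Type) (h : nat) (t : mtree E) :
  is_marked_tree [set u | t u /\ (size u.1 <= h)%N].
Proof.
have [[t0 tp tk] tu] := nodesP t; split; last first.
  by move=> u v [? _] [? _]; exact: tu.
split.
- by case: t0 => -[w i] /= ti wE; exists (w, i) => //=; split => //=; rewrite wE.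
- move=> v w vw [[w' i]] /= [twi sw] ww'; subst w'.
  have [[v' j] /= tvj vv'] : (fst @` nodes t) v by apply: (tp _ w vw); exists (w, i).
  subst v'; exists (v, j) => //=; split => //=.
  exact: leq_trans (size_prefix vw) sw.
- move=> w [[w' i]] /= [twi sw] ww'; subst w'.
  have [k kP] : exists k, forall l, (fst @` nodes t) (rcons w l) <-> (1 <= l <= k)%N.
    by apply: tk; exists (w, i).
  exists (if (size w < h)%N then k else 0%N) => l; split.
    move=> [[w' j] /= [twj sj]] wE; subst w'; rewrite size_rcons in sj.
    by rewrite sj; apply/kP; exists (rcons w l, j).
  case: ifPn => [wh lk|_]; last by rewrite leqn0 lt0n => /andP[/negbTE->].
  have [[w' j] /= twj wE] := (kP l).2 lk; subst w'.
  by exists (rcons w l, j) => //=; split => //=; rewrite size_rcons.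
Qed.

Definition restr (E : Type) (h : nat) (t : mtree E) : mtree E :=
  MTree (restr_subproof h t).

Lemma map_marks_subproof (E F : Type) (f : E -> F) (t : mtree E) :
  is_marked_tree [set (u.1, f u.2) | u in nodes t].
Proof.
have [tt tu] := nodesP t; split; last first.
  move=> _ _ [u tu1 <-] [v tv1 <-] /= uv.
  by have -> : u = v by exact: tu.
suff -> : fst @` [set (u.1, f u.2) | u in nodes t] = fst @` nodes t by [].
apply/seteqP; split=> [w [_ [u ? <-] <-]|w [u ? <-]] /=; first by exists u.
by exists (u.1, f u.2) => //; exists u.
Qed.

Definition map_marks (E F : Type) (f : E -> F) (t : mtree E) : mtree F :=
  MTree (map_marks_subproof f t).

Lemma root_exists (E : Type) (t : mtree E) : exists i, t ([::], i).
Proof. by have [[[[w i] /= ti e] _ _] _] := nodesP t; subst w; exists i. Qed.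

Definition root_mark (E : Type) (t : mtree E) : E := projT1 (cid (root_exists t)).

Definition children (E : Type) (t : mtree E) (u : seq nat * E) :
    set (seq nat * E) :=
  [set v | t v /\ exists l, v.1 = rcons u.1 l].

Definition nb_children (E : choiceType) (t : mtree E) (u : seq nat * E) : nat :=
  #|` fset_set (children t u)|%fset.

Definition children_by_mark (E : finType) (t : mtree E) (u : seq nat * E) :
    {ffun E -> nat} :=
  [ffun j => #|` fset_set [set v | children t u v /\ v.2 = j]|%fset].

(* |t| = k; this is false if some type has infinitely many individuals *)
Definition has_size (E : finType) (t : mtree E) (k : {ffun E -> nat}) : Prop :=
  forall i, [set u | t u /\ u.2 = i] #= `I_(k i).

(* [-1] accounts for the convention max \emptyset = -1; for t <> t' the set of
   h is finite, so the supremum is a maximum. *)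
Definition tree_dist (R : realType) (E : Type) (t t' : mtree E) : R :=
  if `[< t = t' >] then 0
  else 2 `^ (- sup ([set -1] `|`
                    [set h%:R | h in [set h | restr h t = restr h t']])).

Section tree_dist_theory.
Context (R : realType) (E : Type).
Implicit Types t : mtree E.

Lemma restr_le h h' t t' : (h <= h')%N ->
  restr h' t = restr h' t' -> restr h t = restr h t'.
Proof.
move=> hh' e; apply: mtree_eq => /=.
have {}e : nodes (restr h' t) = nodes (restr h' t') by rewrite e.
apply/seteqP; split=> u /= [tu uh].
  have : nodes (restr h' t) u by split => //; exact: leq_trans hh'.
  by rewrite e => -[].
have : nodes (restr h' t') u by split => //; exact: leq_trans hh'.
by rewrite -e => -[].
Qed.

Lemma restr_inj t t' : (forall h, restr h t = restr h t') -> t = t'.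
Proof.
move=> e; apply: mtree_eq; apply/seteqP; split=> u tu.
  have : nodes (restr (size u.1) t) u by [].
  by rewrite e => -[].
have : nodes (restr (size u.1) t') u by [].
by rewrite -e => -[].
Qed.

Lemma tree_distE t t' : t <> t' ->
  exists n : nat, (forall h, restr h t = restr h t' <-> (h < n)%N) /\
    tree_dist R t t' = 2 `^ (1 - n%:R).
Proof.
move=> tt'.
have ex : exists h, `[< restr h t <> restr h t' >].
  apply/not_existsP => all_eq; apply: tt'; apply: restr_inj => h.
  by have /negP/asboolPn/contrapT := all_eq h.
have [n /asboolP nP nmin] := ex_minnP ex.
have nE h : restr h t = restr h t' <-> (h < n)%N.
  split=> [e|hn]; first by rewrite ltnNge; apply/negP => /restr_le/(_ e).
  apply: contrapT => /asboolP/nmin.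
  by rewrite leqNgt hn.
exists n; split=> //.
rewrite /tree_dist asboolF//; congr (_ `^ _).
suff -> : sup ([set -1] `|` [set h%:R | h in [set h | restr h t = restr h t']])
    = n%:R - 1 :> R by rewrite opprB.
set A := (X in sup X).
have Aub : ubound A (n%:R - 1).
  move=> _ [->|[h /nE hn <-]]; first by rewrite lerDr ler0n.
  by rewrite lerBrDr natr1 ler_nat.
apply/eqP; rewrite eq_le; apply/andP; split.
  by apply: ge_sup => //; exists (-1); left.
apply: ub_le_sup; first by exists (n%:R - 1).
case: n {nP nmin Aub} nE => [|n] nE; first by left; rewrite /= sub0r.
by right; exists n; [apply/nE|rewrite -natr1 addrK].
Qed.

Lemma tree_distxx t : tree_dist R t t = 0.
Proof. by rewrite /tree_dist asboolT. Qed.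

Lemma tree_dist_ge0 t t' : 0 <= tree_dist R t t'.
Proof. by rewrite /tree_dist; case: ifP => // _; exact: powR_ge0. Qed.

Lemma tree_dist_positivity t t' : tree_dist R t t' = 0 -> t = t'.
Proof.
move=> d0; apply: contrapT => tt'; move: d0; rewrite /tree_dist asboolF//.
by apply/eqP; rewrite gt_eqF// powR_gt0.
Qed.

Lemma tree_dist_sym t t' : tree_dist R t t' = tree_dist R t' t.
Proof.
rewrite /tree_dist (_ : `[< t = t' >] = `[< t' = t >]); last first.
  by apply: asbool_equiv_eq; split=> ->.
case: ifP => // _; congr (_ `^ (- sup (_ `|` _))).
by congr image; apply/seteqP; split=> h /= ->.
Qed.

Lemma tree_dist_ultra t2 t1 t3 :
  tree_dist R t1 t3 <= Num.max (tree_dist R t1 t2) (tree_dist R t2 t3).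
Proof.
have [->|n13] := pselect (t1 = t3); first by rewrite tree_distxx le_max tree_dist_ge0.
have [->|n12] := pselect (t1 = t2); first by rewrite le_max lexx orbT.
have [->|n23] := pselect (t2 = t3); first by rewrite le_max lexx.
have [a [aP ->]] := tree_distE n13.
have [b [bP ->]] := tree_distE n12.
have [c [cP ->]] := tree_distE n23.
have mono (x y : nat) : (x <= y)%N -> 2 `^ (1 - y%:R) <= 2 `^ (1 - x%:R) :> R.
  by move=> xy; apply: ler_powR; rewrite ?ler1n// lerD2l lerN2 ler_nat.
have : ~~ ((a < b) && (a < c))%N.
  apply/negP => /andP[/bP e1 /cP e2].
  have /aP : restr a t1 = restr a t3 by rewrite e1.
  by rewrite ltnn.
rewrite negb_and -!leqNgt le_max => /orP[/mono ->//|/mono ->].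
by rewrite orbT.
Qed.

Lemma tree_dist_triangle t2 t1 t3 :
  tree_dist R t1 t3 <= tree_dist R t1 t2 + tree_dist R t2 t3.
Proof.
apply: le_trans (tree_dist_ultra t2 t1 t3) _.
by rewrite ge_max lerDl lerDr !tree_dist_ge0.
Qed.

End tree_dist_theory.

Lemma single_root_subproof (E : Type) (i : E) : is_marked_tree [set ([::], i)].
Proof.
split; last by move=> u v /= -> ->.
split.
- by exists ([::], i).
- move=> v w vw [u /= -> /= w0]; exists ([::], i) => //=.
  by subst w; case: v vw.
- move=> w [u /= -> /= <-]; exists 0%N => l; split.
    by move=> [? /= ->].
  by rewrite leqn0 lt0n => /andP[/negbTE->].
Qed.

HB.instance Definition _ (n : nat) := isPointed.Build 'I_n.+1 ord0.

(* Marked trees with the local topology and its Borel sigma-algebra. The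
   parameter [R], in which distances take their values, is needed for the
   metric instance. *)
Definition treespace (R : realType) (E : pointedType) : Type := mtree E.

Section treespace_instances.
Context (R : realType) (E : pointedType).

HB.instance Definition _ := gen_eqMixin (treespace R E).
HB.instance Definition _ := gen_choiceMixin (treespace R E).
HB.instance Definition _ := isPointed.Build (treespace R E)
  (MTree (single_root_subproof (point : E))).
HB.instance Definition _ := @isMetric.Build R (treespace R E) (@tree_dist R E)
  (@tree_distxx R E) (@tree_dist_positivity R E) (@tree_dist_sym R E)
  (@tree_dist_triangle R E).
HB.instance Definition _ := @isMeasurable.Build
  (sigma_display (@open (treespace R E))) (treespace R E)
  <<s @open (treespace R E) >>
  (@sigma_algebra0 _ setT (@open (treespace R E)))
  (@sigma_algebraC _ (@open (treespace R E)))
  (@sigma_algebra_bigcup _ setT (@open (treespace R E))).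

End treespace_instances.

Section offspring.
Context (R : realType) (d : nat).
Implicit Types (p : 'I_d -> {ffun 'I_d -> nat} -> R) (M : 'M[R]_d).

Definition is_offspring p : Prop :=
  forall i, (forall k, 0 <= p i k) /\ (\esum_(k in [set: {ffun 'I_d -> nat}]) (p i k)%:E = 1)%E.

Definition genfun p (i : 'I_d) (s : 'I_d -> R) : \bar R :=
  \esum_(k in [set: {ffun 'I_d -> nat}]) ((\prod_j s j ^+ k j) * p i k)%:E.

Definition mean p (i j : 'I_d) : \bar R :=
  \esum_(k in [set: {ffun 'I_d -> nat}]) ((k j)%:R * p i k)%:E.

Definition mean_mx p : 'M[R]_d := \matrix_(i, j) fine (mean p i j).

Definition nonsingular p : Prop :=
  ~ forall s : 'I_d -> R, (forall j, 0 <= s j <= 1) ->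
      forall i, (genfun p i s = \sum_j mean p i j * (s j)%:E)%E.

Definition primitive p : Prop :=
  (forall i j, mean p i j \is a fin_num) /\
  exists2 n : nat, (1 <= n)%N & forall i j, 0 < (mean_mx p ^+ n) i j.

(* a positive eigenvalue of maximal modulus among the complex eigenvalues *)
Definition perron_root M (rho : R) : Prop :=
  [/\ 0 < rho, eigenvalue M rho
    & forall z : R[i],
        eigenvalue (map_mx (real_complex R) M) z -> `|z| <= rho%:C%C].

Definition critical p : Prop := perron_root (mean_mx p) 1.

Definition is_subgroup (V : zmodType) (H : set V) : Prop :=
  H 0 /\ forall x y, H x -> H y -> H (x - y).

Definition supp p (i : 'I_d) : set {ffun 'I_d -> nat} := [set k | 0 < p i k].

Definition aperiodic p : Prop :=
  smallest (@is_subgroup {ffun 'I_d -> int})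
    (\bigcup_i [set z | exists x y, [/\ supp p i x, supp p i y &
       z = [ffun j => (x j)%:Z - (y j)%:Z]]]) = setT.

Definition is_distribution (alpha : 'I_d -> R) : Prop :=
  (forall i, 0 <= alpha i) /\ \sum_i alpha i = 1.

(* k_u^(1)! ... k_u^(d)! / k_u! : probability of each order of the children *)
Definition order_prob (t : mtree 'I_d) (u : seq nat * 'I_d) : R :=
  (\prod_j (children_by_mark t u j)`!)%N%:R / (nb_children t u)`!%:R.

End offspring.

Section random_trees.
Context (R : realType) (d : nat).
Local Notation ty := 'I_d.+1.
Context (p : ty -> {ffun ty -> nat} -> R) (alpha : ty -> R).
Context (D : measure_display) (Omega : measurableType D).
Context (P : probability Omega R).

Definition gw_tree (tau : {RV P >-> treespace R ty}) : Prop :=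
  forall (h : nat) (t : mtree ty), height_le h t ->
    P [set w | restr h (tau w) = t] =
    (alpha (root_mark t) *
     \big[*%R/1]_(u \in [set u | t u /\ (size u.1 < h)%N])
       (order_prob R t u * p u.2 (children_by_mark t u)))%:E.

Context (astar : 'cV[R]_d.+1).

Definition pairing (k : {ffun ty -> nat}) : R := \sum_j (k j)%:R * astar j 0.

Definition p_hat (i : ty) (k : {ffun ty -> nat}) : R :=
  pairing k / astar i 0 * p i k.

Definition alpha_hat (i : ty) : R :=
  alpha i * astar i 0 / \sum_j alpha j * astar j 0.

(* Marks are pairs (type, status), where status [true] means special. *)
Definition forget_status (t : mtree (ty * bool)) : mtree ty := map_marks fst t.

Definition special_children (t : mtree (ty * bool))
    (u : seq nat * (ty * bool)) : set (seq nat * (ty * bool)) :=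
  [set v | children t u v /\ v.2.2].

(* Probability that [u], given its type and status, has in [t] its children
   with their types, order and statuses: a normal individual has no special
   child; a special one has exactly one, selected among its ordered children
   with probability astar_j / <k_u, astar>. *)
Definition kesten_weight (t : mtree (ty * bool))
    (u : seq nat * (ty * bool)) : R :=
  let v := (u.1, u.2.1) in
  let k := children_by_mark (forget_status t) v in
  let S := special_children t u in
  order_prob R (forget_status t) v *
  if u.2.2 then
    p_hat u.2.1 k *
    (if #|` fset_set S|%fset == 1%N
     then \sum_(c \in S) astar c.2.1 0 / pairing k else 0)
  else
    p u.2.1 k * (if #|` fset_set S|%fset == 0%N then 1 else 0).

Definition kesten_marked_tree
    (sigma : {RV P >-> treespace R (ty * bool)%type}) : Prop :=
  forall (h : nat) (t : mtree (ty * bool)), height_le h t ->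
    P [set w | restr h (sigma w) = t] =
    ((if (root_mark t).2 then alpha_hat (root_mark t).1 else 0) *
     \big[*%R/1]_(u \in [set u | t u /\ (size u.1 < h)%N]) kesten_weight t u)%:E.

Definition kesten_tree (taustar : {RV P >-> treespace R ty}) : Prop :=
  exists2 sigma, kesten_marked_tree sigma &
    forall w, taustar w = forget_status (sigma w).

End random_trees.

Definition cond_prob (R : realType) (D : measure_display)
    (Omega : measurableType D) (P : probability Omega R) (A B : set Omega) :
    \bar R :=
  (P (A `&` B) * ((fine (P B))^-1)%:E)%E.

Definition cvg_in_distribution (R : realType) (E : pointedType)
    (F : set_system nat)
    (D : nat -> measure_display) (Omega : forall n, measurableType (D n))
    (P : forall n, probability (Omega n) R)
    (X : forall n, {RV (P n) >-> treespace R E})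
    (D' : measure_display) (Omega' : measurableType D')
    (P' : probability Omega' R) (Y : {RV P' >-> treespace R E}) : Prop :=
  forall f : treespace R E -> R, continuous f ->
    (exists K : R, forall t, `|f t| <= K) ->
    ('E_(P n)[fun w => f (X n w)])%E @[n --> F] --> ('E_P'[fun w => f (Y w)])%E.

(* Main.v *)
Require Import Defs.
From mathcomp Require Import all_boot all_order all_algebra finmap.
From mathcomp Require Import all_classical all_reals all_analysis.
From mathcomp Require Import zify ring lra.

(** Since the cylinders of a given height carry the whole mass of Kesten's tree, convergence
    for the local topology follows from lower bounds on the probability of every cylinder
    ([cvg_in_distribution_cylinders]). Let [t] be a tree of height at most [h], with [r i]
    individuals of type [i] at height [h] and [c i] at smaller heights. By the branching
    property, a Galton-Watson tree starts with [t] and has size [k] with probability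
    [W(t) * F_r(k - c)] ([gw_size_joint]), where [W(t)] is the weight of the generations
    of [t] before the last one and [F_r] is the law of the total progeny of a forest
    with roots [r] ([progeny]). In Kesten's tree, summing over the position of the special
    individual at height [h], the cylinder of [t] has probability at most
    [W(t) * <r, astar> / <alpha, astar>] ([kesten_law_le]). So everything reduces to the
    ratio limit
      [F_r(k(n) - c) / F_(e_o)(k(n)) --> <r, astar> / astar_o]
    for every type [o], of which the lower bound suffices ([progeny_ratio_lower]).

    To prove it, fix [o] and cut the trees at the individuals of type [o]. Between two
    successive generations of type [o] one sees independent excursions, and the
    Otter-Dwass formula ([dwass]) reads
      [k_o * F_r(k) = sum_y y_o * G_r(y) * P(S_(k_o) = k - y)],
    where [S] is the random walk whose steps are the excursions and [G_r] is the law of the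
    progeny of [r] when the individuals of type [o] do not reproduce. The eigenvector
    equations show that an excursion is almost surely finite, that its mean is [a / a_o]
    ([excursion_mean]), and that [sum_y y_o * G_r(y) = <r, astar> / astar_o]
    ([frozen_mean_eigen]). As [k(n)] is asymptotically proportional to [a], the walk is
    looked at near its mean displacement. There a bounded change of its length or of its endpoint
    changes its probability by a factor that tends to one ([strong_ratio]), and the ratio
    limit follows.

    This strong ratio theorem is proved by the method of Neveu, without a local limit
    theorem: no second moment is available. The probabilities in question do not decay
    exponentially ([walk_subexponential]), because the step counts can be adjusted to any endpoint
    near the mean. By Jensen's inequality applied to an exponential tilting, the walk
    conditioned on such an endpoint must then use each step with its unconditional
    frequency, which is the ratio statement for that step ([walk_ratio_theta]).
    The excursions generate the space-time lattice because the offspring distribution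
    is aperiodic ([excursion_spans]), so all the shifts are reached. *)

Set Implicit Arguments.
Unset Strict Implicit.
Unset Printing Implicit Defensive.

Import Order.TTheory GRing.Theory Num.Theory.
Import numFieldNormedType.Exports.

Local Open Scope classical_set_scope.
Local Open Scope ring_scope.

(** * Vectors of numbers of individuals *)

Section lattice.
Variable d : nat.
Local Notation ty := 'I_d.+1.
Local Notation vec := {ffun ty -> nat}.
Local Notation lat := {ffun ty -> int}.

Definition unitv (i : ty) : vec := [ffun j => (j == i) : nat].

Definition tolat (y : vec) : lat := [ffun j => (y j)%:Z].

Definition vsize (y : vec) : nat := (\sum_j y j)%N.

Definition total (x : lat) : int := \sum_j x j.

Lemma ffvD (x y : vec) j : (x + y) j = (x j + y j)%N.
Proof. by rewrite ffunE. Qed.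

Lemma ffv0 j : (0 : vec) j = 0%N.
Proof. by rewrite ffunE. Qed.

Lemma fflD (x y : lat) j : (x + y) j = x j + y j.
Proof. by rewrite ffunE. Qed.

Lemma fflN (x : lat) j : (- x) j = - x j.
Proof. by rewrite ffunE. Qed.

Lemma ffl0 j : (0 : lat) j = 0.
Proof. by rewrite ffunE. Qed.

Definition ffE := (ffvD, ffv0, fflD, fflN, ffl0).

Lemma tolatE y j : tolat y j = (y j)%:Z.
Proof. by rewrite ffunE. Qed.

Lemma tolatD y z : tolat (y + z) = tolat y + tolat z.
Proof. by apply/ffunP => j; rewrite !(ffE, tolatE) PoszD. Qed.

Lemma tolat0 : tolat 0 = 0.
Proof. by apply/ffunP => j; rewrite !(ffE, tolatE). Qed.

Lemma tolat_inj : injective tolat.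
Proof.
move=> y z /ffunP e; apply/ffunP => j.
by have := e j; rewrite !tolatE => -[].
Qed.

Lemma vaddC (x y : vec) : x + y = y + x.
Proof. by apply/ffunP => j; rewrite !ffvD addnC. Qed.

Lemma vaddA (x y z : vec) : x + (y + z) = x + y + z.
Proof. by apply/ffunP => j; rewrite !ffvD addnA. Qed.

Lemma vaddAC (x y z : vec) : x + y + z = x + z + y.
Proof. by apply/ffunP => j; rewrite !ffvD addnAC. Qed.

Lemma vadd0 (x : vec) : 0 + x = x.
Proof. by apply/ffunP => j; rewrite ffvD ffv0. Qed.

Lemma unitvE i j : unitv i j = (j == i).
Proof. by rewrite ffunE. Qed.

Lemma totalD x y : total (x + y) = total x + total y.
Proof. by rewrite /total -big_split; apply: eq_bigr => j _; rewrite fflD. Qed.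

Lemma totalN x : total (- x) = - total x.
Proof. by rewrite /total -sumrN; apply: eq_bigr => j _; rewrite fflN. Qed.

Lemma vsizeD y z : vsize (y + z) = (vsize y + vsize z)%N.
Proof. by rewrite /vsize -big_split; apply: eq_bigr => j _; rewrite ffvD. Qed.

Lemma vsize_unit i : vsize (unitv i) = 1%N.
Proof.
rewrite /vsize (bigD1 i)//= big1 ?unitvE ?eqxx// => j ji.
by rewrite unitvE (negbTE ji).
Qed.

Lemma vsize0 : vsize 0 = 0%N.
Proof. by rewrite /vsize big1// => j _; rewrite ffv0. Qed.

Lemma total_tolat y : total (tolat y) = (vsize y)%:Z.
Proof. by rewrite /total /vsize -[Posz _]natz natr_sum; apply: eq_bigr => j _; rewrite tolatE natz. Qed.

Lemma total_unit i : total (tolat (unitv i)) = 1.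
Proof. by rewrite total_tolat vsize_unit. Qed.

Lemma vec_split (x : vec) j : (0 < x j)%N -> exists s, x = s + unitv j.
Proof.
move=> xj; exists [ffun k => (x k - unitv j k)%N].
apply/ffunP => k; rewrite ffvD ffunE unitvE.
by have [->|_] := eqVneq k j; [rewrite subnK|rewrite subn0 addn0].
Qed.

(** Induction on vectors, one unit at a time: every additive or multiplicative
    property of forests reduces in this way to a property of one individual. *)
Lemma vec_ind (Q : vec -> Prop) :
  Q 0 -> (forall r i, Q r -> Q (r + unitv i)) -> forall r, Q r.
Proof.
move=> Q0 QS r; have [n] := ubnP (vsize r).
elim: n r => // n IH r rn; have [/eqP->//|] := boolP (r == 0).
move=> r0; have [i ri] : exists i, r i != 0%N.
  apply/existsP; apply: contraNT r0 => /existsPn r0.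
  by apply/eqP/ffunP => i; rewrite ffv0; have := r0 i; rewrite negbK => /eqP.
have [s rE] : exists s, r = s + unitv i by apply: vec_split; rewrite lt0n.
rewrite rE; apply: QS; apply: IH; move: rn.
by rewrite rE vsizeD vsize_unit addn1.
Qed.

(** Once the total size is fixed, every series below has finite support; writing it as
    a sum over this list keeps convergence questions away from the algebra. *)
Definition box (N : nat) : seq vec :=
  [seq y <- [seq [ffun j => val (t j)] | t : {ffun ty -> 'I_N.+1}]
     | (vsize y <= N)%N].

Lemma mem_box N (y : vec) : (y \in box N) = (vsize y <= N)%N.
Proof.
rewrite mem_filter andb_idr// => yN; apply/mapP.
exists [ffun j => inord (y j)]; first by rewrite mem_enum.
apply/ffunP => j; rewrite !ffunE /= inordK// ltnS (leq_trans _ yN)//.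
by rewrite /vsize (bigD1 j)//= leq_addr.
Qed.

Lemma uniq_box N : uniq (box N).
Proof.
rewrite filter_uniq// map_inj_uniq ?enum_uniq// => s t /ffunP e.
by apply/ffunP => j; apply/val_inj; have := e j; rewrite !ffunE.
Qed.

Lemma box_le N N' : (N <= N')%N -> {subset box N <= box N'}.
Proof. by move=> NN' y; rewrite !mem_box => /leq_trans; apply. Qed.

Lemma sum_box_widen (W : nmodType) (f : vec -> W) N N' : (N <= N')%N ->
  (forall y, y \in box N' -> y \notin box N -> f y = 0) ->
  \sum_(y <- box N') f y = \sum_(y <- box N) f y.
Proof.
move=> NN' f0; rewrite (bigID (mem (box N)))/= addrC big1_seq ?add0r; last first.
  by move=> y /andP[/= yN yN']; apply: f0.
rewrite -big_filter; apply: perm_big; apply: uniq_perm.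
- by rewrite filter_uniq ?uniq_box.
- exact: uniq_box.
- move=> y; rewrite mem_filter; apply/andP/idP => [[]//|yN]; split => //.
  exact: box_le NN' _ yN.
Qed.

Lemma sum_box_single (W : nmodType) (f : vec -> W) N z : z \in box N ->
  (forall y, y != z -> f y = 0) -> \sum_(y <- box N) f y = f z.
Proof.
by move=> zN f0; rewrite (bigD1_seq z) ?uniq_box//= big1 ?addr0.
Qed.

End lattice.

(** * Total progeny of a forest *)

Section progeny.
Variables (R : realType) (d : nat).
Local Notation ty := 'I_d.+1.
Local Notation vec := {ffun ty -> nat}.
Local Notation lat := {ffun ty -> int}.
Variable p : ty -> vec -> R.

(** The probability that a forest with [r i] roots of each type [i] has [k j] individuals
    of each type [j], obtained by letting the individuals die one at a time. Each
    death lowers [total k] by one, so that [total k] is enough fuel; [k] lives in the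
    lattice so that it may leave the positive orthant, where the value is zero. *)
Fixpoint progeny_rec (n : nat) (r : vec) (k : lat) : R :=
  if n is m.+1 then
    if [pick i | r i != 0%N] is Some i then
      \sum_(x <- box d n)
        p i x * progeny_rec m ([ffun j => (r j - unitv i j)%N] + x)
                            (k - tolat (unitv i))
    else (k == 0)%:R
  else ((r == 0) && (k == 0))%:R.

Definition progeny (r : vec) (k : lat) : R := progeny_rec `|total k| r k.

Lemma pick_vecP (r : vec) : r = 0 /\ [pick i | r i != 0%N] = None \/
  exists i s, r = s + unitv i /\ [pick i | r i != 0%N] = Some i /\
    s = [ffun j => (r j - unitv i j)%N].
Proof.
case: pickP => [i ri|r0]; last first.
  by left; split => //; apply/ffunP => i; have := r0 i; rewrite ffv0 => /negbFE/eqP.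
right; exists i, [ffun j => (r j - unitv i j)%N]; split => //.
apply/ffunP => j; rewrite ffvD ffunE unitvE.
by have [->|_] := eqVneq j i; [rewrite subnK// lt0n|rewrite subn0 addn0].
Qed.

Lemma progeny_rec_supp n (r : vec) (k : lat) : progeny_rec n r k != 0 -> forall j, (r j)%:Z <= k j.
Proof.
elim: n r k => [|n IH] r k /=.
  rewrite pnatr_eq0 eqb0 negbK => /andP[/eqP-> /eqP->] j.
  by rewrite !ffE.
have [[-> ->]|[i [s [rE [-> <-]]]]] := pick_vecP r.
  by rewrite pnatr_eq0 eqb0 negbK => /eqP-> j; rewrite !ffE.
move=> /eqP h j.
have [x /IH] : exists x, progeny_rec n (s + x) (k - tolat (unitv i)) != 0.
  apply: contrapT => /forallNP h0; apply: h; apply: big1 => x _.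
  by have /negP := h0 x; rewrite negbK => /eqP ->; rewrite mulr0.
by move=> /(_ j); rewrite rE !ffE tolatE; lia.
Qed.

Lemma progeny_rec_eq0 n (r : vec) (k : lat) j : k j < (r j)%:Z -> progeny_rec n r k = 0.
Proof.
move=> kr; apply/eqP; apply: contraTT kr => /progeny_rec_supp/(_ j).
by rewrite -leNgt.
Qed.

Lemma progeny_rec_box n m r s i (k : lat) x : total k <= n.+1%:Z ->
  progeny_rec m (s + x) (k - tolat (unitv i)) != 0 -> r = s + unitv i ->
  x \in box d n.
Proof.
move=> kn /progeny_rec_supp h _; rewrite mem_box -lez_nat -total_tolat.
have : total (k - tolat (unitv i)) <= n%:Z.
  by rewrite totalD totalN total_unit lerBlDr -PoszD addn1.
apply: le_trans; apply: ler_sum => j _; apply: le_trans (h j).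
by rewrite tolatE ffvD PoszD lerDr.
Qed.

Lemma progeny_rec_fuel n m r k : total k <= n%:Z -> total k <= m%:Z ->
  progeny_rec n r k = progeny_rec m r k.
Proof.
have aux i s l (k' : lat) : total k' <= 0 ->
    \sum_(x <- box d l.+1) p i x * progeny_rec l (s + x) (k' - tolat (unitv i)) = 0.
  move=> k0; apply: big1 => x _.
  have [/eqP->|/progeny_rec_supp h] := boolP (progeny_rec l (s + x) (k' - tolat (unitv i)) == 0).
    by rewrite mulr0.
  have : 0 <= total (k' - tolat (unitv i)).
    by apply: sumr_ge0 => j _; apply: le_trans (h j).
  rewrite totalD totalN total_unit => h1.
  by have := le_trans h1 (lerB k0 (lexx 1)).
elim: n m r k => [|n IH] [|m] r k //= kn km.
1, 2: have [[-> ->]|[i [s [rE [-> <-]]]]] := pick_vecP r; first by rewrite eqxx.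
1, 2: rewrite aux//; have -> : (r == 0) = false; last by [].
1, 2: by apply/eqP => /ffunP /(_ i); rewrite rE ffvD unitvE eqxx ffv0 addn1.
- have [[-> ->]|[i [s [rE [-> <-]]]]] := pick_vecP r; first by [].
  have ki : total (k - tolat (unitv i)) = total k - 1.
    by rewrite totalD totalN total_unit.
  transitivity (\sum_(x <- box d (minn n m).+1)
      p i x * progeny_rec n (s + x) (k - tolat (unitv i))).
    apply: sum_box_widen => [|x _]; first by rewrite ltnS geq_minl.
    apply: contraNeq; rewrite mulf_eq0 negb_or => /andP[_ h].
    apply: (box_le (leqnSn _)); apply: progeny_rec_box h rE.
    by case: leqP; lia.
  transitivity (\sum_(x <- box d (minn n m).+1)
      p i x * progeny_rec m (s + x) (k - tolat (unitv i))); last first.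
    apply/esym/sum_box_widen => [|x _]; first by rewrite ltnS geq_minr.
    apply: contraNeq; rewrite mulf_eq0 negb_or => /andP[_ h].
    apply: (box_le (leqnSn _)); apply: progeny_rec_box h rE.
    by case: leqP; lia.
  by apply: eq_bigr => x _; congr (_ * _); apply: IH; rewrite ki; lia.
Qed.

Lemma progenyE n r k : total k <= n%:Z -> progeny r k = progeny_rec n r k.
Proof. by move=> kn; apply: progeny_rec_fuel => //; lia. Qed.

Lemma progeny_supp (r : vec) (k : lat) : progeny r k != 0 -> forall j, (r j)%:Z <= k j.
Proof. exact: progeny_rec_supp. Qed.

Lemma progeny_eq0 (r : vec) (k : lat) j : k j < (r j)%:Z -> progeny r k = 0.
Proof. exact: progeny_rec_eq0. Qed.

Lemma progeny0 k : progeny 0 k = (k == 0)%:R.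
Proof.
rewrite /progeny; case: `|total k|%N => [|n] /=; first by rewrite eqxx.
case: pickP => // i; by rewrite ffv0.
Qed.

Lemma progeny_box r i k x N : total k <= N%:Z ->
  progeny (r + x) (k - tolat (unitv i)) != 0 -> x \in box d N.
Proof.
move=> kN h; apply: (progeny_rec_box _ h (erefl (r + unitv i))).
by apply: le_trans kN _; rewrite lez_nat.
Qed.

(** The recursion may start with any individual, not only with the one picked by
    the definition: two deaths of different types commute. *)
Lemma progeny_kill r i k N : total k <= N%:Z ->
  progeny (r + unitv i) k =
  \sum_(x <- box d N) p i x * progeny (r + x) (k - tolat (unitv i)).
Proof.
have kneg j (k' : lat) : total k' <= 0 -> exists l, (k' - tolat (unitv j)) l < 0.
  move=> k0; apply: contrapT => /forallNP h.
  have : 0 <= total (k' - tolat (unitv j)).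
    by apply: sumr_ge0 => l _; rewrite leNgt; apply/negP; exact: h.
  by rewrite totalD totalN total_unit; lia.
suff H n : total k <= n%:Z -> (n <= N)%N ->
    progeny (r + unitv i) k =
    \sum_(x <- box d N) p i x * progeny (r + x) (k - tolat (unitv i)).
  move=> kN; have [k0|k0] := leP (total k) 0; first exact: (H 0%N).
  by apply: (H `|total k|%N); lia.
elim: n r i k => [|n IH] r i k kn nN.
  rewrite (progenyE _ kn) /= big1 => [|x _]; last first.
    have [l kl] := kneg i k kn; rewrite (@progeny_eq0 _ _ l) ?mulr0//.
    exact: lt_le_trans kl _.
  have -> : (r + unitv i == 0) = false; last by [].
  by apply/eqP => /ffunP /(_ i); rewrite ffvD unitvE eqxx ffv0 addn1.
rewrite (progenyE _ kn) /=.
have [[/ffunP /(_ i)]|[j [s [rE [-> <-]]]]] := pick_vecP (r + unitv i).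
  by rewrite ffvD unitvE eqxx ffv0 addn1.
have kj l : total (k - tolat (unitv l)) <= n%:Z.
  by rewrite totalD totalN total_unit; lia.
under eq_bigr do rewrite -(progenyE _ (kj j)).
rewrite -(sum_box_widen nN); last first.
  move=> x _; apply: contraNeq; rewrite mulf_eq0 negb_or => /andP[_].
  exact: progeny_box.
have [ji|ji] := eqVneq j i.
  rewrite ji in rE *; suff -> : s = r by [].
  apply/ffunP => l; move/ffunP/(_ l): rE; rewrite !ffvD.
  by move/eqP; rewrite eqn_add2r => /eqP.
(* Two distinct types are present: both individuals are made to die, in either order. *)
have [q [sE qE]] : exists q, s = q + unitv i /\ r = q + unitv j.
  have e l : (r l + (l == i) = s l + (l == j))%N.
    by move/ffunP/(_ l): rE; rewrite !ffvD !unitvE.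
  exists [ffun l => (s l - unitv i l)%N]; split; apply/ffunP => l;
    rewrite ffvD ffunE !unitvE; have := e l; have [->|li] := eqVneq l i;
    rewrite ?[i == j]eq_sym ?(negbTE ji) /=; lia.
rewrite sE qE.
transitivity (\sum_(x <- box d N) \sum_(y <- box d N)
    p j x * (p i y * progeny (q + x + y) (k - tolat (unitv j) - tolat (unitv i)))).
  apply: eq_bigr => x _.
  have /= H := IH (q + x) i (k - tolat (unitv j)) (kj j) (ltnW nN).
  rewrite (vaddAC q (unitv i) x).
  rewrite H.
  by rewrite mulr_sumr.
rewrite exchange_big /=; apply: eq_bigr => x _.
rewrite vaddAC IH ?(ltnW nN)// mulr_sumr; apply: eq_bigr => y _.
rewrite mulrCA (vaddAC q y x); congr (_ * (_ * progeny _ _)).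
exact: addrAC.
Qed.

End progeny.

Section progeny_conv.
Variables (R : realType) (d : nat).
Local Notation ty := 'I_d.+1.
Local Notation vec := {ffun ty -> nat}.
Local Notation lat := {ffun ty -> int}.

Lemma vec_case (r : vec) : r = 0 \/ exists i s, r = s + unitv i.
Proof.
have [[-> _]|[i [s [-> _]]]] := pick_vecP r; first by left.
by right; exists i, s.
Qed.

Lemma lat_nneg (k : lat) : (forall j, 0 <= k j) -> exists y : vec, k = tolat y.
Proof.
move=> k0; exists [ffun j => `|k j|%N]; apply/ffunP => j.
by rewrite !ffunE gez0_abs.
Qed.

(** Change of variables [y = z + w] in a sum over the orthant; the hypotheses say that
    nothing is lost on either side of the truncation. *)
Lemma sum_box_shift (W : nmodType) (f : lat -> W) (w : vec) (N : nat) :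
  (forall (v : lat) j, v j < 0 -> f v = 0) ->
  (forall z : vec, (N < vsize (z + w)%R)%N -> f (tolat z) = 0) ->
  \sum_(y <- box d N) f (tolat y - tolat w) = \sum_(z <- box d N) f (tolat z).
Proof.
move=> fneg fbig.
rewrite [RHS](bigID (fun z => (z + w)%R \in box d N))/= [X in _ + X]big1; last first.
  by move=> z; rewrite mem_box -ltnNge => /fbig.
rewrite addr0 -[RHS]big_filter.
rewrite (bigID (fun y : vec => [forall j, w j <= y j]%N))/= [X in _ + X]big1; last first.
  move=> y /forallPn[j]; rewrite -ltnNge => yw.
  by apply: (fneg _ j); rewrite !ffE !tolatE subr_lt0 ltz_nat.
rewrite addr0 -[LHS]big_filter.
rewrite (perm_big [seq z + w | z <- [seq z <- box d N | z + w \in box d N]])/=.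
  by rewrite big_map; apply: eq_bigr => z _; rewrite tolatD addrK.
apply: uniq_perm.
- by rewrite (filter_uniq _ (uniq_box _ _)).
- rewrite map_inj_uniq ?(filter_uniq _ (uniq_box _ _)) ?uniq_box// => y z /ffunP e.
  by apply/ffunP => j; have := e j; rewrite !ffvD => /addIn.
- move=> y; rewrite mem_filter; apply/andP/mapP.
    move=> [/forallP wy yN].
    have yE : y = [ffun j => (y j - w j)%N] + w.
      by apply/ffunP => j; rewrite ffvD ffunE subnK.
    exists [ffun j => (y j - w j)%N] => //; rewrite mem_filter -yE yN/=.
    by move: yN; rewrite !mem_box {1}yE vsizeD; apply: leq_trans; rewrite leq_addr.
  move=> [z]; rewrite mem_filter => /andP[zN _] ->; split => //.
  by apply/forallP => j; rewrite ffvD leq_addl.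
Qed.

Variable p : ty -> vec -> R.

Lemma progeny_total (r : vec) (k : lat) : progeny p r k != 0 -> (vsize r)%:Z <= total k.
Proof.
by move=> /progeny_supp h; rewrite -total_tolat; apply: ler_sum => j _; rewrite tolatE.
Qed.

(** The progenies of two disjoint parts of a forest are independent. *)
Lemma progeny_conv (r r' : vec) (k : lat) N : total k <= N%:Z ->
  progeny p (r + r') k =
  \sum_(y <- box d N) progeny p r (tolat y) * progeny p r' (k - tolat y).
Proof.
suff H n : total k <= n%:Z -> (n <= N)%N -> progeny p (r + r') k =
  \sum_(y <- box d N) progeny p r (tolat y) * progeny p r' (k - tolat y).
  move=> kN; have [k0|k0] := leP (total k) 0; first exact: (H 0%N).
  by apply: (H `|total k|%N); lia.
elim: n r k => [|n IH] r k kn nN.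
all: have [->|[i [s ->]]] := vec_case r.
1, 3: rewrite vadd0 (sum_box_single (z := 0)) ?mem_box ?vsize0//;
  [by rewrite progeny0 tolat0 eqxx mul1r subr0
  |by move=> y y0; rewrite progeny0 -tolat0 (inj_eq (@tolat_inj d)) (negbTE y0) mul0r].
- rewrite big1 => [|y _].
    apply/eqP; apply: contraTT kn => /progeny_total.
    by rewrite !vsizeD vsize_unit; lia.
  apply/eqP; apply: contraTT kn; rewrite mulf_eq0 negb_or => /andP[/progeny_total h1].
  move=> /progeny_total; move: h1.
  by rewrite totalD totalN total_tolat !vsizeD vsize_unit; lia.
- have kn1 : total (k - tolat (unitv i)) <= n%:Z.
    by rewrite totalD totalN total_unit; lia.
  rewrite vaddAC (@progeny_kill _ _ _ _ _ _ N); last by lia.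
  transitivity (\sum_(x <- box d N) \sum_(y <- box d N)
      p i x * (progeny p (s + x) (tolat y - tolat (unitv i)) *
               progeny p r' (k - tolat y))).
    apply: eq_bigr => x _; rewrite vaddAC (IH _ _ kn1 (ltnW nN)) mulr_sumr.
    apply/esym.
    pose fv v := p i x * (progeny p (s + x) v *
       progeny p r' (k - tolat (unitv i) - v)).
    transitivity (\sum_(y <- box d N) fv (tolat y - tolat (unitv i))).
      by apply: eq_bigr => y _; rewrite /fv opprB addrA subrK.
    apply: sum_box_shift => [v j vj|z zN]; rewrite {}/fv.
      rewrite (@progeny_eq0 _ _ _ _ _ j) ?mul0r ?mulr0//.
      exact: lt_le_trans vj _.
    apply/eqP; apply: contraTT zN.
    rewrite !mulf_eq0 !negb_or => /and3P[_ _ /progeny_total].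
    rewrite totalD totalN total_tolat -leqNgt vsizeD vsize_unit.
    by move=> h1; rewrite -lez_nat; lia.
  rewrite exchange_big /=; apply: eq_big_seq => y yN.
  rewrite (@progeny_kill _ _ _ _ _ _ N) ?mulr_suml; last first.
    by rewrite total_tolat; move: yN; rewrite mem_box.
  by apply: eq_bigr => x _; rewrite mulrA.
Qed.

Hypothesis p_ge0 : forall i x, 0 <= p i x.

Lemma progeny_ge0 r k : 0 <= progeny p r k.
Proof.
rewrite /progeny; move: `|total k|%N => n; elim: n r k => [|n IH] r k /=.
  exact: ler0n.
case: pickP => [i _|_]; last exact: ler0n.
by apply: sumr_ge0 => x _; apply: mulr_ge0.
Qed.

Lemma progeny_ge_conv (r r' : vec) (k k' : lat) :
  progeny p r k * progeny p r' k' <= progeny p (r + r') (k + k').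
Proof.
have [->|rk] := eqVneq (progeny p r k) 0; first by rewrite mul0r progeny_ge0.
have [y kE] : exists y, k = tolat y.
  by apply: lat_nneg => j; apply: le_trans (progeny_supp rk j).
rewrite kE (@progeny_conv _ _ _ (`|total (tolat y + k')%R| + vsize y)%N); last by lia.
rewrite (bigD1_seq y) ?uniq_box//=; last by rewrite mem_box leq_addl.
rewrite addrAC subrr add0r lerDl sumr_ge0// => z _.
by rewrite mulr_ge0 ?progeny_ge0.
Qed.

Lemma progeny_ge_kill (r x : vec) i (k : lat) :
  p i x * progeny p (r + x) k <= progeny p (r + unitv i) (k + tolat (unitv i)).
Proof.
rewrite (@progeny_kill _ _ _ _ _ _ (`|total (k + tolat (unitv i))%R| + vsize x)%N); last by lia.
rewrite (bigD1_seq x) ?uniq_box//=; last by rewrite mem_box leq_addl.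
rewrite addrK lerDl sumr_ge0// => z _.
by rewrite mulr_ge0 ?progeny_ge0.
Qed.

End progeny_conv.

Section esum_box.
Variables (R : realType) (d : nat).
Local Notation ty := 'I_d.+1.
Local Notation vec := {ffun ty -> nat}.
Local Notation lat := {ffun ty -> int}.
Local Open Scope ereal_scope.

Lemma esumZl (T : choiceType) (A : set T) (a : T -> \bar R) (c : R) :
  (0 <= c)%R -> (forall i, 0 <= a i) ->
  \esum_(i in A) (c%:E * a i) = c%:E * \esum_(i in A) a i.
Proof.
move=> c0 a0; rewrite /esum -ereal_supZl//; last first.
  by apply/set0P; exists (\sum_(x \in set0) a x); exists set0 => //; exact: fsets_set0.
congr ereal_sup; apply/seteqP; split=> [_ [X XA <-]|_ [_ [X XA <-] <-]].
  exists (\sum_(x \in X) a x); first by exists X.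
  by rewrite ge0_mule_fsumr.
by exists X => //; rewrite ge0_mule_fsumr.
Qed.

Lemma esum_box_le (f : vec -> \bar R) (C : \bar R) : (forall y, 0 <= f y) ->
  (forall N, \sum_(y <- box d N) f y <= C) -> \esum_(y in [set: vec]) f y <= C.
Proof.
move=> f0 fC; apply: ge_ereal_sup => _ [X [finX _] <-].
have [N XN] : exists N, forall y, X y -> y \in box d N.
  exists (\max_(y <- fset_set X) vsize y)%N => y Xy; rewrite mem_box.
  by apply: leq_bigmax_seq => //; rewrite in_fset_set// inE.
apply: le_trans (fC N).
rewrite fsbig_finite//=.
rewrite [leRHS](bigID (fun y => y \in fset_set X))/=.
apply: le_trans (leeDl _ _); last by apply: sume_ge0.
rewrite -[leRHS]big_filter le_eqVlt; apply/orP; left; apply/eqP/perm_big.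
apply: uniq_perm; rewrite ?fset_uniq ?(filter_uniq _ (uniq_box _ _)) ?uniq_box// => y.
by rewrite mem_filter; apply/idP/andP => [yX|[]//]; split => //;
  apply: XN; move: yX; rewrite in_fset_set// inE.
Qed.

Lemma box_esum_le (f : vec -> \bar R) N : (forall y, 0 <= f y) ->
  \sum_(y <- box d N) f y <= \esum_(y in [set: vec]) f y.
Proof.
move=> f0; apply: esum_ge; exists [set` box d N]; first by split; [exact: finite_seq|].
by rewrite -fsbig_seq ?uniq_box.
Qed.

Lemma esum_box (f : vec -> \bar R) N : (forall y, 0 <= f y) ->
  (forall y, y \notin box d N -> f y = 0) ->
  \esum_(y in [set: vec]) f y = \sum_(y <- box d N) f y.
Proof.
move=> f0 fN; apply/eqP; rewrite eq_le; apply/andP; split; last exact: box_esum_le.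
apply: esum_box_le => // M.
rewrite -(@sum_box_widen _ _ _ N (maxn N M)) ?leq_maxl//; last by move=> y _ /fN ->.
rewrite [leRHS](bigID (fun y => y \in box d M))/=.
apply: le_trans (leeDl _ _); last by apply: sume_ge0.
rewrite -[leRHS]big_filter le_eqVlt; apply/orP; left; apply/eqP/perm_big.
apply: uniq_perm; rewrite ?(filter_uniq _ (uniq_box _ _)) ?uniq_box// => y.
rewrite [RHS]mem_filter; apply/idP/andP => [yX|[]//]; split => //.
by apply: box_le yX; exact: leq_maxr.
Qed.

Lemma esum_shift (f : lat -> \bar R) (w : vec) : (forall v, 0 <= f v) ->
  (forall (v : lat) j, (v j < 0)%R -> f v = 0) ->
  \esum_(y in [set: vec]) f (tolat y - tolat w)%R = \esum_(z in [set: vec]) f (tolat z).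
Proof.
move=> f0 fneg.
rewrite (esumID (range (fun z : vec => z + w)%R))//.
rewrite [X in _ + X]esum1 ?adde0; last first.
  move=> y [_ /= yw]; apply: contra_notP yw => fy.
  have [z zE] : exists z, (tolat y - tolat w = tolat z)%R.
    by apply: lat_nneg => j; rewrite leNgt; apply/negP => /fneg /fy.
  exists z => //; apply: tolat_inj; rewrite tolatD -zE subrK//.
rewrite setTI esum_image; last first.
  move=> y z _ _ /ffunP e.
  by apply/ffunP => j; have := e j; rewrite !ffvD => /addIn.
by apply: eq_esum => z _; rewrite tolatD addrK.
Qed.

End esum_box.

(** * Random walks on the lattice *)

Section walk.
Variables (R : realType) (d : nat).
Local Notation ty := 'I_d.+1.
Local Notation vec := {ffun ty -> nat}.
Local Notation lat := {ffun ty -> int}.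
Implicit Types (q : vec -> R) (x : lat).

(** The probability that the random walk with step law [q] is at [x] at time [n]. *)
Fixpoint walk q (n : nat) x : R :=
  if n is m.+1 then \sum_(y <- box d `|total x|) q y * walk q m (x - tolat y)
  else (x == 0)%:R.

Lemma walk_neg q n x j : x j < 0 -> walk q n x = 0.
Proof.
elim: n x => [|n IH] x xj /=.
  by case: eqP => // x0; move: xj; rewrite x0 ffl0 ltxx.
apply: big1 => y _; rewrite IH ?mulr0// !ffE tolatE.
by apply: le_lt_trans xj; rewrite lerBlDr; lia.
Qed.

Lemma walk_supp q n x : walk q n x != 0 -> forall j, 0 <= x j.
Proof. by move=> h j; rewrite leNgt; apply: contra_neqN h => /walk_neg ->. Qed.

Lemma walk_total q n x : walk q n x != 0 -> 0 <= total x.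
Proof. by move=> /walk_supp h; apply: sumr_ge0. Qed.

Lemma walkS q n x N : total x <= N%:Z ->
  walk q n.+1 x = \sum_(y <- box d N) q y * walk q n (x - tolat y).
Proof.
move=> xN /=; set M := `|total x|%N.
have fin K : total x <= K%:Z -> \sum_(y <- box d (maxn M N)) q y * walk q n (x - tolat y) =
    \sum_(y <- box d K) q y * walk q n (x - tolat y) \/ (maxn M N < K)%N.
  move=> xK; have [KMN|KMN] := ltnP (maxn M N) K; [by right|left].
  apply: sum_box_widen => // y _; apply: contraNeq.
  rewrite mulf_eq0 negb_or mem_box => /andP[_ /walk_total].
  by rewrite totalD totalN total_tolat; lia.
have xM : total x <= M%:Z by rewrite /M; lia.
have [<-|] := fin M xM; last by rewrite ltnNge leq_maxl.
by have [<-|] := fin N xN; last by rewrite ltnNge leq_maxr.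
Qed.

(** Exchangeability: the steps of the walk play symmetric roles, so that given
    the endpoint [x] the expected [j]-th coordinate of the first of [n.+1] steps is
    [x j / n.+1]. *)
Lemma walk_exchange q n x (j : ty) N : total x <= N%:Z ->
  n.+1%:R * (\sum_(y <- box d N) (y j)%:R * (q y * walk q n (x - tolat y))) =
  (x j)%:~R * walk q n.+1 x.
Proof.
elim: n x => [|n IH] x xN.
  rewrite mul1r (walkS _ _ xN) mulr_sumr; apply: eq_bigr => y _ /=.
  case: eqP => [/eqP|]; last by rewrite !mulr0.
  by rewrite subr_eq0 => /eqP ->; rewrite tolatE.
rewrite (walkS _ _ xN) [RHS]mulr_sumr.
transitivity (\sum_(y <- box d N) q y * ((x - tolat y) j)%:~R * walk q n.+1 (x - tolat y)
   + \sum_(y <- box d N) (y j)%:R * (q y * walk q n.+1 (x - tolat y))); last first.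
  rewrite -big_split; apply: eq_bigr => y _ /=.
  rewrite !ffE tolatE rmorphB /= mulrBr mulrBl; ring.
rewrite -[in LHS]addn1 natrD mulrDl mul1r; congr (_ + _).
have tot y : total (x - tolat y) <= N%:Z by rewrite totalD totalN total_tolat; lia.
under [RHS]eq_bigr => y _ do rewrite -mulrA -(IH _ (tot y)) mulrCA mulr_sumr.
rewrite -mulr_sumr; congr (_ * _).
under eq_bigr => y _ do rewrite (walkS _ _ (tot y)) !mulr_sumr.
rewrite exchange_big /=; apply: eq_bigr => y _; apply: eq_bigr => z _.
rewrite [x - _ - _]addrAC; ring.
Qed.

(** Unnormalized exponential change of measure which rewards the steps equal to [z]. *)
Definition tilt q (z : vec) (theta : R) (y : vec) : R :=
  q y * (if y == z then expR theta else 1).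

(** Jensen's inequality for the number [K] of steps equal to [z] of the walk
    conditioned to end at [x], in the form [e^(theta K) >= e^(theta m) (1 + theta (K - m))];
    the weight [theta * n * q z * walk (n - 1) (x - z)] is the contribution
    of [theta * K]. Having [m] free is what makes the induction on [n] go through. *)
Lemma walk_tilt_ge q z theta n x (m : R) : (forall y, 0 <= q y) ->
  expR (theta * m) * ((1 - theta * m) * walk q n x +
     theta * n%:R * q z * walk q n.-1 (x - tolat z)) <= walk (tilt q z theta) n x.
Proof.
move=> q0; elim: n x m => [|n IH] x m.
  rewrite mulr0 !mul0r addr0 /= mulrA.
  rewrite -[leRHS]mul1r ler_wpM2r ?ler0n//.
  rewrite -ler_pdivlMl ?expR_gt0// mulr1 -expRN.
  by rewrite -mulNr expR_ge1Dx.
pose N := maxn `|total x|%N (vsize z).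
have xN : total x <= N%:Z by rewrite /N; lia.
have tot y : total (x - tolat y) <= N%:Z by rewrite totalD totalN total_tolat; lia.
have zN : z \in box d N by rewrite mem_box leq_maxr.
rewrite (walkS _ _ xN) (walkS _ _ xN) /=.
pose mm y := m - (y == z)%:R.
apply: (@le_trans _ _ (\sum_(y <- box d N) tilt q z theta y *
  (expR (theta * mm y) * ((1 - theta * mm y) * walk q n (x - tolat y) +
     theta * n%:R * q z * walk q n.-1 (x - tolat y - tolat z))))); last first.
  apply: ler_sum => y _; apply: ler_wpM2l; last exact: IH.
  by rewrite /tilt mulr_ge0//; case: ifP => // _; exact: expR_ge0.
have tiltE y : tilt q z theta y * expR (theta * mm y) = q y * expR (theta * m).
  rewrite /tilt /mm; case: eqP => _; last by rewrite subr0 mulr1.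
  by rewrite -mulrA -expRD mulrBr mulr1 addrC subrK.
rewrite le_eqVlt; apply/orP; left; apply/eqP.
under [RHS]eq_bigr => y _ do rewrite mulrA tiltE.
transitivity (expR (theta * m) * ((1 - theta * m) *
     (\sum_(y <- box d N) q y * walk q n (x - tolat y))
   + theta * (\sum_(y <- box d N) (y == z)%:R * (q y * walk q n (x - tolat y)))
   + theta * n%:R * q z * \sum_(y <- box d N) q y * walk q n.-1 (x - tolat y - tolat z))).
  congr (_ * _); rewrite -addrA; congr (_ + _).
  rewrite (sum_box_single zN) ?eqxx; last by move=> y /negbTE->; rewrite mul0r.
  case: n {IH} => [|n]; first by rewrite /=; ring.
  have -> : \sum_(y <- box d N) q y * walk q n (x - tolat y - tolat z) =
      walk q n.+1 (x - tolat z).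
    rewrite (walkS _ _ (tot z)); apply: eq_bigr => y _.
    by rewrite [x - _ - _]addrAC.
  by rewrite -!natr1 /=; ring.
rewrite !mulr_sumr -!big_split mulr_sumr; apply: eq_bigr => y _ /=.
rewrite /mm; ring.
Qed.

Lemma walk_le q n x (C : R) : (forall y, 0 <= q y) ->
  (forall N, \sum_(y <- box d N) q y <= C) -> walk q n x <= C ^+ n.
Proof.
move=> q0 qC; have C0 : 0 <= C by apply: le_trans (qC 0%N); exact: sumr_ge0.
elim: n x => [|n IH] x /=; first by rewrite expr0; case: eqP.
apply: (@le_trans _ _ (\sum_(y <- box d `|total x|) q y * C ^+ n)).
  by apply: ler_sum => y _; exact: ler_wpM2l.
by rewrite -mulr_suml exprS ler_wpM2r// exprn_ge0.
Qed.

Lemma walk_ge0 q n x : (forall y, 0 <= q y) -> 0 <= walk q n x.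
Proof.
move=> q0; elim: n x => [|n IH] x /=; first exact: ler0n.
by apply: sumr_ge0 => y _; exact: mulr_ge0.
Qed.

(** The trajectories in which the step [z] occurs exactly [c z] times for every [z]
    have a multinomial total weight; the factorials are kept in the numerators. *)
Lemma walk_multinomial q (A : seq vec) (c : vec -> nat) : (forall y, 0 <= q y) ->
  uniq A ->
  (\sum_(z <- A) c z)`!%:R * \prod_(z <- A) q z ^+ c z <=
  walk q (\sum_(z <- A) c z) (\sum_(z <- A) tolat z *+ c z) *
  \prod_(z <- A) (c z)`!%:R.
Proof.
move=> q0 uA; move sE : (\sum_(z <- A) c z)%N => s.
elim: s c sE => [|s IH] c sE.
  have c0 z : z \in A -> c z = 0%N.
    move=> zA; apply/eqP; rewrite -leqn0 -sE (bigD1_seq z)//= leq_addr//.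
  rewrite [X in X <= _](_ : _ = 1); last first.
    by rewrite big1_seq ?mulr1// => z /= zA; rewrite c0.
  rewrite [X in walk _ _ X]big1_seq => [|z /= zA]; last by rewrite c0.
  by rewrite /= eqxx mul1r big1_seq// => z /= zA; rewrite c0.
set x := \sum_(z <- A) _.
have -> : walk q s.+1 x = \sum_(y <- box d (maxn `|total x|%N (\max_(z <- A) vsize z)))
    q y * walk q s (x - tolat y).
  by apply: walkS; lia.
set N := maxn _ _.
have AN z : z \in A -> z \in box d N.
  by move=> zA; rewrite mem_box leq_max; apply/orP; right; exact: leq_bigmax_seq.
apply: (@le_trans _ _ ((\sum_(z <- A | (0 < c z)%N) q z * walk q s (x - tolat z)) *
    \prod_(z <- A) (c z)`!%:R)); last first.
  apply: ler_wpM2r; first by apply: prodr_ge0 => z _; exact: ler0n.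
  rewrite [leRHS](bigID (fun z => (z \in A) && (0 < c z)%N))/=.
  rewrite -[leLHS]addr0 lerD ?sumr_ge0// => [|z _]; last by rewrite mulr_ge0 ?walk_ge0.
  rewrite -[leLHS]big_filter -[leRHS]big_filter le_eqVlt; apply/orP; left; apply/eqP.
  apply/perm_big/uniq_perm; rewrite ?(filter_uniq _ (uniq_box _ _)) ?filter_uniq// => z.
  by rewrite [in LHS]mem_filter [in RHS]mem_filter andbC; case: (boolP (z \in A)) => // /AN ->; rewrite andbT.
rewrite mulr_suml.
apply: (@le_trans _ _ (\sum_(z <- A | (0 < c z)%N) (c z)%:R * (s`!%:R * \prod_(z <- A) q z ^+ c z))).
  rewrite -mulr_suml factS natrM -sE natr_sum -mulrA.
  rewrite [X in X * _ <= _](bigID (fun z => (0 < c z)%N))/= [X in _ + X]big1 ?addr0// => z.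
  by rewrite -eqn0Ngt => /eqP ->.
rewrite big_seq_cond [leRHS]big_seq_cond; apply: ler_sum => z /andP[zA cz].
pose c' y := (c y - (y == z))%N.
have cE y : c y = (c' y + (y == z))%N by rewrite /c'; have [->|_] := eqVneq y z; lia.
have sc' : (\sum_(z <- A) c' z = s)%N.
  apply: succn_inj; rewrite -sE (bigD1_seq z)//= [in RHS](bigD1_seq z)//= cE eqxx addn1 addSn.
  by congr (_ + _).+1; apply: eq_bigr => y yz; rewrite cE (negbTE yz) addn0.
have xE : x - tolat z = \sum_(z <- A) tolat z *+ c' z.
  rewrite /x (bigD1_seq z)//= [in RHS](bigD1_seq z)//= cE eqxx addn1 mulrS.
  rewrite -addrA [X in X - _]addrC addrK; congr (_ + _).
  by apply: eq_bigr => y yz; rewrite cE (negbTE yz) addn0.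
have fE : \prod_(z <- A) (c z)`!%:R = (c z)%:R * \prod_(z <- A) (c' z)`!%:R :> R.
  rewrite (bigD1_seq z)//= [in RHS](bigD1_seq z)//= cE eqxx addn1 factS natrM -!mulrA.
  by congr (_ * (_ * _)); apply: eq_bigr => y yz; rewrite cE (negbTE yz) addn0.
have pE : \prod_(z <- A) q z ^+ c z = q z * \prod_(z <- A) q z ^+ c' z.
  rewrite (bigD1_seq z)//= [in RHS](bigD1_seq z)//= cE eqxx addn1 exprS -!mulrA.
  by congr (_ * (_ * _)); apply: eq_bigr => y yz; rewrite cE (negbTE yz) addn0.
rewrite xE fE pE.
have := IH c' sc'.
set a := _ * _; set b := _ * _ => h.
have -> : q z * walk q s (\sum_(z0 <- A) tolat z0 *+ c' z0) *
    ((c z)%:R * \prod_(z0 <- A) ((c' z0)`!)%:R) = (c z)%:R * (q z * b) by rewrite /b; ring.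
have -> : (c z)%:R * ((s`!)%:R * (q z * \prod_(z0 <- A) q z0 ^+ c' z0)) =
   (c z)%:R * (q z * a) by rewrite /a; ring.
by rewrite ler_wpM2l// ler_wpM2l.
Qed.

End walk.

(** * Lower bound for the walk near its mean displacement *)

Section factorial_bounds.
Variable R : realType.

(** Stirling's formula up to a factor linear in [n], which the exponential scale
    does not see. *)
Lemma natr_succ_exp_le n : n.+1%:R ^+ n <= n%:R ^+ n * expR 1 :> R.
Proof.
case: n => [|n]; first by rewrite !expr0 mul1r -[leLHS]expR0 ler_expR.
have n0 : n.+1%:R != 0 :> R by rewrite pnatr_eq0.
have -> : n.+2%:R = n.+1%:R * (1 + n.+1%:R^-1) :> R.
  by rewrite mulrDr mulr1 divff// natr1.
rewrite exprMn ler_wpM2l ?exprn_ge0//.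
rewrite -[1 in leRHS](mulVf n0) expRM_natr lerXn2r ?nnegrE ?expR_ge0 ?addr_ge0 ?invr_ge0//.
exact: expR_ge1Dx.
Qed.

Lemma natr_exp_le_fact n : n%:R ^+ n <= n`!%:R * expR n%:R :> R.
Proof.
elim: n => [|n IH]; first by rewrite expr0 fact0 expR0 mulr1.
rewrite exprS factS natrM -natr1 expRD natr1 -mulrA ler_wpM2l//.
apply: le_trans (natr_succ_exp_le n) _.
by rewrite mulrA ler_wpM2r ?expR_ge0.
Qed.

Lemma fact_le_natr_exp n :
  n`!%:R * expR n%:R <= expR 1 * n.+1%:R * n%:R ^+ n :> R.
Proof.
suff H m : m.+1`!%:R * expR m.+1%:R <= expR 1 * m.+1%:R * m.+1%:R ^+ m.+1 :> R.
  case: n => [|n].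
    by rewrite fact0 expR0 !mulr1 -[leLHS]expR0 ler_expR.
  apply: le_trans (H n) _; rewrite ler_wpM2r ?exprn_ge0//.
  by rewrite ler_wpM2l ?expR_ge0// ler_nat.
elim: m => [|m IH]; first by rewrite expr1 !mulr1 mul1r.
rewrite factS natrM -[in expR _]natr1 expRD.
have -> : m.+2%:R * m.+1`!%:R * (expR m.+1%:R * expR 1) =
   m.+2%:R * expR 1 * (m.+1`!%:R * expR m.+1%:R) :> R by ring.
apply: (@le_trans _ _ (m.+2%:R * expR 1 * (expR 1 * m.+1%:R * m.+1%:R ^+ m.+1))).
  by rewrite ler_wpM2l// mulr_ge0// expR_ge0.
have -> : m.+2%:R * expR 1 * (expR 1 * m.+1%:R * m.+1%:R ^+ m.+1) =
  (expR 1 * m.+2%:R) * (expR 1 * m.+1%:R ^+ m.+2) :> R by rewrite [in RHS]exprS; ring.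
apply: ler_wpM2l; first by rewrite mulr_ge0// expR_ge0.
have n0 : m.+2%:R != 0 :> R by rewrite pnatr_eq0.
have -> : m.+1%:R = m.+2%:R * (1 - m.+2%:R^-1) :> R.
  by rewrite mulrBr mulr1 divff// -[m.+2%:R]natr1 addrK.
rewrite exprMn mulrCA ler_piMr ?exprn_ge0//.
have : (1 - m.+2%:R^-1) ^+ m.+2 <= expR (- m.+2%:R^-1) ^+ m.+2 :> R.
  rewrite lerXn2r ?nnegrE ?expR_ge0//; last exact: expR_ge1Dx.
  by rewrite subr_ge0 invf_le1// ler1n.
rewrite -expRM_natr mulNr mulVf// => h.
apply: (@le_trans _ _ (expR 1 * expR (- 1))); last by rewrite -expRD subrr expR0.
by rewrite ler_wpM2l ?expR_ge0.
Qed.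

Lemma poly_le_expR (b : nat) (delta : R) : 0 < delta ->
  exists n0 : nat, forall n, (n0 <= n)%N ->
    (expR 1 * n.+1%:R) ^+ b <= expR (delta * n%:R).
Proof.
move=> d0; case: b => [|b].
  exists 0%N => n _; rewrite expr0 -[leLHS]expR0 ler_expR.
  by rewrite mulr_ge0// ltW.
pose c := delta / b.+1%:R.
have c0 : 0 < c by rewrite divr_gt0.
have e0 : 0 < expR 1 :> R by exact: expR_gt0.
pose B := expR 1 * 8 / c ^+ 2.
exists (Num.truncn B).+1 => n nB.
have nB' : B < n%:R.
  by apply: lt_le_trans (truncnS_gt _) _; rewrite ler_nat.
have n1 : 1 <= n%:R :> R by rewrite ler1n (leq_trans _ nB).
have -> : delta * n%:R = (c * n%:R) * b.+1%:R by rewrite /c mulrAC divfK.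
rewrite expRM_natr lerXn2r ?nnegrE ?expR_ge0 ?mulr_ge0 ?expR_ge0//.
have -> : c * n%:R = (c * n%:R / 2) * 2%:R by rewrite divfK.
rewrite expRM_natr.
have h1 : 1 + c * n%:R / 2 <= expR (c * n%:R / 2) by exact: expR_ge1Dx.
apply: (@le_trans _ _ ((c * n%:R / 2) ^+ 2)); last first.
  rewrite lerXn2r ?nnegrE ?expR_ge0 ?divr_ge0 ?mulr_ge0 ?(ltW d0)//.
  by apply: le_trans h1; rewrite lerDr.
apply: (@le_trans _ _ (expR 1 * (2 * n%:R))).
  by rewrite ler_wpM2l ?(ltW e0)// -natr1; lra.
have : B * c ^+ 2 <= n%:R * c ^+ 2 by rewrite ler_wpM2r ?sqr_ge0// ltW.
rewrite /B divfK ?sqrf_eq0 ?gt_eqF// => h2.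
have -> : (c * n%:R / 2) ^+ 2 = (n%:R * c ^+ 2) * n%:R / 4 by field.
have : expR 1 * 8 * n%:R <= n%:R * c ^+ 2 * n%:R by rewrite ler_wpM2r.
move=> h3; rewrite ler_pdivlMr//; apply: le_trans h3.
by rewrite le_eqVlt; apply/orP; left; apply/eqP; ring.
Qed.

Lemma exists_small (T : eqType) (s : seq T) (a b : T -> R) :
  (forall z, 0 <= a z) -> (forall z, 0 <= b z) -> (forall z, b z = 0 -> a z = 0) ->
  exists2 eta : R, 0 < eta & forall z, z \in s -> eta * a z <= b z.
Proof.
move=> a0 b0 ba; elim: s => [|x s [e e0 eP]]; first by exists 1.
have [e' e'0 e'P] : exists2 e', 0 < e' & e' * a x <= b x.
  have [bx|bx] := eqVneq (b x) 0; first by exists 1; rewrite // ba// mulr0.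
  have a1 : 0 < a x + 1 by rewrite ltr_wpDl.
  exists (b x / (a x + 1)); first by rewrite divr_gt0// lt_neqAle eq_sym bx b0.
  by rewrite mulrAC ler_pdivrMr// ler_wpM2l// lerDl.
exists (Num.min e e') => [|z]; first by rewrite lt_min e0.
rewrite inE => /orP[/eqP->|/eP zs]; [apply: le_trans e'P|apply: le_trans zs];
  by rewrite ler_wpM2r// ge_min lexx ?orbT.
Qed.

End factorial_bounds.

Section walk_lower.
Variables (R : realType) (d : nat).
Local Notation ty := 'I_d.+1.
Local Notation vec := {ffun ty -> nat}.
Local Notation lat := {ffun ty -> int}.
Variable (q : vec -> R).

(** Aperiodicity of the walk in space-time: the extra coordinate [1] of a step records
    time, so that both the length and the endpoint of a walk can be changed. *)
Definition spans : Prop := forall H : set (int * lat), is_subgroup H ->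
  (forall z, 0 < q z -> H (1, tolat z)) -> forall u, H u.

Lemma spans_coef : spans -> forall u : int * lat, exists N (c : vec -> int),
  [/\ forall z, q z = 0 -> c z = 0, forall z, z \notin box d N -> c z = 0,
      \sum_(z <- box d N) c z = u.1 &
      forall j, \sum_(z <- box d N) (z j)%:Z * c z = u.2 j].
Proof.
move=> sp u.
pose H : set (int * lat) := [set u : int * lat | exists N (c : vec -> int),
  [/\ forall z, q z = 0 -> c z = 0, forall z, z \notin box d N -> c z = 0,
      \sum_(z <- box d N) c z = u.1 &
      forall j, \sum_(z <- box d N) (z j)%:Z * c z = u.2 j]].
apply: (sp H) => {u}; last first.
  move=> z qz; exists (vsize z), (fun y => (y == z)%:Z); split.
  - by move=> y qy; case: eqP => // yz; move: qz; rewrite -yz qy ltxx.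
  - by move=> y; have [->|] := eqVneq y z; rewrite ?mem_box ?leqnn.
  - rewrite (sum_box_single (z := z)) ?mem_box ?eqxx//.
    by move=> y /negbTE ->.
  - move=> j; rewrite (sum_box_single (z := z)) ?mem_box ?eqxx ?mulr1 ?tolatE//.
    by move=> y /negbTE ->; rewrite mulr0.
split=> [|x y].
    exists 0%N, (fun=> 0); split => //= [|j]; first by rewrite big1.
    by rewrite big1 ?ffl0// => z _; rewrite mulr0.
  move=> [N1 [c1 [q1 b1 s1 t1]]] [N2 [c2 [q2 b2 s2 t2]]].
  exists (maxn N1 N2), (fun z => c1 z - c2 z).
  have w1 (f : vec -> int) : \sum_(z <- box d (maxn N1 N2)) f z * c1 z =
      \sum_(z <- box d N1) f z * c1 z.
    by apply: sum_box_widen; [exact: leq_maxl|move=> z _ /b1 ->; rewrite mulr0].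
  have w2 (f : vec -> int) : \sum_(z <- box d (maxn N1 N2)) f z * c2 z =
      \sum_(z <- box d N2) f z * c2 z.
    by apply: sum_box_widen; [exact: leq_maxr|move=> z _ /b2 ->; rewrite mulr0].
  split.
  - by move=> z qz; rewrite q1// q2// subrr.
  - move=> z zN; rewrite b1 ?b2 ?subrr//; apply: contra zN => h; apply: box_le h.
      exact: leq_maxr.
    exact: leq_maxl.
  - rewrite sumrB /= -s1 -s2; congr (_ - _).
      by apply: sum_box_widen; [exact: leq_maxl|move=> z _ /b1].
    by apply: sum_box_widen; [exact: leq_maxr|move=> z _ /b2].
  - move=> j; under eq_bigr do rewrite mulrBr.
    by rewrite sumrB w1 w2 t1 t2 /= !ffE.
Qed.

Hypothesis q_ge0 : forall y, 0 <= q y.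

(** When the counts are close to [n * q z], the multinomial weight is close to the
    probability that the empirical law of the steps is [q], which is not exponentially small. *)
Lemma walk_lower_counts (A : seq vec) (c : vec -> nat) (delta : R) (n : nat) (x : lat) :
  uniq A -> 0 <= delta -> (\sum_(z <- A) c z)%N = n ->
  \sum_(z <- A) tolat z *+ c z = x ->
  (forall z, z \in A -> (c z)%:R <= (1 + delta) * (n%:R * q z)) ->
  1 <= walk q n x * (expR 1 * n.+1%:R) ^+ size A * (1 + delta) ^+ n.
Proof.
move=> uA d0 nE xE cP.
have := walk_multinomial c q_ge0 uA; rewrite nE xE => h.
set Pq := \prod_(z <- A) q z ^+ c z in h.
have Pq0 : 0 < Pq.
  rewrite /Pq big_seq; apply: prodr_gt0 => z zA.
  case cz : (c z) => [|m]; first by rewrite expr0.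
  rewrite exprn_gt0// lt_neqAle q_ge0 andbT eq_sym; apply/eqP => qz.
  by have := cP _ zA; rewrite cz qz !mulr0 lern0.
have hf : \prod_(z <- A) ((c z)`!%:R * expR (c z)%:R) <=
    (expR 1 * n.+1%:R) ^+ size A * ((1 + delta) * n%:R) ^+ n * Pq.
  apply: (@le_trans _ _ (\prod_(z <- A) ((expR 1 * n.+1%:R) *
     (((1 + delta) * n%:R) ^+ c z * q z ^+ c z)))).
    rewrite [leLHS]big_seq [leRHS]big_seq; apply: ler_prod => z zA.
    rewrite mulr_ge0 ?expR_ge0//=.
    apply: le_trans (fact_le_natr_exp _ _) _.
    apply: ler_pM; rewrite ?mulr_ge0 ?expR_ge0 ?exprn_ge0//.
      rewrite ler_wpM2l ?expR_ge0// ler_nat ltnS -nE (bigD1_seq z)//=.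
      exact: leq_addr.
    rewrite -exprMn lerXn2r ?nnegrE ?mulr_ge0 ?addr_ge0//.
    by rewrite -mulrA cP.
  rewrite big_split /= [X in _ * X]big_split/= -/Pq mulrA; apply: ler_wpM2r; first exact: ltW.
  rewrite big_const_seq count_predT iter_mulr_1 -[X in _ <= _ * _ ^+ X]nE expr_sum; apply: ler_wpM2l => //.
move: hf; rewrite big_split/= -expR_sum -natr_sum nE => hf.
have w0 := walk_ge0 n x q_ge0.
have h2 : n`!%:R * Pq * expR n%:R <= walk q n x *
   ((expR 1 * n.+1%:R) ^+ size A * ((1 + delta) * n%:R) ^+ n * Pq).
  apply: (@le_trans _ _ (walk q n x * (\prod_(z <- A) (c z)`!%:R) * expR n%:R)).
    by rewrite ler_wpM2r ?expR_ge0.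
  by rewrite -mulrA ler_wpM2l.
have h3 := natr_exp_le_fact R n.
have nn0 : 0 < n%:R ^+ n :> R.
  by case: (n) => [|m]; rewrite ?expr0// exprn_gt0.
rewrite -(ler_pM2r (mulr_gt0 nn0 Pq0)) mul1r.
apply: (@le_trans _ _ (n`!%:R * expR n%:R * Pq)).
  by rewrite ler_wpM2r// ltW.
have -> : n`!%:R * expR n%:R * Pq = n`!%:R * Pq * expR n%:R by rewrite mulrAC.
apply: le_trans h2 _; rewrite le_eqVlt; apply/orP; left; apply/eqP.
by rewrite [((1 + delta) * _) ^+ _]exprMn; ring.
Qed.

End walk_lower.

Section counts.
Variables (R : realType) (d : nat).
Local Notation ty := 'I_d.+1.
Local Notation vec := {ffun ty -> nat}.
Local Notation lat := {ffun ty -> int}.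

Lemma sum_box_le (f : vec -> R) N N' : (forall y, 0 <= f y) -> (N <= N')%N ->
  \sum_(y <- box d N) f y <= \sum_(y <- box d N') f y.
Proof.
move=> f0 NN'; rewrite [leRHS](bigID (fun y => y \in box d N))/=.
rewrite -[leLHS]addr0 lerD ?sumr_ge0//.
rewrite -[leRHS]big_filter le_eqVlt; apply/orP; left; apply/eqP/perm_big.
apply: uniq_perm; rewrite ?(filter_uniq _ (uniq_box _ _)) ?uniq_box// => y.
by rewrite [RHS]mem_filter andb_idr// => /(box_le NN').
Qed.

Lemma esum_box_approx (f : vec -> R) (C eps : R) : (forall y, 0 <= f y) ->
  (\esum_(y in [set: vec]) (f y)%:E = C%:E)%E -> 0 < eps ->
  exists N, forall N', (N <= N')%N -> C - eps <= \sum_(y <- box d N') f y.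
Proof.
move=> f0 fC e0.
have [N CN] : exists N, C - eps <= \sum_(y <- box d N) f y.
  apply: contrapT => /forallNP h.
  have : (\esum_(y in [set: vec]) (f y)%:E <= (C - eps)%:E)%E.
    apply: esum_box_le => [y|N]; first by rewrite lee_fin.
    by rewrite sumEFin lee_fin ltW// ltNge; apply/negP; exact: h.
  by rewrite fC lee_fin lerBrDl gerDr leNgt e0.
by exists N => N' /(sum_box_le f0); apply: le_trans.
Qed.

Variables (q : vec -> R) (mu : ty -> R).
Hypothesis q_ge0 : forall y, 0 <= q y.
Hypothesis q_mass : (\esum_(y in [set: vec]) (q y)%:E = 1)%E.
Hypothesis q_mean : forall j, (\esum_(y in [set: vec]) ((y j)%:R * q y)%:E = (mu j)%:E)%E.
Hypothesis q_spans : spans q.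

Lemma sum_q_le N : \sum_(y <- box d N) q y <= 1.
Proof.
rewrite -lee_fin -sumEFin -q_mass; apply: box_esum_le => y.
by rewrite lee_fin.
Qed.

Lemma sum_mean_le j N : \sum_(y <- box d N) (y j)%:R * q y <= mu j.
Proof.
rewrite -lee_fin -sumEFin -q_mean; apply: box_esum_le => y.
by rewrite lee_fin mulr_ge0.
Qed.

(** The integer parts of [n * q z] miss the length [n] and the endpoint [x] by a small
    proportion of [n]; the discrepancy is repaired on a fixed finite set of steps
    generating the space-time lattice, each of which is used often enough to afford it. *)
Lemma exists_counts (delta : R) : 0 < delta -> delta <= 1 ->
  exists (eta : R) (n0 M : nat), 0 < eta /\ forall (n : nat) (x : lat), (n0 <= n)%N ->
    (forall j, `|(x j)%:~R - mu j * n%:R| <= eta * n%:R) ->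
    exists c : vec -> nat, [/\ (\sum_(z <- box d M) c z)%N = n,
      \sum_(z <- box d M) tolat z *+ c z = x &
      forall z, z \in box d M -> (c z)%:R <= (1 + delta) * (n%:R * q z)].
Proof.
move=> d0 d1.
have [N0 [c0 [c0q c0N c0s c0t]]] := spans_coef q_spans (1, 0).
have ex l : exists Nc : nat * (vec -> int),
    [/\ forall z, q z = 0 -> Nc.2 z = 0, forall z, z \notin box d Nc.1 -> Nc.2 z = 0,
      \sum_(z <- box d Nc.1) Nc.2 z = 0 &
      forall j, \sum_(z <- box d Nc.1) (z j)%:Z * Nc.2 z = (j == l)%:Z].
  have [N [c [cq cN cs ct]]] := spans_coef q_spans (0, tolat (unitv l)).
  by exists (N, c); split => // j; rewrite ct /= tolatE unitvE.
have [Nc NcP] := choice ex.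
pose Nj l := (Nc l).1; pose cj l := (Nc l).2.
have cjP l : [/\ forall z, q z = 0 -> cj l z = 0,
      forall z, z \notin box d (Nj l) -> cj l z = 0,
      \sum_(z <- box d (Nj l)) cj l z = 0 &
      forall j, \sum_(z <- box d (Nj l)) (z j)%:Z * cj l z = (j == l)%:Z] := NcP l.
(* [c0] adds one step without moving, [cj l] moves by one unit of type [l] without
   adding a step; all of them are supported by [box d M0]. *)
pose M0 := maxn N0 (\max_l Nj l).
have NjM l : (Nj l <= M0)%N.
  by rewrite leq_max; apply/orP; right; exact: leq_bigmax.
pose C z : R := `|(c0 z)%:~R| + \sum_l `|(cj l z)%:~R|.
have Cout z : z \notin box d M0 -> C z = 0.
  move=> zM; rewrite /C c0N; last first.
    by apply: contra zM; apply: box_le; exact: leq_maxl.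
  rewrite normr0 add0r big1// => l _; have [_ h _ _] := cjP l.
  by rewrite h ?normr0//; apply: contra zM; exact: box_le.
have Cq z : q z = 0 -> C z = 0.
  move=> qz; rewrite /C c0q// normr0 add0r big1// => l _.
  by have [h _ _ _] := cjP l; rewrite h ?normr0.
have C0 z : 0 <= C z by rewrite addr_ge0// sumr_ge0.
have [eta e0 etaP'] : exists2 eta : R, 0 < eta &
    forall z, z \in box d M0 -> eta * (3 * C z) <= delta / 2 * q z.
  apply: exists_small => z; [by rewrite mulr_ge0|by rewrite mulr_ge0// divr_ge0// ltW|].
  move=> /eqP; rewrite mulf_eq0 (gt_eqF (divr_gt0 d0 _))//= => /eqP /Cq ->.
  by rewrite mulr0.
have etaP z : 3 * eta * C z <= delta / 2 * q z.
  have [/etaP'|/Cout ->] := boolP (z \in box d M0); last first.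
    by rewrite mulr0 mulr_ge0// divr_ge0// ltW.
  by rewrite mulrA [eta * 3]mulrC.
have [e1 e10 e1P'] : exists2 e1 : R, 0 < e1 &
    forall z, z \in box d M0 -> e1 * (2 * (q z != 0)%:R) <= q z.
  by apply: exists_small => [z|//|z ->]; rewrite ?mulr_ge0// eqxx mulr0.
have [M [M0M Mq Mmu]] : exists M, [/\ (M0 <= M)%N, 1 - eta <= \sum_(y <- box d M) q y &
    forall j, mu j - eta <= \sum_(y <- box d M) (y j)%:R * q y].
  have [K KP] := esum_box_approx q_ge0 q_mass e0.
  have exK j : exists Kj, forall N', (Kj <= N')%N ->
      mu j - eta <= \sum_(y <- box d N') (y j)%:R * q y.
    by apply: (esum_box_approx _ (q_mean j) e0) => y; rewrite mulr_ge0.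
  have [Kj KjP] := choice exK.
  exists (maxn M0 (maxn K (\max_j Kj j))); split.
  - exact: leq_maxl.
  - by apply: KP; rewrite !leq_max leqnn orbT.
  - move=> j; apply: KjP; rewrite !leq_max; apply/orP; right; apply/orP; right.
    exact: leq_bigmax.
pose K : R := (size (box d M))%:R + \sum_j \sum_(z <- box d M) (z j)%:R.
have K0 : 0 <= K.
  by rewrite addr_ge0// sumr_ge0// => j _; rewrite sumr_ge0.
exists eta, (Num.truncn (K / eta + e1^-1)).+1, M; split => // n x nB xP.
have nB' : K / eta + e1^-1 <= n%:R.
  by rewrite (le_trans (ltW (truncnS_gt _)))// ler_nat.
have nK : K <= eta * n%:R.
  rewrite mulrC -ler_pdivrMr//; apply: le_trans nB'.
  by rewrite lerDl invr_ge0 ltW.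
have ne1 : 1 <= n%:R * e1.
  rewrite -ler_pdivrMr// mul1r; apply: le_trans nB'.
  by rewrite lerDr divr_ge0// ltW.
pose f z : int := Num.floor (n%:R * q z).
have f_le z : (f z)%:~R <= n%:R * q z by exact: floor_le.
have f_ge z : n%:R * q z - 1 <= (f z)%:~R.
  by have := floorD1_gt (n%:R * q z); rewrite rmorphD /= lerBlDr => /ltW.
have f0 z : 0 <= f z by rewrite floor_ge0 mulr_ge0.
pose m' : int := n%:Z - \sum_(z <- box d M) f z.
pose w' j : int := x j - \sum_(z <- box d M) (z j)%:Z * f z.
pose corr z : int := m' * c0 z + \sum_l w' l * cj l z.
have m'P : `|m'%:~R| <= 3 * eta * n%:R :> R.
  rewrite /m' rmorphB /= rmorph_sum /= ger0_norm; last first.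
    rewrite subr_ge0; apply: (@le_trans _ _ (\sum_(z <- box d M) n%:R * q z)).
      by apply: ler_sum.
    by rewrite -mulr_sumr ler_piMr// sum_q_le.
  have : \sum_(z <- box d M) (n%:R * q z - 1) <= \sum_(z <- box d M) (f z)%:~R :> R.
    by apply: ler_sum => z _; exact: f_ge.
  rewrite sumrB -mulr_sumr big_const_seq count_predT iter_addr_0.
  have : n%:R * (1 - eta) <= n%:R * \sum_(y <- box d M) q y by rewrite ler_wpM2l.
  have : (size (box d M))%:R <= K by rewrite lerDl sumr_ge0// => j _; rewrite sumr_ge0.
  have e2 : 0 <= eta * n%:R by rewrite mulr_ge0// ltW.
  move: nK e2; rewrite -[n%:Z%:~R]/(n%:R).
  move: (\sum_(i <- box d M) (f i)%:~R) (\sum_(i <- box d M) q i) (size (box d M))%:R => S1 S2 S3.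
  by lra.
have w'P j : `|(w' j)%:~R| <= 3 * eta * n%:R :> R.
  rewrite /w' rmorphB /= rmorph_sum /=.
  have h1 : \sum_(z <- box d M) ((z j)%:Z * f z)%:~R <= n%:R * mu j :> R.
    apply: (@le_trans _ _ (n%:R * \sum_(z <- box d M) (z j)%:R * q z)).
      rewrite mulr_sumr; apply: ler_sum => z _.
      by rewrite rmorphM /= mulrCA ler_wpM2l.
    by rewrite ler_wpM2l// sum_mean_le.
  have h2 : n%:R * (mu j - eta) - K <= \sum_(z <- box d M) ((z j)%:Z * f z)%:~R :> R.
    apply: (@le_trans _ _ (n%:R * (\sum_(z <- box d M) (z j)%:R * q z)
       - \sum_(z <- box d M) (z j)%:R)).
      apply: lerB; first by rewrite ler_wpM2l.
      rewrite /K (bigD1 j)//= addrCA lerDl addr_ge0// sumr_ge0// => l _.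
      by rewrite sumr_ge0.
    rewrite mulr_sumr -sumrB; apply: ler_sum => z _.
    rewrite rmorphM /= mulrCA -[X in _ - X]mulr1 -mulrBr.
    by rewrite ler_wpM2l.
  have := xP j.
  have e2 : 0 <= eta * n%:R by rewrite mulr_ge0// ltW.
  rewrite !ler_norml => /andP[x1 x2].
  move: h1 h2 nK e2 x1 x2; move: (\sum_(i <- box d M) _) => S1.
  by move=> *; apply/andP; split; lra.
have corrP z : `|(corr z)%:~R| <= delta / 2 * (n%:R * q z) :> R.
  apply: (@le_trans _ _ (3 * eta * n%:R * C z)); last first.
    by rewrite mulrCA mulrAC mulrC ler_wpM2l.
  rewrite /corr rmorphD /= rmorphM /= rmorph_sum /=.
  apply: le_trans (ler_normD _ _) _; rewrite /C mulrDr lerD//.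
    by rewrite normrM ler_wpM2r.
  apply: le_trans (ler_norm_sum _ _ _) _; rewrite mulr_sumr ler_sum// => l _.
  by rewrite rmorphM /= normrM ler_wpM2r.
have fc0 z : 0 <= f z + corr z.
  rewrite -(ler0z R) rmorphD /=.
  have := corrP z; rewrite ler_norml => /andP[h _].
  have [qz|qz] := eqVneq (q z) 0.
    move: h; rewrite qz !mulr0 oppr0 => h.
    by rewrite addr_ge0// ler0z.
  have [zM|zM] := boolP (z \in box d M0); last first.
    rewrite addr_ge0 ?ler0z//; have -> : corr z = 0; last by [].
    have := Cout z zM; rewrite /C => /eqP; rewrite paddr_eq0 ?sumr_ge0//.
    rewrite normr_eq0 intr_eq0 psumr_eq0// => /andP[/eqP c0z /allP cjz].
    rewrite /corr c0z mulr0 add0r big1// => l _.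
    by have := cjz l; rewrite mem_index_enum normr_eq0 intr_eq0 => /(_ isT)/eqP->; rewrite mulr0.
  have := e1P' z zM; rewrite qz mulr1 => h2.
  have h3 : 2 <= n%:R * q z.
    apply: (@le_trans _ _ (n%:R * (e1 * 2))); last by rewrite ler_wpM2l.
    by rewrite mulrA ler_peMl.
  have := f_ge z; move: h h3; move: (n%:R * q z) => t h h3 h4.
  have : delta * t <= t by rewrite ler_piMl// (le_trans _ h3).
  by move: h; rewrite mulrAC; move: (delta * t) => dt; lra.
have sum_c0 (g : vec -> int) : \sum_(z <- box d M) g z * c0 z =
    \sum_(z <- box d N0) g z * c0 z.
  apply: sum_box_widen => [|z _ zN]; last by rewrite c0N ?mulr0.
  by apply: leq_trans M0M; exact: leq_maxl.
have sum_cj l (g : vec -> int) : \sum_(z <- box d M) g z * cj l z =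
    \sum_(z <- box d (Nj l)) g z * cj l z.
  have [_ h _ _] := cjP l.
  apply: sum_box_widen => [|z _ zN]; last by rewrite h ?mulr0.
  exact: leq_trans (NjM l) M0M.
have corr_sum (g : vec -> int) : \sum_(z <- box d M) g z * corr z =
    m' * (\sum_(z <- box d N0) g z * c0 z) +
    \sum_l w' l * (\sum_(z <- box d (Nj l)) g z * cj l z).
  rewrite /corr; under eq_bigr do rewrite mulrDr mulr_sumr.
  rewrite big_split /= exchange_big /=; congr (_ + _).
    by rewrite -sum_c0 mulr_sumr; apply: eq_bigr => z _; rewrite mulrCA.
  apply: eq_bigr => l _; rewrite -sum_cj mulr_sumr.
  by apply: eq_bigr => z _; rewrite mulrCA.
exists (fun z => `|(f z + corr z)%R|%N); split.
- apply/eqP; rewrite -eqz_nat -[X in X == _]natz natr_sum; apply/eqP.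
  transitivity (\sum_(z <- box d M) (f z + 1 * corr z)).
    by apply: eq_bigr => z _; rewrite mul1r natz gez0_abs.
  rewrite big_split /= (corr_sum (fun=> 1)).
  rewrite (eq_bigr _ (fun z _ => mul1r (c0 z))).
  rewrite c0s /= mulr1 [X in _ + (_ + X)]big1 ?addr0 ?natz; last first.
    move=> l _; rewrite (eq_bigr _ (fun z _ => mul1r (cj l z))).
    by have [_ _ -> _] := cjP l; rewrite mulr0.
  by rewrite /m' addrC subrK.
- apply/ffunP => j; rewrite sum_ffunE.
  transitivity (\sum_(z <- box d M) ((z j)%:Z * f z + (z j)%:Z * corr z)).
    apply: eq_bigr => z _; rewrite ffunMnE tolatE -mulr_natr natz gez0_abs//.
    by rewrite mulrDr.
  rewrite big_split /= (corr_sum (fun z => (z j)%:Z)).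
  rewrite c0t /= ffl0 mulr0 add0r [X in _ + X](bigD1 j)//= [X in _ + (_ + X)]big1 ?addr0 => [|l lj]; last first.
    have [_ _ _ ->] := cjP l.
    by rewrite eq_sym (negbTE lj) mulr0.
  have [_ _ _ ->] := cjP j.
  by rewrite eqxx mulr1 /w' addrC subrK.
- move=> z _; rewrite -[X in X <= _]/((`|(f z + corr z)%R|%N%:Z)%:~R) gez0_abs// rmorphD /=.
  have := corrP z; rewrite ler_norml => /andP[_ h].
  apply: le_trans (lerD (f_le z) h) _.
  rewrite mulrDl mul1r lerD2l ler_wpM2r// ?mulr_ge0//.
  by rewrite ler_pdivrMr// ler_peMr ?(ltW d0)// ler1n.
Qed.

(** A single profile of step counts already carries a probability that does not decay
    exponentially. *)
Lemma walk_subexponential (delta : R) : 0 < delta ->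
  exists (eta : R) (n0 : nat), 0 < eta /\ forall (n : nat) (x : lat), (n0 <= n)%N ->
    (forall j, `|(x j)%:~R - mu j * n%:R| <= eta * n%:R) ->
    expR (- (delta * n%:R)) <= walk q n x.
Proof.
move=> d0; pose e := Num.min 1 (delta / 2).
have e0 : 0 < e by rewrite lt_min ltr01 divr_gt0.
have e1 : e <= 1 by rewrite ge_min lexx.
have ed : e <= delta / 2 by rewrite ge_min lexx orbT.
have [eta [n0 [M [eta0 H]]]] := exists_counts e0 e1.
have [n1 n1P] := @poly_le_expR R (size (box d M)) _ (divr_gt0 d0 (ltr0n _ 2)).
exists eta, (maxn n0 n1); split => // n x nn xP.
have [c [cn cx cq]] := H n x (leq_trans (leq_maxl _ _) nn) xP.
have h1 := walk_lower_counts q_ge0 (uniq_box d M) (ltW e0) cn cx cq.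
have h2 := n1P n (leq_trans (leq_maxr _ _) nn).
have h3 : (1 + e) ^+ n <= expR (delta / 2 * n%:R).
  rewrite expRM_natr lerXn2r ?nnegrE ?expR_ge0 ?addr_ge0 ?(ltW e0)//.
  by apply: le_trans (expR_ge1Dx _) _; rewrite ler_expR.
have w0 := walk_ge0 n x q_ge0.
rewrite expRN -div1r ler_pdivrMr ?expR_gt0//.
apply: le_trans h1 _; rewrite -mulrA ler_wpM2l//.
have -> : delta * n%:R = delta / 2 * n%:R + delta / 2 * n%:R by field.
rewrite expRD ler_pM ?exprn_ge0 ?mulr_ge0 ?expR_ge0 ?addr_ge0 ?(ltW e0)//.
Qed.

End counts.

(** * The strong ratio theorem *)

Section ratio.
Variables (R : realType) (d : nat).
Local Notation ty := 'I_d.+1.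
Local Notation vec := {ffun ty -> nat}.
Local Notation lat := {ffun ty -> int}.
Variables (q : vec -> R) (mu : ty -> R).
Hypothesis q_ge0 : forall y, 0 <= q y.
Hypothesis q_mass : (\esum_(y in [set: vec]) (q y)%:E = 1)%E.
Hypothesis q_mean : forall j, (\esum_(y in [set: vec]) ((y j)%:R * q y)%:E = (mu j)%:E)%E.
Hypothesis q_spans : spans q.

Lemma tilt_ge0 z theta y : 0 <= tilt q z theta y.
Proof. by rewrite mulr_ge0//; case: ifP; rewrite ?expR_ge0. Qed.

Lemma sum_tilt_le z theta N :
  \sum_(y <- box d N) tilt q z theta y <= 1 + (expR theta - 1) * q z.
Proof.
pose N' := maxn N (vsize z).
have zN : z \in box d N' by rewrite mem_box leq_maxr.
apply: (@le_trans _ _ (\sum_(y <- box d N') tilt q z theta y)).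
  by apply: sum_box_le; [exact: tilt_ge0|exact: leq_maxl].
have tE y : tilt q z theta y = q y + (y == z)%:R * ((expR theta - 1) * q z).
  by rewrite /tilt; have [->|_] := eqVneq y z; rewrite /= ?mulr1n ?mulr0n ?mul0r; ring.
under eq_bigr do rewrite tE.
rewrite big_split /= [X in _ + X](sum_box_single (z := z))// ?eqxx ?mul1r; last first.
  by move=> y /negbTE ->; rewrite mul0r.
by rewrite lerD2r sum_q_le.
Qed.

(** Neveu's argument. Let [rho] be the ratio [walk (n - 1) (x - z) / walk n x]: the walk
    conditioned to end at [x] makes on average [n * q z * rho] steps [z]. By Jensen's
    inequality [theta * rho * q z * n] is at most the logarithm of the unconditional
    exponential moment, corrected by [- ln (walk n x)], which is [o(n)].
    A small positive [theta] bounds [rho] from above, a small negative one from below. *)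
Lemma walk_ratio_theta z theta eta n x : 0 < walk q n x ->
  expR (- (eta * n%:R)) <= walk q n x -> (0 < n)%N ->
  theta * q z * (walk q n.-1 (x - tolat z) / walk q n x) <=
    (expR theta - 1) * q z + eta.
Proof.
move=> w0 wlow n0; set rho := _ / _.
pose m := n%:R * q z * rho.
have := @walk_tilt_ge R d q z theta n x m q_ge0.
have -> : (1 - theta * m) * walk q n x + theta * n%:R * q z * walk q n.-1 (x - tolat z)
   = walk q n x.
  by rewrite /m /rho; field; rewrite gt_eqF.
have C0 : 0 <= 1 + (expR theta - 1) * q z.
  by apply: le_trans (sum_tilt_le z theta 0); apply: sumr_ge0 => y _; exact: tilt_ge0.
move=> h; have h2 : walk (tilt q z theta) n x <= expR ((expR theta - 1) * q z * n%:R).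
  apply: le_trans (walk_le _ _ _ (sum_tilt_le z theta)) _.
    exact: tilt_ge0.
  by rewrite expRM_natr lerXn2r ?nnegrE ?expR_ge0// expR_ge1Dx.
have : expR (theta * m - eta * n%:R) <= expR ((expR theta - 1) * q z * n%:R).
  apply: le_trans h2; apply: le_trans h.
  by rewrite expRD ler_wpM2l ?expR_ge0.
rewrite ler_expR lerBlDr -mulrDl.
have -> : theta * m = theta * q z * rho * n%:R by rewrite /m; ring.
by rewrite ler_pM2r ?ltr0n.
Qed.

Lemma expR_sub1_le (theta : R) : theta < 1 -> expR theta - 1 <= theta / (1 - theta).
Proof.
move=> t1; have t0 : 0 < 1 - theta by rewrite subr_gt0.
have h : 1 - theta <= (expR theta)^-1 by rewrite -expRN; exact: expR_ge1Dx.
rewrite lerBlDr; have -> : theta / (1 - theta) + 1 = (1 - theta)^-1.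
  by field; rewrite gt_eqF.
by rewrite -[leLHS]invrK lef_pV2// posrE invr_gt0 expR_gt0.
Qed.

(** Space-time points [s l] at which the lower bound on the walk applies: the time tends
    to infinity and the position follows the law of large numbers. *)
Definition drifts (s : nat -> int * lat) : Prop :=
  (forall N : int, \forall l \near \oo, N <= (s l).1) /\
  (forall j (eps : R), 0 < eps -> \forall l \near \oo,
     `|((s l).2 j)%:~R - mu j * ((s l).1)%:~R| <= eps * ((s l).1)%:~R).

Lemma drifts_shift s u : drifts s -> drifts (fun l => s l + u).
Proof.
move=> [s1 s2]; split.
  move=> N; near=> l; rewrite /= -lerBlDr; near: l; exact: s1.
move=> j eps e0.
pose B : R := 2 * (`|(u.2 j)%:~R - mu j * (u.1)%:~R| + eps * `|(u.1)%:~R|) / eps.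
near=> l.
have h1 : (Num.ceil B)%:~R <= ((s l).1)%:~R :> R.
  by rewrite ler_int; near: l; exact: s1.
have h2 : `|((s l).2 j)%:~R - mu j * ((s l).1)%:~R| <= eps / 2 * ((s l).1)%:~R.
  by near: l; apply: s2; rewrite divr_gt0.
have hB := le_trans (ceil_ge B) h1.
rewrite /= fflD !rmorphD /= mulrDr opprD addrACA.
apply: le_trans (ler_normD _ _) _.
move: hB; rewrite /B ler_pdivrMr// => hB.
have := ler_norm (- (u.1)%:~R : R); rewrite normrN => hu.
have : eps * - (u.1)%:~R <= eps * `|(u.1)%:~R| by rewrite ler_wpM2l// ltW.
move: hB h2; rewrite mulrDr.
move: `|_ - _| `|_ - _| (eps * `|_|) => *.
by lra.
Unshelve. all: by end_near. Qed.

Definition walkz (u : int * lat) : R := walk q `|u.1|%N u.2.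

Lemma walkz_ge0 u : 0 <= walkz u.
Proof. exact: walk_ge0. Qed.

Lemma drifts_subexp s eta : drifts s -> 0 < eta ->
  \forall l \near \oo, [/\ 1 <= (s l).1, 0 < walkz (s l) &
     expR (- (eta * `|(s l).1|%N%:R)) <= walkz (s l)].
Proof.
move=> [s1 s2] e0.
have [eps [n0 [eps0 H]]] := walk_subexponential q_ge0 q_mass q_mean q_spans e0.
have near2 : \forall l \near \oo, forall j,
    `|((s l).2 j)%:~R - mu j * ((s l).1)%:~R| <= eps * ((s l).1)%:~R.
  apply: filter_forall => j; exact: s2.
near=> l.
have l1 : 1 <= (s l).1 by near: l; exact: s1.
have ln : n0%:Z <= (s l).1 by near: l; exact: s1.
have lE : ((s l).1)%:~R = `|(s l).1|%N%:R :> R by rewrite -{1}[(s l).1]gez0_abs//; lia.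
have hw : expR (- (eta * `|(s l).1|%N%:R)) <= walkz (s l).
  have hn : forall j, `|((s l).2 j)%:~R - mu j * ((s l).1)%:~R| <= eps * ((s l).1)%:~R.
    by near: l.
  by apply: H => [|j]; [lia|rewrite -lE; exact: hn].
by split => //; apply: lt_le_trans hw; exact: expR_gt0.
Unshelve. all: by end_near. Qed.

(** Only the lower bound is kept: applied to [- u] along the shifted sequence, it
    gives the upper bound, and it is stable under addition. *)
Definition lower_shift (u : int * lat) : Prop :=
  forall s, drifts s -> forall eps : R, 0 < eps -> eps < 1 ->
    \forall l \near \oo, (1 - eps) * walkz (s l) <= walkz (s l + u).

Lemma lower_shift0 : lower_shift 0.
Proof.
move=> s _ eps e0 e1; near=> l; rewrite addr0 ler_piMl ?walkz_ge0//.
by rewrite lerBlDr lerDl ltW.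
Unshelve. all: by end_near. Qed.

Lemma lower_shiftD u v : lower_shift u -> lower_shift v -> lower_shift (u + v).
Proof.
move=> Hu Hv s sd eps e0 e1.
have e20 : 0 < eps / 2 by rewrite divr_gt0.
have e21 : eps / 2 < 1 by lra.
near=> l.
have h1 : (1 - eps / 2) * walkz (s l) <= walkz (s l + u).
  by near: l; exact: Hu.
have h2 : (1 - eps / 2) * walkz (s l + u) <= walkz (s l + u + v).
  by near: l; apply: Hv => //; exact: drifts_shift.
rewrite addrA; apply: le_trans h2.
apply: (@le_trans _ _ ((1 - eps / 2) * ((1 - eps / 2) * walkz (s l)))); last first.
  by rewrite ler_wpM2l// subr_ge0 ltW.
rewrite mulrA ler_wpM2r ?walkz_ge0//.
by have := sqr_ge0 (eps / 2); lra.
Unshelve. all: by end_near. Qed.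

Lemma lower_shift_remove z : 0 < q z -> lower_shift (- (1, tolat z)).
Proof.
move=> qz s sd eps e0 e1.
(* With [theta = - eps / 2] the second-order error of the exponential is at most
   [theta ^ 2], and [eta] is chosen of the same order. *)
pose eta := q z * eps ^+ 2 / 4.
have eta0 : 0 < eta by rewrite divr_gt0// mulr_gt0// exprn_gt0.
near=> l.
have [l1 w0 wlow] : [/\ 1 <= (s l).1, 0 < walkz (s l) &
     expR (- (eta * `|(s l).1|%N%:R)) <= walkz (s l)].
  by near: l; exact: drifts_subexp.
have := @walk_ratio_theta z (- (eps / 2)) eta `|(s l).1|%N (s l).2 w0 wlow _.
have -> : walkz (s l - (1, tolat z)) = walk q `|(s l).1|.-1 ((s l).2 - tolat z).
  by rewrite /walkz /=; congr walk; lia.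
set rho := walk _ _ _ / _ => h.
have {}h : - (eps / 2) * q z * rho <= (expR (- (eps / 2)) - 1) * q z + eta by apply: h; lia.
have h2 : expR (- (eps / 2)) - 1 <= - (eps / 2) / (1 - - (eps / 2)).
  by apply: expR_sub1_le; lra.
have h3 : - (eps / 2) / (1 - - (eps / 2)) <= - (eps / 2) * (1 - eps / 2).
  rewrite ler_pdivrMr; last by lra.
  have := sqr_ge0 (eps / 2); have : 0 <= (eps / 2) ^+ 3 by rewrite exprn_ge0//; lra.
  by lra.
have h4 : (expR (- (eps / 2)) - 1) * q z <= - (eps / 2) * (1 - eps / 2) * q z.
  by rewrite ler_pM2r//; apply: le_trans h3.
have h5 : - (eps / 2) * q z * rho <= - (eps / 2) * q z * (1 - eps).
  apply: le_trans h _; apply: le_trans (lerD h4 (lexx _)) _.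
  by rewrite /eta; lra.
have : 1 - eps <= rho.
  by move: h5; rewrite ler_nM2l// nmulr_rlt0// ltrNl oppr0 divr_gt0.
by rewrite /rho ler_pdivlMr.
Unshelve. all: by end_near. Qed.

Lemma lower_shift_add z : 0 < q z -> lower_shift (1, tolat z).
Proof.
move=> qz s sd eps e0 e1.
pose eta := q z * eps ^+ 2 / 4.
have eta0 : 0 < eta by rewrite divr_gt0// mulr_gt0// exprn_gt0.
near=> l.
have l1 : 1 <= (s l).1 by near: l; case: sd.
have [l2 w0 wlow] : [/\ 1 <= (s l + (1, tolat z)).1, 0 < walkz (s l + (1, tolat z)) &
     expR (- (eta * `|(s l + (1, tolat z))%R.1|%N%:R)) <= walkz (s l + (1, tolat z))].
  near: l; apply: drifts_subexp => //; exact: drifts_shift.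
have := @walk_ratio_theta z (eps / 2) eta _ _ w0 wlow _.
have -> : walk q `|(s l + (1, tolat z))%R.1|.-1 ((s l + (1, tolat z)).2 - tolat z) = walkz (s l).
  by rewrite /walkz /=; congr walk; [lia|rewrite addrK].
rewrite -/(walkz (s l + (1, tolat z))).
set w' := walkz (s l + _) in w0 *; set w := walkz (s l) => h.
have {}h : eps / 2 * q z * (w / w') <= (expR (eps / 2) - 1) * q z + eta.
  by apply: h; rewrite absz_gt0 gt_eqF// (lt_le_trans _ l2).
have h2 : expR (eps / 2) - 1 <= eps / 2 / (1 - eps / 2).
  by apply: expR_sub1_le; lra.
have h3 : eps / 2 * q z * (w / w') <= eps / 2 * q z * ((1 - eps / 2)^-1 + eps / 2).
  apply: le_trans h _.
  have -> : eps / 2 * q z * ((1 - eps / 2)^-1 + eps / 2) = eps / 2 / (1 - eps / 2) * q z + eta.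
    by rewrite /eta; field; lra.
  by rewrite lerD2r ler_pM2r.
have h4 : w / w' <= (1 - eps / 2)^-1 + eps / 2.
  by move: h3; rewrite ler_pM2l// mulr_gt0// divr_gt0.
have h5 : (1 - eps) * ((1 - eps / 2)^-1 + eps / 2) <= 1.
  have t0 : 0 < 1 - eps / 2 by lra.
  rewrite -(ler_pM2r t0) mul1r.
  have -> : (1 - eps) * ((1 - eps / 2)^-1 + eps / 2) * (1 - eps / 2) =
     (1 - eps) + (1 - eps) * (eps / 2) * (1 - eps / 2) by field; lra.
  have : 0 <= eps ^+ 2 * (3 / 4 - eps / 4) by rewrite mulr_ge0 ?sqr_ge0//; lra.
  by lra.
have : (1 - eps) * (w / w') <= 1.
  by apply: le_trans h5; rewrite ler_wpM2l// subr_ge0 ltW.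
by rewrite mulrA ler_pdivrMr// mul1r.
Unshelve. all: by end_near. Qed.

(** The shifts [u] such that both [u] and [- u] satisfy the lower bound form a subgroup,
    which contains every step of positive probability, hence is the whole lattice. *)
Theorem strong_ratio u : lower_shift u.
Proof.
suff : [set u | lower_shift u /\ lower_shift (- u)] u by case.
apply: q_spans => [|z qz]; last first.
  by split; [exact: lower_shift_add|exact: lower_shift_remove].
split=> [|x y [x1 x2] [y1 y2]]; first by rewrite /= oppr0; split; exact: lower_shift0.
split; first exact: lower_shiftD.
by rewrite opprB; exact: lower_shiftD.
Qed.

End ratio.

(** * Excursions and the Otter-Dwass formula *)

Section dwass.
Variables (R : realType) (d : nat).
Local Notation ty := 'I_d.+1.
Local Notation vec := {ffun ty -> nat}.
Local Notation lat := {ffun ty -> int}.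
Variables (p : ty -> vec -> R) (o : ty).

(** Stopping the exploration at the first descendants of type [o] cuts a tree into
    independent pieces, one for each individual of type [o]. *)
Definition frozen (i : ty) (x : vec) : R := if i == o then (x == 0)%:R else p i x.

Local Notation F := (progeny p).
Local Notation G := (progeny frozen).

(** One such piece: the numbers, by type, of the strict descendants of an individual of
    type [o] met before or at the first return to the type [o]. These are the steps of
    the random walk that encodes a forest. *)
Definition excursion (y : vec) : R :=
  \sum_(x <- box d (vsize y)) p o x * G x (tolat y).

Definition copies (m : nat) : vec := [ffun j => if j == o then m else 0%N].

Lemma copiesS m : copies m.+1 = copies m + unitv o.
Proof.
apply/ffunP => j; rewrite ffvD unitvE !ffunE.
by case: eqP => _; rewrite ?addn1.
Qed.

Lemma copies0 : copies 0 = 0.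
Proof. by apply/ffunP => j; rewrite ffunE ffv0; case: eqP. Qed.

Lemma frozen_unit (r : vec) (k : lat) : G (r + unitv o) k = G r (k - tolat (unitv o)).
Proof.
rewrite (@progeny_kill _ _ _ _ _ _ `|total k|%N); last by lia.
rewrite (sum_box_single (z := 0)) ?mem_box ?vsize0//; last first.
  by move=> y /negbTE y0; rewrite /frozen eqxx y0 mul0r.
by rewrite /frozen !eqxx mul1r vaddC vadd0.
Qed.

Lemma frozen_copies m (r : vec) (k : lat) : G (copies m + r) k = G r (k - tolat (copies m)).
Proof.
elim: m k => [|m IH] k; first by rewrite copies0 vadd0 tolat0 subr0.
by rewrite copiesS vaddAC frozen_unit IH tolatD opprD addrA addrAC.
Qed.

Lemma excursion_sum (y : lat) N : total y <= N%:Z ->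
  \sum_(x <- box d N) p o x * G x y =
  \sum_(z <- box d N) excursion z * (y == tolat z)%:R.
Proof.
move=> yN; have [y0|] := pselect (forall j, 0 <= y j); last first.
  move=> /existsNP[j /negP]; rewrite -ltNge => yj.
  rewrite big1 => [|x _]; last first.
    by rewrite (@progeny_eq0 _ _ _ _ _ j) ?mulr0//; exact: lt_le_trans yj _.
  rewrite big1// => z _; case: eqP => [yz|]; last by rewrite mulr0.
  by move: yj; rewrite yz tolatE.
have [z yE] := lat_nneg y0; subst y.
have zN : (vsize z <= N)%N by rewrite -lez_nat -total_tolat.
rewrite [RHS](sum_box_single (z := z)) ?mem_box// ?eqxx ?mulr1; last first.
  by move=> x xz; rewrite (inj_eq (@tolat_inj d)) eq_sym (negbTE xz) mulr0.
apply: sum_box_widen => // x _; rewrite mem_box -ltnNge => zx.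
apply/eqP; apply: contraTT zx; rewrite mulf_eq0 negb_or => /andP[_ /progeny_total].
by rewrite total_tolat -leqNgt lez_nat.
Qed.

Lemma progeny_frozen (r : vec) (k : lat) : k o = 0 -> F r k = G r k.
Proof.
suff H n : total k <= n%:Z -> k o = 0 -> F r k = G r k by apply: (H `|total k|%N); lia.
elim: n r k => [|n IH] r k kn ko.
all: have [->|[i [s rE]]] := vec_case r; first by rewrite !progeny0.
  have z pp : progeny pp r k = 0 :> R.
    apply/eqP; apply: contraTT kn => /progeny_total.
    by rewrite rE vsizeD vsize_unit; lia.
  by rewrite !z.
have [io|io] := eqVneq i o.
  have z pp : progeny pp r k = 0 :> R.
    apply: (@progeny_eq0 _ _ _ _ _ o); rewrite ko rE ffvD io unitvE eqxx.
    by rewrite addn1.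
  by rewrite !z.
have kn1 : total (k - tolat (unitv i)) <= n%:Z.
  by rewrite totalD totalN total_unit; lia.
rewrite rE !(@progeny_kill _ _ _ _ _ _ n.+1)//; apply: eq_bigr => x _.
rewrite /frozen (negbTE io); congr (_ * _); apply: IH => //.
by rewrite !ffE tolatE unitvE eq_sym (negbTE io) subr0.
Qed.

Lemma vec_case_type (r : vec) : (exists m, r = copies m) \/
  exists i s, i != o /\ r = s + unitv i.
Proof.
have [[i /andP[io ri]]|h] := pselect (exists i, (i != o) && (0 < r i)%N); [right|left].
  by have [s rE] := vec_split ri; exists i, s.
exists (r o); apply/ffunP => j; rewrite ffunE; have [->//|jo] := eqVneq j o.
move/forallNP : h => /(_ j)/negP; rewrite jo/= -eqn0Ngt => /eqP//.
Qed.

(** Otter-Dwass formula. Killing the individuals of a type other than [o] first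
    reduces the statement to forests of type [o]; these are excursions of type [o],
    and the cyclic factor comes from the exchangeability of the excursions. *)
Theorem dwass (r : vec) (k : lat) N : 0 < k o -> total k <= N%:Z ->
  (k o)%:~R * F r k =
  \sum_(y <- box d N) (y o)%:R * (G r (tolat y) * walk excursion `|k o|%N (k - tolat y)).
Proof.
move=> ko kN.
suff H n : total k <= n%:Z -> (n <= N)%N -> 0 < k o -> (k o)%:~R * F r k =
  \sum_(y <- box d N) (y o)%:R * (G r (tolat y) * walk excursion `|k o|%N (k - tolat y)).
  have [k0|k0] := leP (total k) 0; first exact: (H 0%N).
  by apply: (H `|total k|%N); lia.
elim: n r k {ko kN} => [|n IH] r k kn nN ko.
all: have [->|[i0 [s0 rE]]] := vec_case r.
1, 3: rewrite progeny0 big1 => [|y _];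
  [by case: eqP ko => [->|_]; rewrite ?ffl0// mulr0
  |rewrite progeny0 -tolat0 (inj_eq (@tolat_inj d)); have [->|_] := eqVneq y 0;
    by rewrite ?ffv0 ?mul0r ?mulr0].
  have kr : ~~ ((vsize r)%:Z <= total k).
    by rewrite rE vsizeD vsize_unit; lia.
  rewrite (_ : F r k = 0) ?mulr0; last first.
    by apply/eqP; apply: contraNT kr => /progeny_total.
  rewrite big1// => y _; apply/eqP; apply: contraNT kr.
  rewrite !mulf_eq0 !negb_or => /and3P[_ /progeny_total h /walk_total].
  by rewrite totalD totalN; move: h; lia.
have kn1 i : total (k - tolat (unitv i)) <= n%:Z.
  by rewrite totalD totalN total_unit; lia.
have kN : total k <= N%:Z by lia.
have [[m rm]|[i [s [io {}rE]]]] := vec_case_type r; last first.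
  have koi : (k - tolat (unitv i)) o = k o.
    by rewrite !ffE tolatE unitvE eq_sym (negbTE io) subr0.
  rewrite rE (@progeny_kill _ _ _ _ _ _ N)// mulr_sumr.
  transitivity (\sum_(x <- box d N) \sum_(y <- box d N) (y o)%:R * (p i x *
    (G (s + x) (tolat y - tolat (unitv i)) * walk excursion `|k o|%N (k - tolat y)))).
    apply: eq_bigr => x _; rewrite mulrCA -[in (k o)%:~R]koi IH ?koi ?(ltnW nN)//.
    rewrite mulr_sumr.
    pose fv (v : lat) := (v o)%:~R * (p i x * (G (s + x) v *
       walk excursion `|k o|%N (k - tolat (unitv i) - v))).
    transitivity (\sum_(y <- box d N) fv (tolat y)).
      by apply: eq_bigr => y _; rewrite /fv tolatE mulrCA.
    rewrite -(sum_box_shift (w := unitv i)); rewrite /fv.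
    - apply: eq_bigr => y _; rewrite !ffE !tolatE unitvE eq_sym (negbTE io) subr0.
      by rewrite opprB addrA subrK.
    - move=> v j vj; rewrite (@progeny_eq0 _ _ _ _ _ j) ?mul0r ?mulr0//.
      exact: lt_le_trans vj _.
    - move=> z zN; apply/eqP; apply: contraTT zN.
      rewrite !mulf_eq0 !negb_or => /and4P[_ _ _ /walk_total].
      by rewrite totalD totalN total_tolat -leqNgt vsizeD vsize_unit => h1; rewrite -lez_nat; move: (kn1 i); lia.
  rewrite exchange_big /=; apply: eq_big_seq => y yN.
  rewrite (@progeny_kill _ _ _ _ _ _ N); last first.
    by rewrite total_tolat; move: yN; rewrite mem_box.
  rewrite mulr_suml mulr_sumr; apply: eq_bigr => x _.
  have -> : frozen i x = p i x by rewrite /frozen (negbTE io).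
  by rewrite -[in RHS]mulrA.
case: m rm => [|m] rm.
  by move/ffunP/(_ i0): rE; rewrite rm copies0 ffvD ffv0 unitvE eqxx addn1.
pose X := k - tolat (copies m.+1).
have Xo : X o = k o - m.+1%:Z.
  by rewrite /X !ffE tolatE /copies ffunE eqxx.
have XN : total X <= N%:Z by rewrite /X totalD totalN total_tolat; lia.
have -> : \sum_(y <- box d N) (y o)%:R * (G r (tolat y) *
    walk excursion `|k o|%N (k - tolat y)) = m.+1%:R * walk excursion `|k o|%N X.
  have gE (y : vec) : G r (tolat y) = (y == copies m.+1)%:R.
    rewrite rm -[copies _ in LHS](vadd0) vaddC frozen_copies progeny0 subr_eq0.
    by rewrite (inj_eq (@tolat_inj d)).
  have [kbig|ksmall] := leqP (vsize (copies m.+1)) N.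
    rewrite (sum_box_single (z := copies m.+1)) ?mem_box//.
      by rewrite gE eqxx mul1r [copies _ o]ffunE eqxx.
    by move=> y /negbTE yc; rewrite gE yc mul0r mulr0.
  rewrite big1_seq => [|y /= yN].
    apply/esym/eqP; apply: contraTT ksmall; rewrite mulf_eq0 negb_or => /andP[_ /walk_total].
    by rewrite /X totalD totalN total_tolat; lia.
  rewrite gE; case: eqP => [yc|]; last by rewrite mul0r mulr0.
  by move: yN; rewrite mem_box yc leqNgt ksmall.
rewrite rm copiesS (@progeny_kill _ _ _ _ _ _ N)//.
have koo : (k - tolat (unitv o)) o = k o - 1.
  by rewrite !ffE tolatE unitvE eqxx.
have XE : k - tolat (unitv o) - tolat (copies m) = X.
  by rewrite /X copiesS tolatD opprD addrA addrAC.
have [k1|k1] := eqVneq (k o) 1.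
  have -> : \sum_(x <- box d N) p o x * F (copies m + x) (k - tolat (unitv o)) =
      \sum_(x <- box d N) p o x * G x X.
    apply: eq_bigr => x _; rewrite progeny_frozen ?koo ?k1// frozen_copies.
    by rewrite XE.
  rewrite k1 mul1r excursion_sum//.
  case: m {rm} X Xo XN XE => [|m] X Xo XN XE.
    rewrite mul1r (walkS _ _ XN); apply: eq_bigr => z _; congr (_ * _).
    by rewrite /= subr_eq0.
  rewrite (@walk_neg _ _ _ _ _ o) ?mulr0; last by rewrite Xo k1; lia.
  rewrite big1// => z _; case: eqP => [Xz|]; last by rewrite mulr0.
  by move: Xo; rewrite Xz tolatE k1; lia.
case kE : `|k o|%N => [|[|n']]; [lia|lia|].
have koE : k o = n'.+2%:Z by lia.
have n'0 : n'.+1%:R != 0 :> R by rewrite pnatr_eq0.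
apply: (mulfI n'0).
rewrite mulrCA [in LHS]mulr_sumr.
have -> : \sum_(x <- box d N) n'.+1%:R * (p o x * F (copies m + x) (k - tolat (unitv o))) =
    \sum_(z <- box d N) (m + z o)%:R * (excursion z * walk excursion n'.+1 (X - tolat z)).
  transitivity (\sum_(x <- box d N) \sum_(y <- box d N) (m + y o)%:R * (p o x *
      (G x (tolat y) * walk excursion n'.+1 (X - tolat y)))).
    apply: eq_bigr => x _; rewrite mulrCA.
    have -> : n'.+1%:R = ((k - tolat (unitv o)) o)%:~R :> R.
      rewrite koo koE (_ : n'.+2%:Z - 1 = n'.+1%:Z)//; lia.
    rewrite IH ?(ltnW nN)//; last by rewrite koo koE.
    have -> : `|(k - tolat (unitv o))%R o|%N = n'.+1 by rewrite koo koE; lia.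
    rewrite mulr_sumr.
    pose fv (v : lat) := (m%:R + (v o)%:~R) * (p o x * (G x v *
       walk excursion n'.+1 (X - v))).
    transitivity (\sum_(y <- box d N) fv (tolat y)); last first.
      by apply: eq_bigr => y _; rewrite /fv tolatE natrD.
    rewrite -(sum_box_shift (w := copies m)); rewrite /fv.
    - apply: eq_bigr => y _; rewrite frozen_copies.
      have -> : X - (tolat y - tolat (copies m)) = k - tolat (unitv o) - tolat y.
        by rewrite -XE opprB addrA subrK.
      have -> : m%:R + ((tolat y - tolat (copies m)) o)%:~R = (y o)%:R :> R.
        rewrite !ffE !tolatE [copies m o]ffunE eqxx rmorphB /=.
        by rewrite addrC subrK.
      by rewrite mulrCA.
    - move=> v j vj; rewrite (@progeny_eq0 _ _ _ _ _ j) ?mul0r ?mulr0//.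
      exact: lt_le_trans vj _.
    - move=> z zN; apply/eqP; apply: contraTT zN.
      rewrite !mulf_eq0 !negb_or => /and4P[_ _ _ /walk_total].
      rewrite -XE !totalD !totalN !total_tolat -leqNgt vsizeD => h1.
      by rewrite -lez_nat; lia.
  rewrite exchange_big /=; apply: eq_big_seq => z zN.
  rewrite -mulr_sumr; congr (_ * _).
  have zN' : total (tolat z) <= N%:Z by rewrite total_tolat; move: zN; rewrite mem_box.
  transitivity ((\sum_(x <- box d N) p o x * G x (tolat z)) * walk excursion n'.+1 (X - tolat z)).
    by rewrite mulr_suml; apply: eq_bigr => x _; rewrite mulrA.
  rewrite excursion_sum// (sum_box_single (z := z)) ?eqxx ?mulr1//.
  by move=> y yz; rewrite (inj_eq (@tolat_inj d)) eq_sym (negbTE yz) mulr0.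
have ex := walk_exchange excursion n'.+1 o XN.
under eq_bigr => z _ do rewrite natrD mulrDl.
rewrite big_split -mulr_sumr -[X in _ * (_ * X + _)](walkS _ _ XN) mulrDr.
rewrite [in (k o)%:~R]koE -[n'.+2%:Z%:~R]/(n'.+2%:R) [X in _ + X = _]ex Xo koE.
rewrite rmorphB /= -[n'.+2%:Z%:~R]/(n'.+2%:R) -[m.+1%:Z%:~R]/(m.+1%:R) -!natr1.
ring.
Qed.

End dwass.

(** * Expectations over the total progeny *)

Section progeny_expectation.
Variables (R : realType) (d : nat).
Local Notation ty := 'I_d.+1.
Local Notation vec := {ffun ty -> nat}.
Local Notation lat := {ffun ty -> int}.
Local Open Scope ereal_scope.

Lemma esum_swap (T1 T2 : choiceType) (f : T1 -> T2 -> \bar R) :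
  (forall x y, 0 <= f x y) ->
  \esum_(x in [set: T1]) \esum_(y in [set: T2]) f x y =
  \esum_(y in [set: T2]) \esum_(x in [set: T1]) f x y.
Proof.
move=> f0; rewrite !esum_esum//.
rewrite (reindex_esum ([set: T2] `*`` fun=> [set: T1]) _ (fun z => (z.2, z.1)))//.
split => //=; first by move=> [x1 x2] [y1 y2] /= _ _ [-> ->].
by move=> [x1 x2] _; exists (x2, x1).
Qed.

Lemma esum_ge_term (T : choiceType) (f : T -> \bar R) (x : T) :
  (forall y, 0 <= f y) -> f x <= \esum_(y in [set: T]) f y.
Proof.
move=> f0; apply: esum_ge; exists [set x]; first by split => //; exact: finite_set1.
by rewrite fsbig_set1.
Qed.

Implicit Types (phi psi : lat -> R) (r s : vec).
Variable p : ty -> vec -> R.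
Hypothesis p_ge0 : forall i x, (0 <= p i x)%R.
Hypothesis p_mass : forall i, \esum_(x in [set: vec]) (p i x)%:E = 1.

(** The expectation of [phi] at the total progeny of a forest with roots [r], on the
    event that this progeny is finite. *)
Definition pexp phi r : \bar R :=
  \esum_(y in [set: vec]) (phi (tolat y) * progeny p r (tolat y))%:E.

Lemma pexp_ge0 phi r : (forall v, 0 <= phi v)%R -> 0 <= pexp phi r.
Proof. by move=> f0; apply: esum_ge0 => y _; rewrite lee_fin mulr_ge0 ?progeny_ge0. Qed.

Lemma le_pexp (phi psi : lat -> R) r : (forall y : vec, phi (tolat y) <= psi (tolat y))%R ->
  pexp phi r <= pexp psi r.
Proof.
by move=> h; apply: le_esum => y _; rewrite lee_fin ler_wpM2r ?progeny_ge0.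
Qed.

Lemma pexp0 phi : (forall v, 0 <= phi v)%R -> pexp phi 0%R = (phi 0%R)%:E.
Proof.
move=> f0; rewrite /pexp (@esum_box _ _ _ 0).
- rewrite (sum_box_single (z := 0%R)) ?mem_box ?vsize0// ?tolat0 ?progeny0 ?eqxx ?mulr1//.
  by move=> y /negbTE y0; rewrite progeny0 -tolat0 (inj_eq (@tolat_inj d)) y0 mulr0.
- by move=> y; rewrite lee_fin mulr_ge0 ?progeny_ge0.
- move=> y; rewrite mem_box -ltnNge progeny0 => y0; case: eqP => [yz|]; last by rewrite mulr0.
  by move: y0; rewrite -[vsize y]/`|(vsize y)%:Z|%N -total_tolat yz -tolat0 total_tolat vsize0.
Qed.

Lemma pexp_kill phi s i : (forall v, 0 <= phi v)%R ->
  pexp phi (s + unitv i)%R = \esum_(x in [set: vec])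
     (p i x)%:E * pexp (fun v => phi (v + tolat (unitv i)))%R (s + x)%R.
Proof.
move=> f0.
transitivity (\esum_(y in [set: vec]) \esum_(x in [set: vec])
   (phi (tolat y) * (p i x * progeny p (s + x) (tolat y - tolat (unitv i))))%:E).
  apply: eq_esum => y _; rewrite (@esum_box _ _ _ (vsize y)).
  - rewrite (@progeny_kill _ _ _ _ _ _ (vsize y)) ?total_tolat//.
    by rewrite sumEFin mulr_sumr.
  - by move=> x; rewrite lee_fin !mulr_ge0 ?progeny_ge0.
  - move=> x; apply: contraNeq; rewrite eqe !mulf_eq0 !negb_or => /and3P[_ _].
    by apply: progeny_box; rewrite total_tolat.
rewrite esum_swap; last by move=> x y; rewrite lee_fin !mulr_ge0 ?progeny_ge0.
apply: eq_esum => x _; rewrite /pexp -esumZl//; last first.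
  by move=> y; rewrite lee_fin mulr_ge0 ?progeny_ge0.
pose f (v : lat) := (p i x * (phi (v + tolat (unitv i)) * progeny p (s + x) v))%:E.
transitivity (\esum_(y in [set: vec]) f (tolat y - tolat (unitv i))%R).
  by apply: eq_esum => y _; rewrite /f subrK mulrCA.
rewrite (@esum_shift _ _ f); first by apply: eq_esum => y _; rewrite /f EFinM.
- by move=> v; rewrite lee_fin !mulr_ge0 ?progeny_ge0.
- move=> v j vj; rewrite /f (@progeny_eq0 _ _ _ _ _ j) ?mulr0//.
  exact: lt_le_trans vj _.
Qed.

(** Fubini's theorem for two independent forests. *)
Lemma pexp_add phi r r' : (forall v, 0 <= phi v)%R ->
  pexp phi (r + r')%R = \esum_(y in [set: vec]) \esum_(z in [set: vec])
    (phi (tolat y + tolat z) * (progeny p r (tolat y) * progeny p r' (tolat z)))%:E.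
Proof.
move=> f0.
transitivity (\esum_(k in [set: vec]) \esum_(y in [set: vec])
   (phi (tolat k) * (progeny p r (tolat y) * progeny p r' (tolat k - tolat y)))%:E).
  apply: eq_esum => k _; rewrite (@esum_box _ _ _ (vsize k)).
  - rewrite (@progeny_conv _ _ _ _ _ _ (vsize k)) ?total_tolat//.
    by rewrite sumEFin mulr_sumr.
  - by move=> x; rewrite lee_fin !mulr_ge0 ?progeny_ge0.
  - move=> y; apply: contraNeq; rewrite eqe !mulf_eq0 !negb_or => /and3P[_ _].
    move=> /progeny_total; rewrite totalD totalN !total_tolat mem_box => h.
    by rewrite -lez_nat; lia.
rewrite esum_swap; last by move=> x y; rewrite lee_fin !mulr_ge0 ?progeny_ge0.
apply: eq_esum => y _.
pose f (v : lat) := (phi (tolat y + v) * (progeny p r (tolat y) * progeny p r' v))%:E.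
transitivity (\esum_(k in [set: vec]) f (tolat k - tolat y)%R).
  by apply: eq_esum => k _; rewrite /f (_ : tolat y + (tolat k - tolat y) = tolat k)%R// addrC subrK.
rewrite (@esum_shift _ _ f)//.
- by move=> v; rewrite lee_fin !mulr_ge0 ?progeny_ge0.
- move=> v j vj; rewrite /f (@progeny_eq0 _ _ p r' v j) ?mulr0//.
  exact: lt_le_trans vj _.
Qed.

(** Bounding the total size makes the recursion of [pexp_kill] well-founded. *)
Lemma pexp_trunc_le1 r N : pexp (fun v => (total v <= N%:Z)%R%:R%R) r <= 1.
Proof.
elim: N r => [|N IH] r; have [->|[i [s ->]]] := vec_case r.
1, 3: by rewrite pexp0 // lee_fin lern1 leq_b1.
- rewrite [leLHS]esum1// => y _.
  have [y0|_] := boolP (total (tolat y) <= 0%N%:Z)%R; last by rewrite mul0r.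
  rewrite [progeny _ _ _](_ : _ = 0%R) ?mulr0//.
  apply/eqP; apply: contraTT y0 => /progeny_total; rewrite !total_tolat.
  by rewrite vsizeD vsize_unit; lia.
- rewrite pexp_kill// -(p_mass i); apply: le_esum => x _.
  rewrite -[leRHS]mule1 lee_wpmul2l ?lee_fin//; apply: le_trans (IH (s + x)%R).
  apply: le_pexp => y; rewrite totalD total_unit ler_nat.
  by case: (boolP (total (tolat y) + 1 <= _)%R) => // h; rewrite (_ : (_ <= _)%R = true)//; lia.
Qed.

Lemma pmass_le1 r : pexp (fun=> 1%R) r <= 1.
Proof.
apply: esum_box_le => [y|N]; first by rewrite lee_fin mul1r progeny_ge0.
apply: le_trans (pexp_trunc_le1 r N).
apply: le_trans (box_esum_le _ _); last first.
  by move=> y; rewrite lee_fin mulr_ge0 ?progeny_ge0.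
rewrite [leLHS]big_seq [leRHS]big_seq; apply: lee_sum => y.
by rewrite mem_box total_tolat lez_nat => ->.
Qed.

(** The probability that a forest with roots [r] is finite. *)
Definition pmass r : R := fine (pexp (fun=> 1%R) r).

Lemma pmassE r : pexp (fun=> 1%R) r = (pmass r)%:E.
Proof.
rewrite /pmass fineK// ge0_fin_numE ?pexp_ge0//.
by apply: le_lt_trans (pmass_le1 r) _; rewrite ltry.
Qed.

Lemma pmass_ge0 r : (0 <= pmass r)%R.
Proof. by rewrite -lee_fin -pmassE pexp_ge0. Qed.

Lemma pmass_le r : (pmass r <= 1)%R.
Proof. by rewrite -lee_fin -pmassE pmass_le1. Qed.

Lemma pmassD r r' : pmass (r + r')%R = (pmass r * pmass r')%R.
Proof.
apply/EFin_inj; rewrite -pmassE pexp_add//.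
transitivity (\esum_(y in [set: vec]) (pmass r')%:E * (1 * progeny p r (tolat y))%:E).
  apply: eq_esum => y _; rewrite muleC mul1r -pmassE -esumZl ?progeny_ge0//.
    by apply: eq_esum => z _; rewrite mul1r mul1r EFinM.
  by move=> z; rewrite lee_fin mul1r progeny_ge0.
rewrite esumZl ?pmass_ge0//; last by move=> y; rewrite lee_fin mul1r progeny_ge0.
by rewrite -/(pexp (fun=> 1%R) r) pmassE -EFinM mulrC.
Qed.

Lemma pmass0 : pmass 0%R = 1%R.
Proof. by rewrite /pmass pexp0. Qed.

(** The masses being at most one, independence still gives an upper bound when finiteness
    of the forests is not known; subadditivity is what survives when an additive [phi]
    is truncated at a bounded size. *)
Lemma pexp_subadd phi r r' : (forall v, 0 <= phi v)%R ->
  (forall y z : vec, phi (tolat y + tolat z) <= phi (tolat y) + phi (tolat z))%R ->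
  pexp phi (r + r')%R <= pexp phi r + pexp phi r'.
Proof.
move=> f0 fD; have P0 := pexp_ge0 r f0.
have [->|rfin] := eqVneq (pexp phi r') +oo.
  by rewrite addey ?leey// gt_eqF// (lt_le_trans _ P0)// ltNyr.
have [c c0 cE] : exists2 c : R, (0 <= c)%R & pexp phi r' = c%:E.
  exists (fine (pexp phi r')); first by rewrite fine_ge0// pexp_ge0.
  by rewrite fineK// ge0_fin_numE ?pexp_ge0// ltey.
rewrite pexp_add//.
apply: (@le_trans _ _ (\esum_(y in [set: vec]) \esum_(z in [set: vec])
  ((phi (tolat y) * progeny p r (tolat y))%:E * (1 * progeny p r' (tolat z))%:E +
   (progeny p r (tolat y))%:E * (phi (tolat z) * progeny p r' (tolat z))%:E))).
  apply: le_esum => y _; apply: le_esum => z _; rewrite -!EFinM -EFinD lee_fin.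
  rewrite mul1r -mulrA [X in (_ <= _ + X)%R]mulrCA -mulrDl ler_wpM2r// mulr_ge0 ?progeny_ge0//.
have g0 r1 (y : vec) : 0 <= (phi (tolat y) * progeny p r1 (tolat y))%:E.
  by rewrite lee_fin mulr_ge0 ?progeny_ge0.
have h0 r1 (y : vec) : 0 <= (1 * progeny p r1 (tolat y))%:E.
  by rewrite lee_fin mul1r progeny_ge0.
have k0 r1 (y : vec) : 0 <= (progeny p r1 (tolat y))%:E.
  by rewrite lee_fin progeny_ge0.
have inner (y : vec) : \esum_(z in [set: vec])
  ((phi (tolat y) * progeny p r (tolat y))%:E * (1 * progeny p r' (tolat z))%:E +
   (progeny p r (tolat y))%:E * (phi (tolat z) * progeny p r' (tolat z))%:E) =
   (phi (tolat y) * progeny p r (tolat y))%:E * pexp (fun=> 1%R) r' +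
   (progeny p r (tolat y))%:E * pexp phi r'.
  rewrite esumD; [|by move=> z _; rewrite mule_ge0|by move=> z _; rewrite mule_ge0].
  by rewrite !esumZl ?mulr_ge0 ?progeny_ge0.
under eq_esum do rewrite inner.
rewrite esumD; last 2 first.
- by move=> y _; rewrite mule_ge0// pexp_ge0.
- by move=> y _; rewrite mule_ge0// pexp_ge0.
apply: leeD.
  apply: le_esum => y _; rewrite -[leRHS]mule1; apply: lee_wpmul2l => //.
  exact: pmass_le1.
rewrite cE; under eq_esum do rewrite muleC.
rewrite esumZl// -[leRHS]mule1 lee_wpmul2l ?lee_fin//.
apply: le_trans (pmass_le1 r); apply: le_esum => y _; by rewrite mul1r.
Qed.

(** With masses equal to one, each of the two terms of [phi] integrates out the other
    forest exactly. *)
Lemma pexp_additive phi r r' : (forall i, pmass (unitv i) = 1%R) ->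
  (forall v, 0 <= phi v)%R ->
  (forall y z : vec, phi (tolat y + tolat z) = phi (tolat y) + phi (tolat z))%R ->
  pexp phi (r + r')%R = pexp phi r + pexp phi r'.
Proof.
move=> m1 f0 fD.
have M1 s : pmass s = 1%R.
  elim/vec_ind: s => [|s i IH]; first exact: pmass0.
  by rewrite pmassD IH m1 mulr1.
apply/eqP; rewrite eq_le pexp_subadd//=; last by move=> y z; rewrite fD.
have g0 s (y : vec) : 0 <= (phi (tolat y) * progeny p s (tolat y))%:E.
  by rewrite lee_fin mulr_ge0 ?progeny_ge0.
have h0 s (y : vec) : 0 <= (1 * progeny p s (tolat y))%:E.
  by rewrite lee_fin mul1r progeny_ge0.
have m0 s (y z : vec) : 0 <= (phi (tolat y) * progeny p r (tolat y))%:E * (1 * progeny p s (tolat z))%:E.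
  by rewrite mule_ge0.
rewrite pexp_add//.
have E1 : pexp phi r = \esum_(y in [set: vec]) \esum_(z in [set: vec])
   ((phi (tolat y) * progeny p r (tolat y))%:E * (1 * progeny p r' (tolat z))%:E).
  apply: eq_esum => y _; rewrite esumZl ?mulr_ge0 ?progeny_ge0//.
  by rewrite -/(pexp (fun=> 1%R) r') pmassE M1 mule1.
have E2 : pexp phi r' = \esum_(y in [set: vec]) \esum_(z in [set: vec])
   ((1 * progeny p r (tolat y))%:E * (phi (tolat z) * progeny p r' (tolat z))%:E).
  rewrite esum_swap; last by move=> y z; rewrite mule_ge0.
  apply: eq_esum => z _; under eq_esum do rewrite muleC.
  rewrite esumZl ?mulr_ge0 ?progeny_ge0//.
  by rewrite -/(pexp (fun=> 1%R) r) pmassE M1 mule1.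
rewrite {1}E1 {1}E2 -esumD; last 2 first.
- by move=> y _; apply: esum_ge0.
- by move=> y _; apply: esum_ge0 => z _; rewrite mule_ge0.
apply: le_esum => y _; rewrite -esumD; last 2 first.
- by move=> z _.
- by move=> z _; rewrite mule_ge0.
apply: le_esum => z _; rewrite -!EFinM -EFinD lee_fin fD !mul1r mulrDl.
by rewrite mulrA lerD2l mulrCA.
Qed.

End progeny_expectation.

(** * Perron eigenvectors and moments of the excursions *)

Section perron.
Variables (R : realType) (d : nat).
Local Notation ty := 'I_d.+1.
Variable M : 'M[R]_d.+1.
Hypothesis M_ge0 : forall i j, 0 <= M i j.
Variable n : nat.
Hypothesis M_pos : forall i j, 0 < (M ^+ n) i j.

(** A zero entry propagates, because a power of [M] has positive entries. *)
Lemma perron_eq0 (v : ty -> R) (o : ty) : (forall i, 0 <= v i) ->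
  (forall i, \sum_j M i j * v j = v i) -> v o = 0 -> forall j, v j = 0.
Proof.
move=> v0 Mv vo j; pose V : 'cV[R]_d.+1 := \col_i v i.
have MV m : M ^+ m *m V = V.
  elim: m => [|m IH]; first by rewrite expr0 mul1mx.
  rewrite exprSr -mulmxE -mulmxA (_ : M *m V = V)//.
  by apply/colP => i; rewrite !mxE -[RHS]Mv; apply: eq_bigr => l _; rewrite mxE.
have : \sum_l (M ^+ n) o l * v l = 0.
  move/colP/(_ o): (MV n); rewrite !mxE vo => h; rewrite -[RHS]h.
  by apply: eq_bigr => l _; rewrite mxE.
move/eqP; rewrite psumr_eq0 => [/allP/(_ j)|l _]; last by rewrite mulr_ge0// ltW.
by rewrite mem_index_enum mulf_eq0 gt_eqF//= => /(_ isT)/eqP.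
Qed.

(** Subtract from [v] the largest multiple of [w] that keeps it nonnegative. *)
Lemma perron_unique (v w : ty -> R) (o : ty) : (forall i, 0 < w i) ->
  (forall i, \sum_j M i j * v j = v i) -> (forall i, \sum_j M i j * w j = w i) ->
  (forall i, v i = v o / w o * w i).
Proof.
move=> w0 Mv Mw.
have [l _ lP] : exists2 l : ty, true & forall i, v l / w l <= v i / w i.
  by case: (@arg_minP _ R ty o xpredT (fun i => v i / w i) isT) => l _ lP; exists l => // i; exact: lP.
have H i : v i - v l / w l * w i = 0.
  apply: (@perron_eq0 (fun i => v i - v l / w l * w i) l).
  - by move=> j; rewrite subr_ge0 -ler_pdivlMr.
  - move=> j; under eq_bigr do rewrite mulrBr mulrCA.
    by rewrite sumrB Mv -mulr_sumr Mw.
  - by rewrite divfK ?subrr// gt_eqF.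
move=> i; have := H o; move/eqP; rewrite subr_eq0 => /eqP ->.
by rewrite mulfK ?gt_eqF//; apply/eqP; rewrite -subr_eq0 H.
Qed.

Lemma irreducible_closed (S : set ty) (o : ty) : S o ->
  (forall i j, S i -> 0 < M i j -> S j) -> forall j, S j.
Proof.
move=> So Sc j.
suff H m i l : S i -> (M ^+ m) i l != 0 -> S l by apply: (H n o) => //; rewrite gt_eqF.
elim: m i => [|m IH] i Si.
  by rewrite expr0 mxE; have [<-//|_] := eqVneq i l; rewrite eqxx.
rewrite exprS -mulmxE mxE => /eqP h.
have [z] : exists z, M i z * (M ^+ m) z l != 0.
  apply: contrapT => /forallNP h0; apply: h; apply: big1 => z _.
  by have /negP := h0 z; rewrite negbK => /eqP.
rewrite mulf_eq0 negb_or => /andP[Miz]; apply: IH; apply: Sc Si _.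
by rewrite lt_neqAle eq_sym Miz M_ge0.
Qed.

End perron.

Section excursion_moments.
Variables (R : realType) (d : nat).
Local Notation ty := 'I_d.+1.
Local Notation vec := {ffun ty -> nat}.
Local Notation lat := {ffun ty -> int}.
Variable p : ty -> vec -> R.
Hypothesis p_ge0 : forall i x, 0 <= p i x.
Hypothesis p_mass : forall i, (\esum_(x in [set: vec]) (p i x)%:E = 1)%E.
Variable M : 'M[R]_d.+1.
Hypothesis p_mean : forall i j, (\esum_(x in [set: vec]) ((x j)%:R * p i x)%:E = (M i j)%:E)%E.
Variable nM : nat.
Hypothesis M_pos : forall i j, 0 < (M ^+ nM) i j.
Variable a : ty -> R.
Hypothesis a_pos : forall i, 0 < a i.
Hypothesis a_eigen : forall j, \sum_i a i * M i j = a j.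
Variable o : ty.

Local Notation fr := (frozen p o).
Local Notation G := (progeny fr).
Local Notation q := (excursion p o).

Lemma mean_ge0 i j : 0 <= M i j.
Proof. by rewrite -lee_fin -p_mean esum_ge0// => x _; rewrite lee_fin mulr_ge0. Qed.

Lemma mean_gt0_ex i j : 0 < M i j -> exists x, 0 < p i x /\ (0 < x j)%N.
Proof.
move=> Mij; apply: contrapT => /forallNP h.
have : (M i j)%:E = 0%E.
  rewrite -p_mean; apply: esum1 => x _.
  have [x0|x0] := posnP (x j); first by rewrite x0 mul0r.
  have [px|px] := eqVneq (p i x) 0; first by rewrite px mulr0.
  by case: (h x); split => //; rewrite lt_neqAle eq_sym px p_ge0.
by case => Mij0; rewrite Mij0 ltxx in Mij.
Qed.

Lemma frozen_ge0 i x : 0 <= fr i x.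
Proof. by rewrite /frozen; case: ifP. Qed.

Lemma frozen_mass i : (\esum_(x in [set: vec]) (fr i x)%:E = 1)%E.
Proof.
have [->|io] := eqVneq i o; last first.
  by rewrite -(p_mass i); apply: eq_esum => x _; rewrite /frozen (negbTE io).
under eq_esum do rewrite /frozen eqxx.
rewrite (@esum_box _ _ _ 0).
- by rewrite (sum_box_single (z := 0)) ?mem_box ?vsize0 ?eqxx// => y /negbTE ->.
- by move=> y; rewrite lee_fin.
- by move=> y; have [->|//] := eqVneq y 0; rewrite mem_box vsize0.
Qed.

Hint Resolve frozen_ge0 frozen_mass : core.

(** A nonnegative defect [delta] with [delta <= M delta] is invariant, as one sees by pairing
    it with the left eigenvector; so it vanishes when one of its entries does. *)
Lemma subinvariant (delta : ty -> R) : (forall i, 0 <= delta i) ->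
  (forall i, delta i <= \sum_j M i j * delta j) ->
  forall i, \sum_j M i j * delta j = delta i.
Proof.
move=> d0 dM.
have : \sum_i a i * (\sum_j M i j * delta j - delta i) = 0.
  under eq_bigr do rewrite mulrBr mulr_sumr.
  rewrite sumrB exchange_big /= -sumrB; apply: big1 => j _.
  by rewrite -[in X in _ - X]a_eigen mulr_suml -sumrB; apply: big1 => i _; rewrite mulrA subrr.
move/eqP; rewrite psumr_eq0 => [/allP h i|i _]; last by rewrite mulr_ge0 ?subr_ge0// ltW.
by have := h i; rewrite mem_index_enum mulf_eq0 gt_eqF//= subr_eq0 => /(_ isT)/eqP.
Qed.

Lemma offspring_linear (i : ty) (c : ty -> R) : (forall j, 0 <= c j) ->
  (\esum_(x in [set: vec]) ((\sum_j (x j)%:R * c j) * p i x)%:E =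
   (\sum_j M i j * c j)%:E)%E.
Proof.
move=> c0.
transitivity (\esum_(x in [set: vec]) \sum_j (c j)%:E * ((x j)%:R * p i x)%:E)%E.
  apply: eq_esum => x _; rewrite mulr_suml -sumEFin; apply: eq_bigr => j _.
  by rewrite -EFinM mulrCA mulrA.
rewrite esum_sum => [|x j _ _]; last by rewrite mule_ge0 ?lee_fin ?mulr_ge0.
rewrite -sumEFin; apply: eq_bigr => j _.
by rewrite esumZl// ?p_mean ?EFinM 1?muleC// => x; rewrite lee_fin mulr_ge0.
Qed.

Lemma pmass_frozen_o : pmass fr (unitv o) = 1.
Proof.
apply/EFin_inj; rewrite -pmassE//.
rewrite -(vadd0 (unitv o)) pexp_kill//.
rewrite -[RHS](frozen_mass o); apply: eq_esum => x _.
rewrite vadd0; have [->|x0] := eqVneq x 0; first by rewrite pexp0// mule1.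
by rewrite (_ : fr o x = 0) ?mul0e// /frozen eqxx (negbTE x0).
Qed.

(** The probability that a frozen tree is infinite is a subinvariant defect, and it
    vanishes at the type [o], where the tree is reduced to its root. *)
Lemma pmass_frozen i : pmass fr (unitv i) = 1.
Proof.
pose delta i := 1 - pmass fr (unitv i).
have d0 j : 0 <= delta j by rewrite subr_ge0 pmass_le.
have dsum (x : vec) : 1 - pmass fr x <= \sum_j (x j)%:R * delta j.
  elim/vec_ind: x => [|x j IH].
    by rewrite pmass0// subrr sumr_ge0// => j _; rewrite mulr_ge0.
  have -> : \sum_l ((x + unitv j)%R l)%:R * delta l = \sum_l (x l)%:R * delta l + delta j.
    under eq_bigr do rewrite ffvD natrD mulrDl.
    rewrite big_split /=; congr (_ + _); rewrite (bigD1 j)//= unitvE eqxx mul1r.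
    by rewrite big1 ?addr0// => l /negbTE lj; rewrite unitvE lj mul0r.
  apply: le_trans (lerD IH (lexx _)); rewrite pmassD// /delta.
  have := pmass_le frozen_ge0 frozen_mass x; have := d0 j; rewrite /delta.
  have := pmass_ge0 frozen_ge0 frozen_mass x.
  move=> u0 v1 u1; have : 0 <= 1 - pmass fr x by rewrite subr_ge0.
  move=> /mulr_ge0 /(_ v1); lra.
have dM j : delta j <= \sum_l M j l * delta l.
  have [->|jo] := eqVneq j o.
    rewrite /delta pmass_frozen_o subrr; apply: sumr_ge0 => l _.
    by rewrite mulr_ge0 ?mean_ge0//; exact: d0.
  rewrite lerBlDr -lee_fin EFinD -pmassE// -offspring_linear//.
  rewrite -(vadd0 (unitv j)) pexp_kill// -(p_mass j) -esumD; last 2 first.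
  - by move=> x _; rewrite lee_fin mulr_ge0// sumr_ge0// => l _; rewrite mulr_ge0.
  - by move=> x _; rewrite mule_ge0 ?lee_fin//; apply: pexp_ge0.
  apply: le_esum => x _; rewrite vadd0 pmassE// {1}/frozen (negbTE jo).
  rewrite -EFinM -EFinD lee_fin mulrC -mulrDr ler_peMr//.
  by have := dsum x; rewrite lerBlDr.
have := perron_eq0 M_pos d0 (subinvariant d0 dM) (o := o).
rewrite {1}/delta pmass_frozen_o subrr => /(_ erefl i)/eqP.
by rewrite subr_eq0 => /eqP ->.
Qed.

Lemma pmass_frozen_vec r : pmass fr r = 1.
Proof.
elim/vec_ind: r => [|s i IH]; first exact: pmass0.
by rewrite pmassD// IH pmass_frozen mulr1.
Qed.

Lemma excursion_ge0 y : 0 <= q y.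
Proof. by apply: sumr_ge0 => x _; rewrite mulr_ge0 ?progeny_ge0. Qed.

Lemma excursion_pexp (phi : lat -> R) : (forall v, 0 <= phi v) ->
  (\esum_(y in [set: vec]) (phi (tolat y) * q y)%:E =
   \esum_(x in [set: vec]) (p o x)%:E * pexp fr phi x)%E.
Proof.
move=> f0.
transitivity (\esum_(y in [set: vec]) \esum_(x in [set: vec])
   (phi (tolat y) * (p o x * G x (tolat y)))%:E)%E.
  apply: eq_esum => y _; rewrite (@esum_box _ _ _ (vsize y)).
  - by rewrite sumEFin mulr_sumr.
  - by move=> x; rewrite lee_fin !mulr_ge0 ?progeny_ge0.
  - move=> x; apply: contraNeq; rewrite eqe !mulf_eq0 !negb_or => /and3P[_ _].
    by move=> /progeny_total; rewrite total_tolat mem_box lez_nat.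
rewrite esum_swap; last by move=> x y; rewrite lee_fin !mulr_ge0 ?progeny_ge0.
apply: eq_esum => x _; rewrite /pexp -esumZl//; last first.
  by move=> y; rewrite lee_fin mulr_ge0 ?progeny_ge0.
by apply: eq_esum => y _; rewrite -EFinM mulrCA.
Qed.

Lemma excursion_mass : (\esum_(y in [set: vec]) (q y)%:E = 1)%E.
Proof.
transitivity (\esum_(y in [set: vec]) ((fun=> 1 : R) (tolat y) * q y)%:E)%E.
  by apply: eq_esum => y _; rewrite mul1r.
rewrite (excursion_pexp (phi := fun=> 1))// -(p_mass o); apply: eq_esum => x _.
by rewrite pmassE// pmass_frozen_vec mule1.
Qed.

Lemma offspring_affine (i : ty) (b : R) (c : ty -> R) : 0 <= b -> (forall j, 0 <= c j) ->
  (\esum_(x in [set: vec]) (p i x)%:E * (b + \sum_j (x j)%:R * c j)%:E =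
   (b + \sum_j M i j * c j)%:E)%E.
Proof.
move=> b0 c0; rewrite EFinD -offspring_linear// -[X in (X + _)%E]mule1 -(p_mass i) -esumZl//; last first.
  by move=> x; rewrite lee_fin.
rewrite -esumD => [|x _|x _]; last 2 first.
- by rewrite -EFinM lee_fin mulr_ge0.
- by rewrite lee_fin mulr_ge0// sumr_ge0// => j _; rewrite mulr_ge0.
by apply: eq_esum => x _; rewrite -!EFinM -EFinD mulrDr mulrC [p i x * _ in LHS]mulrC.
Qed.

Lemma pexp_affine (b : R) (phi : lat -> R) (x : vec) : 0 <= b -> (forall v, 0 <= phi v) ->
  pexp fr (fun v => b + phi v) x = (b%:E + pexp fr phi x)%E.
Proof.
move=> b0 f0; rewrite -[b%:E]mule1 -[X in (_ * X + _)%E](_ : pexp fr (fun=> 1%R) x = 1%E); last first.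
  by rewrite pmassE// pmass_frozen_vec.
rewrite -esumZl => [|//|y]; last by rewrite lee_fin mul1r progeny_ge0.
rewrite -esumD => [|y _|y _]; last 2 first.
- by rewrite -EFinM lee_fin !mulr_ge0// progeny_ge0.
- by rewrite lee_fin mulr_ge0// progeny_ge0.
by apply: eq_esum => y _; rewrite -EFinM -EFinD mul1r -mulrDl.
Qed.

(** Paired with the left eigenvector, the recursion [c j = (j == l) + sum_i M j i * c i] of
    the frozen means loses its sum, and only its source term [a l] remains. *)
Lemma eigen_pairing (l : ty) (c : ty -> R) :
  \sum_j a j * ((j == l)%:R + \sum_i M j i * c i) = a l + \sum_j a j * c j.
Proof.
under eq_bigr do rewrite mulrDr.
rewrite big_split /=; congr (_ + _).
  rewrite (bigD1 l)//= eqxx mulr1 big1 ?addr0// => j /negbTE ->.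
  by rewrite mulr0.
under eq_bigr do rewrite mulr_sumr.
rewrite exchange_big /=; apply: eq_bigr => i _; rewrite -[in RHS]a_eigen mulr_suml.
by apply: eq_bigr => j _; rewrite mulrA.
Qed.

Lemma sum_vecD (r s : vec) (c : ty -> R) :
  \sum_j ((r + s)%R j)%:R * c j = \sum_j (r j)%:R * c j + \sum_j (s j)%:R * c j.
Proof. by rewrite -big_split; apply: eq_bigr => j _; rewrite ffvD natrD mulrDl. Qed.

Lemma sum_unitv (i : ty) (c : ty -> R) : \sum_j (unitv i j)%:R * c j = c i.
Proof.
rewrite (bigD1 i)//= unitvE eqxx mul1r big1 ?addr0// => l /negbTE li.
by rewrite unitvE li mul0r.
Qed.

Lemma pexp_frozen_o (phi : lat -> R) : (forall v, 0 <= phi v) ->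
  pexp fr phi (unitv o) = (phi (tolat (unitv o)))%:E.
Proof.
move=> f0; rewrite -(vadd0 (unitv o)) pexp_kill// vadd0.
rewrite (@esum_box _ _ _ 0).
- rewrite (sum_box_single (z := 0)) ?mem_box ?vsize0//.
    by rewrite vadd0 pexp0// add0r /frozen !eqxx mul1e.
  by move=> x /negbTE x0; rewrite /frozen eqxx x0 mul0e.
- by move=> x; rewrite mule_ge0 ?lee_fin//; apply: pexp_ge0.
- move=> x; have [->|x0 _] := eqVneq x 0; first by rewrite mem_box vsize0.
  by rewrite /frozen eqxx (negbTE x0) mul0e.
Qed.

Section one_type.
Variable l : ty.

Definition count_type (v : lat) : R := `|v l|%N%:R.

Lemma count_tolat (y : vec) : count_type (tolat y) = (y l)%:R.
Proof. by rewrite /count_type tolatE. Qed.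

Lemma count_tolatD (y z : vec) :
  count_type (tolat y + tolat z) = count_type (tolat y) + count_type (tolat z).
Proof. by rewrite -tolatD !count_tolat ffvD natrD. Qed.

Let trunc (N : nat) (v : lat) : R := (total v <= N%:Z)%R%:R * count_type v.

Let trunc_ge0 N v : 0 <= trunc N v.
Proof. by rewrite mulr_ge0. Qed.

Let trunc_le N v : trunc N v <= count_type v.
Proof. by rewrite /trunc; have [_|_] := boolP (total v <= N%:Z); rewrite ?mul1r// mul0r ler0n. Qed.

Let truncD N (y z : vec) : trunc N (tolat y + tolat z) <= trunc N (tolat y) + trunc N (tolat z).
Proof.
have [h|h] := boolP (total (tolat y + tolat z) <= N%:Z); last first.
  by rewrite {1}/trunc (negbTE h) mul0r addr_ge0.
have hy : total (tolat y) <= N%:Z by apply: le_trans h; rewrite totalD lerDl total_tolat.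
have hz : total (tolat z) <= N%:Z by apply: le_trans h; rewrite totalD lerDr total_tolat.
by rewrite /trunc h hy hz !mul1r count_tolatD.
Qed.

Let trunc_fin N r : pexp fr (trunc N) r \is a fin_num.
Proof.
rewrite ge0_fin_numE ?pexp_ge0//; apply: (@le_lt_trans _ _ N%:R%:E); last by rewrite ltry.
have h : (N%:R%:E * pexp fr (fun=> 1%R) r <= N%:R%:E)%E.
  by rewrite pmassE// -EFinM lee_fin ler_piMr// pmass_le.
apply: le_trans h; rewrite -esumZl//; last by move=> y; rewrite lee_fin mulr_ge0 ?progeny_ge0.
apply: le_esum => y _; rewrite -EFinM lee_fin mul1r ler_wpM2r ?progeny_ge0//.
rewrite /trunc count_tolat total_tolat; have [h|_] := boolP ((vsize y)%:Z <= N%:Z); last by rewrite mul0r.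
rewrite mul1r ler_nat; rewrite lez_nat in h; apply: leq_trans h.
by rewrite /vsize (bigD1 l)//= leq_addr.
Qed.

(** The truncation makes the means finite from the start, so that they can be subtracted
    in the pairing with the left eigenvector. *)
Let tmean N j : R := fine (pexp fr (trunc N) (unitv j)).

Let tmeanE N j : pexp fr (trunc N) (unitv j) = (tmean N j)%:E.
Proof. by rewrite /tmean fineK. Qed.

Let tmean_ge0 N j : 0 <= tmean N j.
Proof. by rewrite -lee_fin -tmeanE pexp_ge0. Qed.

Let tmean_vec N x : (pexp fr (trunc N) x <= (\sum_j (x j)%:R * tmean N j)%:E)%E.
Proof.
elim/vec_ind: x => [|x j IH].
  rewrite pexp0// lee_fin big1 => [|j _]; last by rewrite ffv0 mul0r.
  by rewrite /trunc /count_type ffl0 mulr0.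
rewrite sum_vecD sum_unitv EFinD -tmeanE; apply: le_trans (leeD IH (lexx _)).
by apply: pexp_subadd.
Qed.

Let tmean_kill N j : j != o ->
  tmean N j <= (j == l)%:R + \sum_i M j i * tmean N i.
Proof.
move=> jo; rewrite -lee_fin -tmeanE -(vadd0 (unitv j)) pexp_kill// -offspring_affine//.
apply: le_esum => x _; rewrite vadd0 {1}/frozen (negbTE jo).
apply: lee_wpmul2l; first by rewrite lee_fin.
rewrite EFinD; apply: le_trans (leeD (lexx _) (tmean_vec N x)).
rewrite -pexp_affine//; apply: le_pexp => // y; rewrite addrC.
apply: le_trans (truncD _ _ _) _; rewrite lerD2r; apply: le_trans (trunc_le _ _) _.
by rewrite count_tolat unitvE eq_sym.
Qed.

Let tmean_o N : tmean N o <= (o == l)%:R.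
Proof.
rewrite -lee_fin -tmeanE pexp_frozen_o// lee_fin; apply: le_trans (trunc_le _ _) _.
by rewrite count_tolat unitvE eq_sym.
Qed.

(* Uniform in the truncation: outside [o] the recursion is an inequality, and the missing
   term for [j = o] is what the pairing bounds. *)
Let tmean_bound N : \sum_i M o i * tmean N i <= a l / a o.
Proof.
rewrite ler_pdivlMr//.
have h1 : \sum_j a j * tmean N j <=
    \sum_j a j * ((j == l)%:R + \sum_i M j i * tmean N i) - a o * \sum_i M o i * tmean N i.
  have e (b S r c : R) : c * (b + S) + r - c * S = c * b + r by ring.
  rewrite (bigD1 o)//= [X in _ <= X - _](bigD1 o)//= e.
  apply: lerD; first by rewrite ler_pM2l.
  by apply: ler_sum => j jo; rewrite ler_pM2l ?tmean_kill.
move: h1; rewrite eigen_pairing mulrC.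
by move: (_ * a o) => c; lra.
Qed.

(* Finiteness holds for the possible children of [o] by the uniform bound, and then
   passes from a type to its possible children. *)
Let mean_fin j : pexp fr count_type (unitv j) \is a fin_num.
Proof.
rewrite ge0_fin_numE; last by apply: pexp_ge0.
apply: (irreducible_closed mean_ge0 M_pos
  (S := [set j | (pexp fr count_type (unitv j) < +oo)%E]) (o := o)) => /=.
  by rewrite pexp_frozen_o// ltry.
move=> i {}j ifin Mij.
have [io|io] := eqVneq i o.
  apply: (@le_lt_trans _ _ (a l / a o / M o j)%:E); last by rewrite ltry.
  rewrite io in Mij.
  apply: esum_box_le => [y|N]; first by rewrite lee_fin mulr_ge0// progeny_ge0.
  apply: (@le_trans _ _ (tmean N j)%:E); last first.
    rewrite lee_fin ler_pdivlMr// mulrC; apply: le_trans (tmean_bound N).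
    by rewrite (bigD1 j)//= lerDl sumr_ge0// => i' _; rewrite mulr_ge0 ?mean_ge0.
  rewrite -tmeanE; apply: le_trans (box_esum_le _ _); last first.
    by move=> y; rewrite lee_fin mulr_ge0 ?progeny_ge0.
  rewrite [leLHS]big_seq [leRHS]big_seq; apply: lee_sum => y.
  by rewrite mem_box /trunc total_tolat lez_nat => ->; rewrite mul1r.
have [x [pix /vec_split[s xE]]] := mean_gt0_ex Mij.
suff h : ((p i x)%:E * pexp fr count_type (unitv j) <= pexp fr count_type (unitv i))%E.
  rewrite ltNge leye_eq; apply/eqP => jinf.
  by move: (le_lt_trans h ifin); rewrite jinf gt0_muley ?lte_fin// ltxx.
rewrite -[in leRHS](vadd0 (unitv i)) pexp_kill//.
apply: le_trans (esum_ge_term x _); last first.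
  by move=> y; rewrite mule_ge0 ?lee_fin//; apply: pexp_ge0.
rewrite vadd0 /= {2}/frozen (negbTE io).
apply: lee_wpmul2l; first by rewrite lee_fin.
apply: (@le_trans _ _ (pexp fr count_type x)).
  rewrite xE pexp_additive//; last 2 first.
  - exact: pmass_frozen.
  - exact: count_tolatD.
  by apply: leeDr; apply: pexp_ge0.
apply: le_pexp => // y; rewrite count_tolatD.
by rewrite lerDl.
Qed.

Definition frozen_mean (j : ty) : R := fine (pexp fr count_type (unitv j)).

Lemma frozen_meanE j : pexp fr count_type (unitv j) = (frozen_mean j)%:E.
Proof. by rewrite /frozen_mean fineK. Qed.

Lemma frozen_mean_vec x : pexp fr count_type x = (\sum_j (x j)%:R * frozen_mean j)%:E.
Proof.
elim/vec_ind: x => [|x j IH].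
  rewrite pexp0// big1 => [|j _]; last by rewrite ffv0 mul0r.
  by rewrite /count_type ffl0.
rewrite sum_vecD sum_unitv EFinD -frozen_meanE -IH.
by apply: pexp_additive => //; [exact: pmass_frozen|exact: count_tolatD].
Qed.

Lemma frozen_mean_ge0 j : 0 <= frozen_mean j.
Proof. by rewrite -lee_fin -frozen_meanE pexp_ge0. Qed.

Lemma frozen_mean_o : frozen_mean o = (o == l)%:R.
Proof.
by apply/EFin_inj; rewrite -frozen_meanE pexp_frozen_o// count_tolat unitvE eq_sym.
Qed.

Lemma frozen_mean_kill j : j != o ->
  frozen_mean j = (j == l)%:R + \sum_i M j i * frozen_mean i.
Proof.
move=> jo; apply/EFin_inj; rewrite -frozen_meanE -(vadd0 (unitv j)) pexp_kill//.
rewrite -offspring_affine//; last exact: frozen_mean_ge0.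
apply: eq_esum => x _; rewrite vadd0 {1}/frozen (negbTE jo) EFinD -frozen_mean_vec -pexp_affine//.
by congr (_ * _)%E; apply: eq_esum => y _; rewrite count_tolatD addrC [X in X + _]count_tolat unitvE eq_sym.
Qed.

Lemma excursion_mean_frozen :
  (\esum_(y in [set: vec]) ((y l)%:R * q y)%:E = (\sum_i M o i * frozen_mean i)%:E)%E.
Proof.
transitivity (\esum_(y in [set: vec]) (count_type (tolat y) * q y)%:E)%E.
  by apply: eq_esum => y _; rewrite count_tolat.
rewrite excursion_pexp// -offspring_linear; last exact: frozen_mean_ge0.
by apply: eq_esum => x _; rewrite frozen_mean_vec -EFinM mulrC.
Qed.

(** The truncated argument, now with equalities. *)
Lemma frozen_mean_step : \sum_i M o i * frozen_mean i = a l / a o.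
Proof.
have h1 : \sum_j a j * frozen_mean j = \sum_j a j * ((j == l)%:R + \sum_i M j i * frozen_mean i)
    - a o * \sum_i M o i * frozen_mean i.
  have e (b S r c : R) : c * (b + S) + r - c * S = c * b + r by ring.
  rewrite (bigD1 o)//= [X in _ = X - _](bigD1 o)//= e.
  rewrite frozen_mean_o; congr (_ + _).
  by apply: eq_bigr => j jo; rewrite frozen_mean_kill.
move: h1; rewrite eigen_pairing => h1; apply/eqP; rewrite eq_sym -subr_eq0; apply/eqP.
apply: (mulfI (lt0r_neq0 (a_pos o))); rewrite mulr0 mulrBr mulrCA divff ?gt_eqF// mulr1.
by move: h1; move: (a o * _) => c; lra.
Qed.

Lemma excursion_mean :
  (\esum_(y in [set: vec]) ((y l)%:R * q y)%:E = (a l / a o)%:E)%E.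
Proof. by rewrite excursion_mean_frozen frozen_mean_step. Qed.

End one_type.

(** One-step decomposition gives the eigenvector equation outside [o]; at [o] it holds
    because an excursion has on average one child of type [o], the eigenvalue being one.
    Conclude by uniqueness of the Perron eigenvector. *)
Lemma frozen_mean_eigen (w : ty -> R) : (forall i, 0 < w i) ->
  (forall i, \sum_j M i j * w j = w i) -> forall i, frozen_mean o i = w i / w o.
Proof.
move=> w0 Mw i.
rewrite (perron_unique M_pos (v := frozen_mean o) o w0)//.
  by rewrite frozen_mean_o eqxx mul1r mulrC.
move=> j; have [->|jo] := eqVneq j o; last first.
  by rewrite [RHS]frozen_mean_kill// (negbTE jo) add0r.
by rewrite frozen_mean_step frozen_mean_o eqxx divff// gt_eqF.
Qed.

End excursion_moments.

(** * Aperiodicity of the excursions *)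

Section subgroup.
Variables (V : zmodType) (H : set V).
Hypothesis HH : is_subgroup H.

Lemma subgroup0 : H 0. Proof. by case: HH. Qed.
Lemma subgroupB x y : H x -> H y -> H (x - y). Proof. by case: HH => _; apply. Qed.
Lemma subgroupN x : H x -> H (- x).
Proof. by move=> Hx; rewrite -sub0r; apply: subgroupB => //; exact: subgroup0. Qed.
Lemma subgroupD x y : H x -> H y -> H (x + y).
Proof. by move=> Hx Hy; rewrite -[y]opprK; apply: subgroupB => //; exact: subgroupN. Qed.
Lemma subgroupMn x n : H x -> H (x *+ n).
Proof.
move=> Hx; elim: n => [|n IH]; first by rewrite mulr0n; exact: subgroup0.
by rewrite mulrS; exact: subgroupD.
Qed.
Lemma subgroupMz x n : H x -> H (x *~ n).
Proof.
by move=> Hx; case: n => n; [exact: subgroupMn|apply: subgroupN; exact: subgroupMn].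
Qed.
Lemma subgroup_sum (I : Type) (s : seq I) (f : I -> V) :
  (forall i, H (f i)) -> H (\sum_(i <- s) f i).
Proof.
move=> Hf; elim: s => [|i s IH]; rewrite ?big_nil ?big_cons; first exact: subgroup0.
exact: subgroupD.
Qed.

End subgroup.

Section excursion_span.
Variables (R : realType) (d : nat).
Local Notation ty := 'I_d.+1.
Local Notation vec := {ffun ty -> nat}.
Local Notation lat := {ffun ty -> int}.
Variable p : ty -> vec -> R.
Hypothesis p_ge0 : forall i x, 0 <= p i x.
Hypothesis p_mass : forall i, (\esum_(x in [set: vec]) (p i x)%:E = 1)%E.
Variable M : 'M[R]_d.+1.
Hypothesis p_mean : forall i j, (\esum_(x in [set: vec]) ((x j)%:R * p i x)%:E = (M i j)%:E)%E.
Variable nM : nat.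
Hypothesis M_pos : forall i j, 0 < (M ^+ nM) i j.
Hypothesis p_aperiodic : aperiodic p.
Variable o : ty.
Local Notation fr := (frozen p o).
Local Notation G := (progeny fr).
Local Notation q := (excursion p o).
Hypothesis G_mass : forall i, pmass fr (unitv i) = 1.

Let fr_ge0 : forall i x, 0 <= fr i x.
Proof. exact: frozen_ge0. Qed.

Let fr_mass i : (\esum_(x in [set: vec]) (fr i x)%:E = 1)%E.
Proof. exact: frozen_mass. Qed.

Let offspring_ex i : exists x, 0 < p i x.
Proof.
apply: contrapT => /forallNP h; have := p_mass i; rewrite esum1 => [/esym/eqP|x _].
  by rewrite onee_eq0.
by congr EFin; apply/eqP; rewrite eq_le p_ge0 andbT leNgt; apply/negP; exact: h.
Qed.

Let frozen_ex i : exists y : vec, 0 < G (unitv i) (tolat y) /\ (i = o -> y = unitv o).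
Proof.
have [->|io] := eqVneq i o.
  exists (unitv o); split => //.
  by rewrite -(vadd0 (unitv o)) frozen_unit vadd0 subrr progeny0 eqxx.
have [y yP] : exists y : vec, 0 < G (unitv i) (tolat y).
  apply: contrapT => /forallNP h.
  have := pmassE fr_ge0 fr_mass (unitv i); rewrite G_mass /pexp esum1 => [/eqP|y _].
    by rewrite eq_sym onee_eq0.
  congr EFin; rewrite mul1r; apply/eqP; rewrite eq_le progeny_ge0// andbT leNgt.
  by apply/negP; exact: h.
by exists y; split => // /eqP; rewrite (negbTE io).
Qed.

Let pairB (u v : int * lat) : u - v = (u.1 - v.1, u.2 - v.2).
Proof. by []. Qed.

Let pairD (u v : int * lat) : u + v = (u.1 + v.1, u.2 + v.2).
Proof. by []. Qed.

Lemma excursion_gt0 (x y : vec) : 0 < p o x -> 0 < G x (tolat y) -> 0 < q y.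
Proof.
move=> px gx; rewrite /excursion (bigD1_seq x) ?uniq_box//=; last first.
  by rewrite mem_box -lez_nat -(total_tolat y); apply: (@progeny_total _ _ fr); rewrite gt_eqF.
by rewrite ltr_pwDl ?mulr_gt0// sumr_ge0// => z _; rewrite mulr_ge0 ?progeny_ge0.
Qed.

(** Aperiodicity passes from the offspring distribution to the excursions. Fix a
    frozen tree with progeny [yy j] for each root type [j]. Two frozen trees which
    start from the same type can replace each other inside an excursion, so the difference
    of their progenies is a period; comparing [yy i] with the tree whose root has
    offspring [x], one gets the period [yy i - e_i - sum_j x_j yy j]. *)
Lemma excursion_spans : spans q.
Proof.
move=> H HH Hq.
have [yy yyP] := choice frozen_ex.
pose s (x : vec) : lat := \sum_j tolat (yy j) *+ x j.
have sD x j : s (x + unitv j) = s x + tolat (yy j).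
  rewrite /s; under eq_bigr do rewrite ffvD mulrnDr.
  rewrite big_split /=; congr (_ + _).
  rewrite (bigD1 j)//= unitvE eqxx mulr1n big1 ?addr0// => k /negbTE kj.
  by rewrite unitvE kj mulr0n.
have s0 : s 0 = 0 by rewrite /s big1// => j _; rewrite ffv0 mulr0n.
have Gs x : 0 < G x (s x).
  elim/vec_ind: x => [|x j IH]; first by rewrite s0 progeny0 eqxx.
  rewrite sD; apply: lt_le_trans (progeny_ge_conv fr_ge0 _ _ _ _).
  by rewrite mulr_gt0//; case: (yyP j).
have HG x (v : lat) : 0 < p o x -> 0 < G x v -> H (1, v).
  move=> px gx; have [y vE] : exists y, v = tolat y.
    apply: lat_nneg => j; apply: le_trans (progeny_supp (lt0r_neq0 gx) j).
    by [].
  by rewrite vE; apply: Hq; apply: excursion_gt0 px _; rewrite -vE.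
(* Every type [i] other than [o] occurs in some excursion, where [w] is the rest of that
   excursion. *)
have reach i : i = o \/ exists w : lat, forall v, 0 < G (unitv i) v -> H (1, w + v).
  apply: (irreducible_closed (mean_ge0 p_ge0 p_mean) M_pos (S := [set i | i = o \/
     exists w : lat, forall v, 0 < G (unitv i) v -> H (1, w + v)]) (o := o)) => /=; first by left.
  move=> {}i j [->|[w wP]] /(mean_gt0_ex p_ge0 p_mean)[x [px /vec_split[t xE]]]; right.
    exists (s t) => v gv; apply: HG px _; rewrite xE.
    by apply: lt_le_trans (progeny_ge_conv fr_ge0 _ _ _ _); rewrite mulr_gt0.
  have [io|io] := eqVneq i o.
    exists (s t) => v gv; apply: (HG x); first by rewrite -io.
    rewrite xE.
    by apply: lt_le_trans (progeny_ge_conv fr_ge0 _ _ _ _); rewrite mulr_gt0.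
  exists (w + s t + tolat (unitv i)) => v gv.
  rewrite -!addrA; apply: wP; rewrite [tolat _ + _]addrC addrA -[X in G X](vadd0 (unitv i)).
  apply: lt_le_trans (progeny_ge_kill fr_ge0 0 x i (s t + v)).
  rewrite /frozen (negbTE io) mulr_gt0// -/fr vadd0 xE.
  by apply: lt_le_trans (progeny_ge_conv fr_ge0 _ _ _ _); rewrite mulr_gt0.
have H0 (u v : lat) : H (1, u) -> H (1, v) -> H (0, u - v).
  by move=> Hu Hv; have := subgroupB HH Hu Hv.
have H0B (u v : lat) : H (0, u) -> H (0, v) -> H (0, u - v).
  by move=> Hu Hv; have := subgroupB HH Hu Hv.
have Hsub i x : i != o -> 0 < p i x -> H (0, tolat (yy i) - (s x + tolat (unitv i))).
  move=> io px; have [/eqP|[w wP]] := reach i; first by rewrite (negbTE io).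
  have h1 : H (1, w + tolat (yy i)) by apply: wP; case: (yyP i).
  have h2 : H (1, w + (s x + tolat (unitv i))).
    apply: wP; rewrite -[X in G X](vadd0 (unitv i)).
    apply: lt_le_trans (progeny_ge_kill fr_ge0 0 x i (s x)).
    by rewrite /frozen (negbTE io) mulr_gt0// -/fr vadd0.
  have := H0 _ _ h1 h2.
  by rewrite opprD addrACA subrr add0r.
have Hdiff i x x' : 0 < p i x -> 0 < p i x' -> H (0, s x - s x').
  move=> px px'; have [io|io] := eqVneq i o.
    by apply: H0; [apply: (HG x)|apply: (HG x')] => //; rewrite -io.
  have := H0B _ _ (Hsub i x' io px') (Hsub i x io px).
  by rewrite opprB addrC addrA subrK opprD addrACA subrr addr0.
(* [s] extends to a linear map on the lattice; by aperiodicity the differences of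
   offspring generate everything, so the image of this map is made of periods. *)
pose lin (v : lat) : lat := \sum_j tolat (yy j) *~ v j.
have linB u v : lin (u - v) = lin u - lin v.
  by rewrite /lin -sumrB; apply: eq_bigr => j _; rewrite fflD fflN mulrzBr.
have Hlin v : H (0, lin v).
  have : [set: lat] v by [].
  rewrite -p_aperiodic => /(_ [set u : lat | H (0, lin u)]); apply; split.
    split; first by rewrite /= /lin big1 => [|j _]; rewrite ?ffl0//; exact: (subgroup0 HH).
    by move=> x y /= Hx Hy; rewrite linB; exact: H0B.
  move=> z [i _ [x [x' [px px' ->]]]] /=.
  have -> : lin [ffun j => (x j)%:Z - (x' j)%:Z] = s x - s x'.
    rewrite /lin /s -sumrB; apply: eq_bigr => j _.
    by rewrite ffunE mulrzBr !pmulrn.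
  exact: Hdiff px px'.
have sE x : s x = lin (tolat x).
  by rewrite /s /lin; apply: eq_bigr => j _; rewrite tolatE pmulrn.
have yyE j : tolat (yy j) = lin (tolat (unitv j)) by rewrite -sE -(vadd0 (unitv j)) sD s0 add0r.
(* For [i] other than [o] the period [yy i - s x - e_i] leaves [e_i], the two other terms
   being in the image of [lin]. *)
have Hunit i : H (0, tolat (unitv i)).
  have [->|io] := eqVneq i o.
    by case: (yyP o) => _ /(_ erefl) {1}<-; rewrite yyE.
  have [x px] := offspring_ex i.
  have h1 : H (0, tolat (yy i)) by rewrite yyE.
  have h2 : H (0, s x) by rewrite sE.
  have := H0B _ _ (H0B _ _ h1 (Hsub i x io px)) h2.
  by rewrite opprB addrCA subrr addr0 [s x + _]addrC addrK.
have HH' : is_subgroup [set v : lat | H (0, v)].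
  by split; [exact: (subgroup0 HH)|move=> u v /= Hu Hv; exact: H0B].
have Hlat v : H (0, v).
  have -> : v = \sum_j tolat (unitv j) *~ v j.
    apply/ffunP => j; rewrite sum_ffunE (bigD1 j)//= big1 => [|k kj].
      by rewrite ffunMzE tolatE unitvE eqxx addr0 -mulrzr mul1r intz.
    by rewrite ffunMzE tolatE unitvE eq_sym (negbTE kj) mul0rz.
  by apply: (subgroup_sum HH') => j; apply: (subgroupMz HH'); exact: Hunit.
move=> [n v].
have [x px] := offspring_ex o.
have HH1 : is_subgroup [set m | H (m, 0)].
  split; first exact: (subgroup0 HH).
  by move=> m m' /= h h'; have := subgroupB HH h h'; rewrite pairB /= subr0.
have h2 : H (1, 0).
  have := subgroupB HH (HG x _ px (Gs x)) (Hlat (s x)).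
  by rewrite pairB /= subr0 subrr.
have := subgroupD HH (subgroupMz HH1 n h2) (Hlat v).
by rewrite pairD /= addr0 add0r intz.
Qed.

End excursion_span.

(** * The ratio limit for total progenies *)

Lemma near_seq (F : set_system nat) (FF : Filter F) (T : eqType) (s : seq T)
    (Q : T -> nat -> Prop) :
  (forall x, x \in s -> \forall n \near F, Q x n) ->
  \forall n \near F, forall x, x \in s -> Q x n.
Proof.
elim: s => [|x s IH] h; first exact: nearW.
have h1 := h x (mem_head _ _).
have /IH h2 : forall y, y \in s -> \forall n \near F, Q y n.
  by move=> y ys; apply: h; rewrite inE ys orbT.
near=> n => y; rewrite inE => /orP[/eqP->|]; first by near: n.
by move: y; near: n.
Unshelve. all: by end_near. Qed.

Section ratio_limit.
Variables (R : realType) (d : nat).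
Local Notation ty := 'I_d.+1.
Local Notation vec := {ffun ty -> nat}.
Local Notation lat := {ffun ty -> int}.
Variables (p : ty -> vec -> R) (a : 'rV[R]_d.+1) (astar : 'cV[R]_d.+1).
Hypothesis p_offspring : is_offspring p.
Hypothesis p_primitive : primitive p.
Hypothesis p_aperiodic : aperiodic p.
Hypothesis a_pos : forall i, 0 < a 0 i.
Hypothesis a_eigen : a *m mean_mx p = a.
Hypothesis astar_pos : forall i, 0 < astar i 0.
Hypothesis astar_eigen : mean_mx p *m astar = astar.
Variable k : nat -> vec.
Hypothesis k_infty : (\sum_i k n i)%N @[n --> \oo] --> \oo.
Hypothesis k_ratio : forall i,
  (k n i)%:R / (\sum_j k n j)%:R @[n --> \oo] --> a 0 i.

Let p_ge0 i x : 0 <= p i x.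
Proof. by case: (p_offspring i). Qed.

Let p_mass i : (\esum_(x in [set: vec]) (p i x)%:E = 1)%E.
Proof. by case: (p_offspring i). Qed.

Let p_mean i j : (\esum_(x in [set: vec]) ((x j)%:R * p i x)%:E = (mean_mx p i j)%:E)%E.
Proof. by case: p_primitive => fin _; rewrite mxE fineK ?fin. Qed.

Let aM j : \sum_i a 0 i * mean_mx p i j = a 0 j.
Proof. by move/rowP/(_ j): a_eigen; rewrite mxE. Qed.

Let Mastar i : \sum_j mean_mx p i j * astar j 0 = astar i 0.
Proof. by move/colP/(_ i): astar_eigen; rewrite mxE. Qed.

Section type_o.
Variable o : ty.
Local Notation q := (excursion p o).
Local Notation G := (progeny (frozen p o)).
Local Notation F := (progeny p).
Let mu j := a 0 j / a 0 o.

(* The forest made of a single [o] has the trivial frozen part [e_o]. *)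
Let endpoint n : int * lat := ((k n o)%:Z, tolat (k n) - tolat (unitv o)).

Let k_close j (eta : R) : 0 < eta -> \forall n \near \oo,
  `|(k n j)%:R - a 0 j * (\sum_i k n i)%:R| <= eta * (\sum_i k n i)%:R.
Proof.
move=> e0.
have h : \forall n \near \oo, `|a 0 j - (k n j)%:R / (\sum_j k n j)%:R| < eta.
  by move/cvgrPdist_lt : (@k_ratio j) => /(_ _ e0).
have h1 : \forall n \near \oo, (1 <= \sum_i k n i)%N.
  by move/cvgnyPge : k_infty; apply.
near=> n.
have n1 : (1 <= \sum_i k n i)%N by near: n.
have n0 : 0 < (\sum_i k n i)%:R :> R by rewrite ltr0n.
have : `|a 0 j - (k n j)%:R / (\sum_j k n j)%:R| < eta by near: n.
rewrite distrC => /ltW; rewrite -(ler_pM2r n0) -[X in _ * X <= _ -> _](gtr0_norm n0) -normrM mulrBl.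
by rewrite divfK ?gt_eqF.
Unshelve. all: by end_near. Qed.

Let k_large (N : nat) : \forall n \near \oo, (N <= k n o)%N.
Proof.
have a2 : 0 < a 0 o / 2 by rewrite divr_gt0.
have h := k_close o a2.
pose B := (Num.truncn (N%:R / (a 0 o / 2))).+1.
have h1 : \forall n \near \oo, (B <= \sum_i k n i)%N.
  by move/cvgnyPge : k_infty; apply.
near=> n.
have n1 : (B <= \sum_i k n i)%N by near: n.
have : `|(k n o)%:R - a 0 o * (\sum_i k n i)%:R| <= a 0 o / 2 * (\sum_i k n i)%:R by near: n.
rewrite ler_norml => /andP[h2 _].
have h3 : a 0 o / 2 * (\sum_i k n i)%:R <= (k n o)%:R by lra.
rewrite -(ler_nat R); apply: le_trans h3; rewrite mulrC -ler_pdivrMr//.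
by apply: le_trans (ltW (truncnS_gt _)) _; rewrite ler_nat.
Unshelve. all: by end_near. Qed.

Let endpoint_drifts : drifts mu endpoint.
Proof.
split.
  move=> N; near=> n.
  have : (`|N| <= k n o)%N by near: n; exact: k_large.
  by rewrite /endpoint /=; lia.
move=> j eps e0.
have ao := a_pos o.
pose C := 1 + mu j.
have C0 : 0 < C by rewrite addr_gt0// divr_gt0.
pose eta := Num.min (a 0 o / 2) (eps / 2 * (a 0 o / 2) / C).
have eta0 : 0 < eta by rewrite lt_min !divr_gt0// ?mulr_gt0// divr_gt0.
near=> n.
have h1 : `|(k n j)%:R - a 0 j * (\sum_i k n i)%:R| <= eta * (\sum_i k n i)%:R.
  by near: n; exact: k_close.
have h2 : `|(k n o)%:R - a 0 o * (\sum_i k n i)%:R| <= eta * (\sum_i k n i)%:R.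
  by near: n; exact: k_close.
have h3 : ((Num.truncn (2 / eps)).+1 <= k n o)%N by near: n; exact: k_large.
rewrite /endpoint /= !ffE !tolatE unitvE rmorphB /=.
rewrite -[(k n o)%:Z%:~R]/((k n o)%:R) -[(k n j)%:Z%:~R]/((k n j)%:R).
set S : R := (\sum_i k n i)%:R in h1 h2.
have S0 : 0 <= S by rewrite ler0n.
have e1 : eta <= a 0 o / 2 by rewrite ge_min lexx.
have e2 : eta * C <= eps / 2 * (a 0 o / 2) by rewrite -ler_pdivlMr// ge_min lexx orbT.
have h4 : a 0 o / 2 * S <= (k n o)%:R.
  have := ler_wpM2r S0 e1; move: h2; rewrite ler_norml => /andP[h _]; lra.
have h5 : 1 <= eps / 2 * (k n o)%:R.
  have : 2 / eps <= (k n o)%:R.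
    by apply: le_trans (ltW (truncnS_gt _)) _; rewrite ler_nat.
  by rewrite ler_pdivrMr//; lra.
have h6 : `|(k n j)%:R - mu j * (k n o)%:R| <= eps / 2 * (k n o)%:R.
  have -> : (k n j)%:R - mu j * (k n o)%:R =
     ((k n j)%:R - a 0 j * S) - mu j * ((k n o)%:R - a 0 o * S).
    by rewrite /mu; field; rewrite gt_eqF.
  apply: le_trans (ler_normB _ _) _; rewrite normrM (gtr0_norm (divr_gt0 (a_pos j) ao)).
  apply: (@le_trans _ _ (eta * S + mu j * (eta * S))).
    by rewrite lerD// ler_pM2l// divr_gt0.
  have -> : eta * S + mu j * (eta * S) = eta * C * S by rewrite /C; ring.
  apply: (@le_trans _ _ (eps / 2 * (a 0 o / 2) * S)); first by rewrite ler_wpM2r.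
  by rewrite -mulrA ler_pM2l// divr_gt0.
have -> : (k n j)%:R - (j == o)%:Z%:~R - mu j * (k n o)%:R =
   ((k n j)%:R - mu j * (k n o)%:R) - (j == o)%:R :> R by rewrite addrAC.
apply: le_trans (ler_normB _ _) _.
have : `|(j == o)%:R| <= 1 :> R by case: (j == o); rewrite ?normr1 ?normr0.
by lra.
Unshelve. all: by end_near. Qed.

Lemma progeny_unit_walk n : (0 < k n o)%N ->
  (k n o)%:R * F (unitv o) (tolat (k n)) = walkz q (endpoint n).
Proof.
move=> ko; have := @dwass R d p o (unitv o) (tolat (k n)) (vsize (k n)).
rewrite tolatE total_tolat => /(_ ko (lexx _)) ->.
rewrite (sum_box_single (z := unitv o)).
- rewrite unitvE eqxx mul1r -[X in G X](vadd0 (unitv o)) frozen_unit subrr progeny0 eqxx mul1r.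
  by [].
- rewrite mem_box vsize_unit; apply: leq_trans ko _.
  by rewrite /vsize (bigD1 o)//= leq_addr.
- move=> y yo; rewrite -(vadd0 (unitv o)) frozen_unit progeny0 subr_eq0.
  by rewrite (inj_eq (@tolat_inj d)) (negbTE yo) mul0r mulr0.
Qed.

(** The ratio limit, as a lower bound: by the Otter-Dwass formula the ratio is a sum
    over the frozen trees [y] of [y o * G r y] times a ratio of probabilities of the
    random walk, each of which tends to one. Keeping finitely many [y] is enough for
    a lower bound, and the expectation of [y o] is the ratio of eigenvector entries. *)
Lemma progeny_ratio_lower (r : vec) (c : lat) (eps : R) : 0 < eps ->
  \forall n \near \oo,
    ((\sum_i (r i)%:R * astar i 0) / astar o 0 - eps) * F (unitv o) (tolat (k n)) <=
    F r (tolat (k n) - c).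
Proof.
move=> e0.
have [nM _ M_pos] := p_primitive.2.
have q0 := excursion_ge0 p_ge0 o.
have q1 := excursion_mass p_ge0 p_mass p_mean M_pos a_pos aM o.
have qm := excursion_mean p_ge0 p_mass p_mean M_pos a_pos aM o.
have gm := pmass_frozen p_ge0 p_mass p_mean M_pos a_pos aM o.
have qs := excursion_spans p_ge0 p_mass p_mean M_pos p_aperiodic gm.
have fr0 := frozen_ge0 p_ge0 o.
pose L := (\sum_i (r i)%:R * astar i 0) / astar o 0.
have L0 : 0 <= L.
  by rewrite divr_ge0 ?(ltW (astar_pos _))// sumr_ge0// => i _; rewrite mulr_ge0// ltW.
have GL : (\esum_(y in [set: vec]) ((y o)%:R * G r (tolat y))%:E = L%:E)%E.
  transitivity (pexp (frozen p o) (count_type R o) r).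
    by apply: eq_esum => y _; rewrite count_tolat.
  rewrite (frozen_mean_vec p_ge0 p_mass p_mean M_pos a_pos aM) /L mulr_suml; congr EFin.
  apply: eq_bigr => i _.
  by rewrite (frozen_mean_eigen p_ge0 p_mass p_mean M_pos a_pos aM o astar_pos Mastar) mulrA.
have G0 (y : vec) : 0 <= (y o)%:R * G r (tolat y) by rewrite mulr_ge0// progeny_ge0.
have [Y /(_ Y (leqnn _)) YP] := esum_box_approx G0 GL (divr_gt0 e0 (ltr0n _ 2)).
set L' := \sum_(y <- box d Y) _ in YP.
have L'L : L' <= L.
  by rewrite -lee_fin -GL -sumEFin; apply: box_esum_le => y; rewrite lee_fin.
have L'0 : 0 <= L' by apply: sumr_ge0.
pose delta := Num.min (1 / 2) (eps / (4 * (L + 1))).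
have L1 : 0 < L + 1 by rewrite ltr_wpDl.
have d0 : 0 < delta by rewrite lt_min !divr_gt0// mulr_gt0.
have d1 : delta < 1 by apply: (@le_lt_trans _ _ (1 / 2)); [rewrite ge_min lexx|lra].
have dL : delta * L <= eps / 4.
  apply: (@le_trans _ _ (delta * (L + 1))); first by rewrite ler_pM2l// lerDl.
  rewrite -ler_pdivlMr// -mulrA -invfM; first by rewrite ge_min lexx orbT.
(* The shift between the space-time points at which the two progenies evaluate the walk. *)
pose u (y : vec) : int * lat := (- c o, tolat (unitv o) - c - tolat y).
have near1 : \forall n \near \oo, forall y, y \in box d Y ->
    (1 - delta) * walkz q (endpoint n) <= walkz q (endpoint n + u y).
  by apply: near_seq => y _; exact: (strong_ratio q0 q1 qm qs (u y) endpoint_drifts d0 d1).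
pose B := (`|c o| + `|(Num.ceil (`|c o|%N%:R / delta : R))| + Y)%N.
near=> n.
have kB : (B < k n o)%N by near: n; exact: k_large.
have nP : forall y, y \in box d Y ->
    (1 - delta) * walkz q (endpoint n) <= walkz q (endpoint n + u y).
  by near: n.
pose K := tolat (k n).
have kco : 0 < (K - c) o by rewrite !ffE tolatE; move: kB; rewrite /B; lia.
have F0 s v : 0 <= F s v by exact: progeny_ge0.
have ko : (0 < k n o)%N by lia.
have w0 : 0 <= walkz q (endpoint n) by exact: walk_ge0.
have hd : L' * ((1 - delta) * walkz q (endpoint n)) <= ((K - c) o)%:~R * F r (K - c).
  pose N := (`|total (K - c)%R| + Y)%N.
  rewrite (@dwass R d p o r (K - c) N)//; last by rewrite /N; lia.
  apply: (@le_trans _ _ (\sum_(y <- box d Y) (y o)%:R * (G r (tolat y) *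
      walk q `|(K - c)%R o|%N (K - c - tolat y)))); last first.
    apply: sum_box_le; last by rewrite leq_addl.
    by move=> y; rewrite !mulr_ge0// ?progeny_ge0// walk_ge0.
  rewrite mulr_suml big_seq [leRHS]big_seq; apply: ler_sum => y yY.
  rewrite mulrA ler_wpM2l//; apply: le_trans (nP y yY) _.
  rewrite /walkz /endpoint /u /= le_eqVlt; apply/orP; left; apply/eqP; congr walk.
    by rewrite !ffE tolatE.
  by rewrite !addrA subrK.
have hk : (1 - delta) * ((K - c) o)%:~R <= (k n o)%:R :> R.
  rewrite !ffE tolatE rmorphB /= -[(k n o)%:Z%:~R]/((k n o)%:R).
  have : `|c o|%N%:R / delta <= (k n o)%:R :> R.
    apply: le_trans (ceil_ge _) _; rewrite -[leRHS]/((k n o)%:Z%:~R) ler_int.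
    move: kB; rewrite /B; move: (Num.ceil (`|c o|%N%:R / delta : R)) => z.
    by move: (c o) (k n o) => u' m; clear; lia.
  rewrite ler_pdivrMr// => h.
  have : - (c o)%:~R <= `|c o|%N%:R :> R.
    rewrite -[leRHS]/(`|c o|%N%:Z%:~R) -rmorphN ler_int.
    by move: (c o) => z; clear; lia.
  have : 0 <= `|c o|%N%:R :> R by [].
  move: h; move: (`|c o|%N%:R) ((c o)%:~R) ((k n o)%:R) => A1 A2 A3 h1 h2 h3.
  have : (1 - delta) * - A2 <= (1 - delta) * A1 by rewrite ler_wpM2l// subr_ge0 ltW.
  have : delta * A1 >= 0 by rewrite mulr_ge0// ltW.
  by lra.
have hu := progeny_unit_walk ko.
have kp : 0 < ((K - c) o)%:~R :> R by rewrite ltr0z.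
rewrite -(ler_pM2l kp); apply: le_trans hd.
rewrite -hu.
have hL : L - eps <= L' * (1 - delta) * (1 - delta).
  have : L' * delta <= eps / 4 by apply: le_trans dL; rewrite mulrC ler_pM2l.
  have : 0 <= L' * (delta * delta) by rewrite !mulr_ge0// ltW.
  by lra.
have hF := F0 (unitv o) K.
have [neg|pos] := leP (L - eps) 0.
  apply: (@le_trans _ _ 0).
    by rewrite -/L mulrA mulr_le0_ge0// mulr_ge0_le0// ltW.
  by rewrite !mulr_ge0// subr_ge0 ltW.
apply: (@le_trans _ _ (((K - c) o)%:~R * ((L' * (1 - delta) * (1 - delta)) * F (unitv o) K))).
  by rewrite ler_pM2l// ler_wpM2r.
have -> : ((K - c) o)%:~R * (L' * (1 - delta) * (1 - delta) * F (unitv o) K) =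
  (L' * (1 - delta) * F (unitv o) K) * ((1 - delta) * ((K - c) o)%:~R) by ring.
have -> : L' * ((1 - delta) * ((k n o)%:R * F (unitv o) (tolat (k n)))) =
  (L' * (1 - delta) * F (unitv o) K) * (k n o)%:R by rewrite /K; ring.
by rewrite ler_wpM2l// !mulr_ge0// subr_ge0 ltW.
Unshelve. all: by end_near. Qed.

End type_o.

End ratio_limit.

(** * Generations of a marked tree *)

Section tree_levels.
Variable E : choiceType.
Implicit Types (t : mtree E) (u v : seq nat * E) (w : seq nat) (om : seq E).

Lemma mark_inj t u v : t u -> t v -> u.1 = v.1 -> u = v.
Proof. by move=> tu tv; have [_] := nodesP t; apply. Qed.

Lemma root_markP t : t ([::], root_mark t).
Proof. by rewrite /root_mark; case: cid. Qed.

Lemma tree_parent t w l j : t (rcons w l, j) -> exists2 i, t (w, i) & (0 < l)%N.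
Proof.
move=> tl; have [[_ tp tk] _] := nodesP t.
have [[w' i] /= ti e] : (fst @` nodes t) w.
  by apply: (tp _ (rcons w l)); [exact: prefix_rcons|exists (rcons w l, j)].
subst w'; exists i => //.
have [k kP] : exists k, forall l, (fst @` nodes t) (rcons w l) <-> (1 <= l <= k)%N.
  by apply: tk; exists (w, i).
have /kP : (fst @` nodes t) (rcons w l) by exists (rcons w l, j).
by case/andP.
Qed.

Lemma onth_nthE (x0 : E) om l : (l < size om)%N -> onth om l = Some (nth x0 om l).
Proof. by move=> lm; rewrite onthE (nth_map x0). Qed.

(** Children being numbered consecutively from one, the list of their marks carries the
    same information as the set of children. *)
Lemma offspring_word t u : t u -> exists om, forall l j,
  t (rcons u.1 l.+1, j) <-> onth om l = Some j.
Proof.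
move=> tu; have [[_ _ tk] _] := nodesP t.
have [k kP] : exists k, forall l, (fst @` nodes t) (rcons u.1 l) <-> (1 <= l <= k)%N.
  by apply: tk; exists u => //.
have ex l : exists j, (l < k)%N -> t (rcons u.1 l.+1, j).
  have [lk|_] := ltnP l k; last by exists u.2.
  have [[w' j] /= tj e] := (kP l.+1).2 lk.
  by exists j; rewrite -e.
have [m mP] := choice ex; exists (mkseq m k) => l j; split=> [tj|].
  have /kP /= lk : (fst @` nodes t) (rcons u.1 l.+1) by exists (rcons u.1 l.+1, j).
  rewrite (onth_nthE u.2) ?size_mkseq// nth_mkseq//; congr Some.
  by have := mark_inj (mP l lk) tj erefl => -[].
have [lk|lk] := ltnP l k; last by rewrite onth_default// size_mkseq.
by rewrite (onth_nthE u.2) ?size_mkseq// nth_mkseq// => -[<-]; exact: mP.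
Qed.

Definition word t u : seq E :=
  if pselect (t u) is left tu then projT1 (cid (offspring_word tu)) else [::].

Lemma wordP t u : t u -> forall l j, t (rcons u.1 l.+1, j) <-> onth (word t u) l = Some j.
Proof.
by rewrite /word; case: pselect => // tu _; case: cid.
Qed.

Lemma word_ext t t' u : t u -> t' u ->
  (forall l j, t (rcons u.1 l, j) <-> t' (rcons u.1 l, j)) -> word t u = word t' u.
Proof.
move=> tu tu' h; apply: eq_from_onth => l.
case e : (onth (word t' u) l) => [j|].
  by apply/(wordP tu)/h/(wordP tu').
case e' : (onth (word t u) l) => [j|//].
by move/(wordP tu)/h/(wordP tu') : e'; rewrite e.
Qed.

Definition kid_nodes u om : seq (seq nat * E) :=
  [seq (rcons u.1 i.+1, nth u.2 om i) | i <- iota 0 (size om)].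

Lemma mem_kid_nodes u om v : v \in kid_nodes u om <->
  exists l, v.1 = rcons u.1 l.+1 /\ onth om l = Some v.2.
Proof.
rewrite /kid_nodes; split=> [/mapP[i im ->]|[l [v1 ol]]].
  move: im; rewrite mem_iota /= => im; exists i; split => //.
  by rewrite (onth_nthE u.2).
have lm : (l < size om)%N.
  by rewrite ltnNge; apply/negP => /onth_default ol'; rewrite ol' in ol.
apply/mapP; exists l; first by rewrite mem_iota.
by move: ol; rewrite (onth_nthE u.2)// => -[->]; rewrite -v1; case: (v).
Qed.

Lemma kid_nodes_uniq u om : uniq (kid_nodes u om).
Proof. by rewrite map_inj_uniq ?iota_uniq// => i j [] /rcons_inj[]. Qed.

Lemma kid_nodes_marks u om : [seq v.2 | v <- kid_nodes u om] = om.
Proof.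
by rewrite -map_comp; apply: (@eq_from_nth _ u.2) => [|i]; rewrite size_map size_iota// => im;
  rewrite (nth_map 0%N) ?size_iota// nth_iota.
Qed.

Lemma childrenE t u : t u -> children t u = [set` kid_nodes u (word t u)].
Proof.
move=> tu; apply/seteqP; split=> v /=.
  move=> [tv [l v1]]; apply/mem_kid_nodes.
  have tv' : t (rcons u.1 l, v.2) by rewrite -v1; case: (v) tv.
  have [_ _ l0] := tree_parent tv'; exists l.-1; rewrite prednK//; split => //.
  by apply/(wordP tu); rewrite prednK.
move=> /mem_kid_nodes[l [v1 /(wordP tu) tv]]; split; last by exists l.+1.
by rewrite -v1 in tv; case: (v) tv.
Qed.

Lemma card_fset_set_seq (T : choiceType) (s : seq T) (A : set T) : uniq s -> A = [set` s] ->
  #|` fset_set A|%fset = size s.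
Proof.
move=> us ->; apply: perm_size; apply: uniq_perm => // x.
by rewrite in_fset_set ?inE//; apply/idP/idP => //; rewrite inE.
Qed.

Lemma nb_childrenE t u : t u -> nb_children t u = size (word t u).
Proof.
move=> tu; rewrite /nb_children (card_fset_set_seq (kid_nodes_uniq u _) (childrenE tu)).
by rewrite size_map size_iota.
Qed.

Fixpoint level t (h : nat) : seq (seq nat * E) :=
  if h is g.+1 then flatten [seq kid_nodes u (word t u) | u <- level t g]
  else [:: ([::], root_mark t)].

Lemma mem_level t h u : u \in level t h <-> t u /\ size u.1 = h.
Proof.
elim: h u => [|h IH] [w j] /=.
  rewrite inE; split=> [/eqP[-> ->]|[tw /size0nil w0]]; first by split => //; exact: root_markP.
  by subst w; apply/eqP/(mark_inj tw) => //; exact: root_markP.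
split=> [/flattenP[s /mapP[u /IH[tu uh] ->]] /mem_kid_nodes[l /= [-> /(wordP tu) tl]]|[]].
  by rewrite size_rcons uh.
case: (lastP w) => // {}w l tw; rewrite size_rcons => -[wh].
have [i ti l0] := tree_parent tw.
apply/flattenP; exists (kid_nodes (w, i) (word t (w, i))).
  by apply: map_f; apply/IH.
apply/mem_kid_nodes; exists l.-1; rewrite prednK//; split => //.
by apply/(wordP ti); rewrite prednK.
Qed.

Lemma level_uniq t h : uniq (level t h).
Proof.
elim: h => [|h IH] //=.
elim: (level t h) IH (fun u => (mem_level t h u).1) => [|u s IHs] //= /andP[us uniqs] hs.
rewrite cat_uniq kid_nodes_uniq IHs ?andbT/=; last by move=> v vs; apply: hs; rewrite inE vs orbT.
  apply/hasPn => v /flattenP[_ /mapP[u' u's ->]] /mem_kid_nodes[l [v1 _]].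
  apply/negP => /mem_kid_nodes[l' [v1' _]].
  have /rcons_inj[e _] : rcons u'.1 l.+1 = rcons u.1 l'.+1 by rewrite -v1 -v1'.
  have tu : t u by case: (hs u); rewrite ?inE ?eqxx.
  have tu' : t u' by case: (hs u'); rewrite ?inE ?u's ?orbT.
  by move: us; rewrite -(mark_inj tu' tu e) u's.
exact: uniqs.
Qed.

Definition below t (h : nat) : seq (seq nat * E) := flatten [seq level t g | g <- iota 0 h].

Lemma belowS t h : below t h.+1 = below t h ++ level t h.
Proof. by rewrite /below -addn1 iotaD map_cat flatten_cat /= cats0. Qed.

Lemma mem_below t h u : u \in below t h <-> t u /\ (size u.1 < h)%N.
Proof.
elim: h => [|h IH]; first by split => // -[].
rewrite belowS mem_cat; split=> [/orP[/IH[tu uh]|/mem_level[tu ->]]|[tu]].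
- by split => //; exact: ltnW.
- by [].
- by rewrite ltnS leq_eqVlt => /orP[/eqP uh|uh]; apply/orP; [right; apply/mem_level|left; apply/IH].
Qed.

Lemma below_uniq t h : uniq (below t h).
Proof.
elim: h => // h IH; rewrite belowS cat_uniq IH level_uniq andbT.
apply/hasPn => u /mem_level[_ uh]; apply/negP => /mem_below[_].
by rewrite uh ltnn.
Qed.

Lemma root_mark_restr t h : root_mark (restr h t) = root_mark t.
Proof.
have h1 : t ([::], root_mark (restr h t)) by case: (root_markP (restr h t)).
by have [] := mark_inj h1 (root_markP t) erefl.
Qed.

Lemma word_restr t h u : t u -> (size u.1 < h)%N -> word (restr h t) u = word t u.
Proof.
move=> tu uh; apply: word_ext => // [|l j]; first by split => //; exact: ltnW.
by split=> [[]//|tl]; split => //=; rewrite size_rcons.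
Qed.

Lemma level_restr t h g : (g <= h)%N -> level (restr h t) g = level t g.
Proof.
elim: g => [|g IH] gh /=; first by rewrite root_mark_restr.
rewrite IH ?(ltnW gh)//; congr flatten; apply/eq_in_map => u /mem_level[tu ug].
by rewrite word_restr// ug.
Qed.

Lemma below_restr t h g : (g <= h.+1)%N -> below (restr h t) g = below t g.
Proof.
move=> gh; congr flatten; apply/eq_in_map => g'; rewrite mem_iota /= add0n => g'g.
by rewrite level_restr// -ltnS (leq_trans g'g).
Qed.

Lemma height_restr t h : height_le h (restr h t).
Proof. by move=> u []. Qed.

Lemma restr_id t h : height_le h t -> restr h t = t.
Proof.
move=> ht; apply: mtree_eq; apply/seteqP; split=> u /=; first by case.
by move=> tu; split => //; exact: ht.
Qed.

Lemma restr_restr t h h' : (h <= h')%N -> restr h (restr h' t) = restr h t.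
Proof.
move=> hh'; apply: mtree_eq; apply/seteqP; split=> u /= [].
  by move=> [tu _] uh.
by move=> tu uh; split => //; split => //; exact: leq_trans hh'.
Qed.

Lemma level_nil t h u : level t h = [::] -> t u -> (size u.1 < h)%N.
Proof.
move=> lh tu; rewrite ltnNge; apply/negP => hu.
have [[_ tp _] _] := nodesP t.
have [[w i] /= ti e] : (fst @` nodes t) (take h u.1).
  by apply: (tp _ u.1); [exact: prefix_take|exists u].
have : (w, i) \in level t h by apply/mem_level; split => //=; rewrite e size_takel.
by rewrite lh.
Qed.

Lemma extension_inj t t1 t2 h : height_le h.+1 t1 -> height_le h.+1 t2 ->
  restr h t1 = t -> restr h t2 = t ->
  [seq word t1 u | u <- level t h] = [seq word t2 u | u <- level t h] -> t1 = t2.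
Proof.
suff H s1 s2 : height_le h.+1 s1 -> restr h s1 = t -> restr h s2 = t ->
    [seq word s1 u | u <- level t h] = [seq word s2 u | u <- level t h] ->
    forall u, s1 u -> s2 u.
  move=> h1 h2 r1 r2 e; apply: mtree_eq; apply/seteqP; split=> u.
    exact: (H _ _ h1 r1 r2 e).
  by apply: (H _ _ h2 r2 r1 (esym e)).
move=> h1 r1 r2 /eq_in_map e [w j] s1w; have := h1 _ s1w => /=.
rewrite leq_eqVlt => /orP[/eqP wh|wh]; last first.
  have : restr h s1 (w, j) by [].
  by rewrite r1 -r2 => -[].
case: (lastP w) wh s1w => // {}w l; rewrite size_rcons => -[wh] s1w.
have [i s1i l0] := tree_parent s1w.
have ti : t (w, i) by rewrite -r1; split => //=; rewrite wh.
have s2i : s2 (w, i) by move: ti; rewrite -r2 => -[].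
have /e we : (w, i) \in level t h by apply/mem_level.
rewrite -(prednK l0); apply/(wordP s2i); rewrite -we; apply/(wordP s1i).
by rewrite prednK.
Qed.

Lemma tree_below_inj t t' h : height_le h t -> height_le h t' ->
  below t h.+1 =i below t' h.+1 -> t = t'.
Proof.
move=> ht ht' e; apply: mtree_eq; apply/seteqP; split=> u tu.
  by have /mem_below[] : u \in below t' h.+1 by rewrite -e; apply/mem_below; split => //; rewrite ltnS ht.
by have /mem_below[] : u \in below t h.+1 by rewrite e; apply/mem_below; split => //; rewrite ltnS ht'.
Qed.

End tree_levels.

Section tree_counts.
Variable E : finType.
Implicit Types (t : mtree E) (u v : seq nat * E) (om : seq E).

(** The numbers of letters of each type, that is the offspring vector encoded by a word. *)
Definition content om : {ffun E -> nat} := [ffun j => count_mem j om].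

Lemma children_by_markE t u : t u -> children_by_mark t u = content (word t u).
Proof.
move=> tu; apply/ffunP => j; rewrite !ffunE.
rewrite (@card_fset_set_seq _ [seq v <- kid_nodes u (word t u) | v.2 == j]).
- transitivity (count_mem j [seq v.2 | v <- kid_nodes u (word t u)]).
    by rewrite count_map size_filter.
  by rewrite kid_nodes_marks.
- by rewrite filter_uniq// kid_nodes_uniq.
- rewrite childrenE//; apply/seteqP; split=> v /=; rewrite mem_filter.
    by move=> [-> <-]; rewrite eqxx.
  by move=> /andP[/eqP].
Qed.

Definition generation t h : {ffun E -> nat} := content [seq u.2 | u <- level t h].

Definition ancestors t h : {ffun E -> nat} := content [seq u.2 | u <- below t h].

Lemma content_cat om om' j : content (om ++ om') j = (content om j + content om' j)%N.
Proof. by rewrite !ffunE count_cat. Qed.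

Lemma ancestorsS t h j : ancestors t h.+1 j = (ancestors t h j + generation t h j)%N.
Proof. by rewrite /ancestors belowS map_cat content_cat. Qed.

Lemma sum_content om : (\sum_j content om j)%N = size om.
Proof.
elim: om => [|x om IH] /=; first by rewrite big1// => j _; rewrite ffunE.
rewrite -IH; under eq_bigr do rewrite ffunE /=.
rewrite big_split /= (bigD1 x)//= eqxx big1 => [|j /negbTE]; last by rewrite eq_sym => ->.
by rewrite addn0 add1n; congr _.+1; apply: eq_bigr => j _; rewrite ffunE.
Qed.

Lemma card_ancestors t h j : exists s : seq (seq nat * E),
  [/\ uniq s, size s = ancestors t h j &
      forall v, v \in s <-> [/\ t v, v.2 = j & (size v.1 < h)%N]].
Proof.
exists [seq v <- below t h | v.2 == j]; split.
- by rewrite filter_uniq// below_uniq.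
- by rewrite ffunE count_map size_filter.
- move=> v; rewrite mem_filter; split=> [/andP[/eqP v2 /mem_below[tv vh]]|[tv v2 vh]]; first by [].
  by rewrite v2 eqxx; apply/mem_below.
Qed.

Lemma has_size_ancestors t k h j : has_size t k -> (ancestors t h j <= k j)%N.
Proof.
move=> /(_ j) tk; have [s [us <- hs]] := card_ancestors t h j.
rewrite -(card_fset_set_seq us erefl); apply: geq_card_fset_set.
move: tk; rewrite card_eq_le => /andP[tk _]; apply: card_le_trans tk.
by apply: subset_card_le => v /= /hs[tv v2 _].
Qed.

Lemma has_sizeE t k h : level t h = [::] -> has_size t k <-> ancestors t h = k.
Proof.
move=> th; suff cE j : ([set u | t u /\ u.2 = j] #= `I_(ancestors t h j))%card.
  split=> [tk|<- //]; apply/ffunP => j.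
  have /card_fset_set := tk j; have /card_fset_set := cE j.
  by move=> -> ->.
have [s [us <- hs]] := card_ancestors t h j.
suff -> : [set u | t u /\ u.2 = j] = [set` s].
  have <- : [set` fset_set [set` s]] = [set` s] by rewrite fset_setK//; exact: finite_seq.
  by apply/card_eq_fsetP; exact: card_fset_set_seq.
apply/seteqP; split=> v /=; last by move=> /hs[].
by move=> [tv v2]; apply/hs; split => //; exact: level_nil th tv.
Qed.

Lemma levelS_nil t h : level t h = [::] -> level t h.+1 = [::].
Proof. by move=> /= ->. Qed.

Lemma size_below t h : level t h <> [::] -> (h < size (below t h.+1))%N.
Proof.
elim: h => [|h IH] th; first by rewrite belowS.
rewrite belowS size_cat; have /IH hs : level t h <> [::] by move=> /levelS_nil.
have : (0 < size (level t h.+1))%N by case: (level t h.+1) th.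
by lia.
Qed.

Lemma sum_ancestors t h : (\sum_j ancestors t h j)%N = size (below t h).
Proof. by rewrite sum_content size_map. Qed.

(** Each generation before an empty one contributes at least one individual, so a finite
    tree is not higher than its size. *)
Lemma has_size_level t k h : has_size t k -> (\sum_j k j <= h)%N -> level t h = [::].
Proof.
move=> tk kh; case e : (level t h) => [//|u s].
have /size_below : level t h <> [::] by rewrite e.
rewrite -sum_ancestors => hs.
have : (\sum_j ancestors t h.+1 j <= \sum_j k j)%N by apply: leq_sum => j _; exact: has_size_ancestors.
by lia.
Qed.

Lemma level_nil_restr t h : level t h = [::] -> restr h t = t.
Proof. by move=> th; apply: restr_id => u tu; exact/ltnW/(level_nil th tu). Qed.

Lemma has_size_restr t (k : {ffun E -> nat}) h : (\sum_j k j <= h)%N -> has_size (restr h t) k <-> has_size t k.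
Proof.
move=> kh; split=> tk.
  have : level (restr h t) h = [::] by exact: has_size_level tk kh.
  by rewrite level_restr// => /level_nil_restr <-.
by rewrite level_nil_restr//; exact: has_size_level tk kh.
Qed.

Lemma generationS t h : generation t h.+1 = content (flatten [seq word t u | u <- level t h]).
Proof.
rewrite /generation /= map_flatten -map_comp; congr (content (flatten _)).
by apply: eq_map => u /=; rewrite kid_nodes_marks.
Qed.

End tree_counts.

(** * Offspring words *)

Section words.
Variable E : finType.
Implicit Types (x : {ffun E -> nat}) (w : seq E).

Definition decr x (j : E) : {ffun E -> nat} := [ffun l => (x l - (l == j))%N].

Fixpoint words (n : nat) x : seq (seq E) :=
  if n is m.+1 then
    flatten [seq [seq j :: w | w <- words m (decr x j)] | j <- enum E & (0 < x j)%N]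
  else [:: [::]].

Lemma content_cons j w : content (j :: w) = [ffun l => ((l == j) + content w l)%N].
Proof. by apply/ffunP => l; rewrite !ffunE /= eq_sym. Qed.

Lemma decr_cons x j w : (0 < x j)%N -> content w = decr x j <-> content (j :: w) = x.
Proof.
rewrite content_cons => xj; split=> [->|<-]; apply/ffunP => l; rewrite !ffunE.
  by case: eqP => [->|_] /=; rewrite ?subnKC// subn0.
by rewrite addKn.
Qed.

Lemma decr_size x j m : (0 < x j)%N -> (\sum_l x l = m.+1)%N -> (\sum_l decr x j l = m)%N.
Proof.
move=> xj; rewrite (bigD1 j)//= [in X in _ -> X](bigD1 j)//= ffunE eqxx.
under [in X in _ -> X]eq_bigr => l /negbTE lj do rewrite ffunE lj subn0.
by lia.
Qed.

Lemma mem_words n x w : (\sum_j x j = n)%N -> (w \in words n x) = (content w == x).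
Proof.
elim: n x w => [|n IH] x w xn /=.
  have x0 : x = content [::].
    apply/ffunP => j; rewrite ffunE; apply/eqP; rewrite -leqn0 -xn.
    by rewrite (bigD1 j)//= leq_addr.
  rewrite inE x0; apply/eqP/eqP => [->//|/(congr1 (fun y : {ffun E -> nat} => (\sum_j y j)%N))].
  by rewrite !sum_content => /size0nil.
apply/flattenP/eqP => [[s /mapP[j]]|wx].
  rewrite mem_filter => /andP[xj _] -> /mapP[w' + ->].
  by rewrite IH; [move=> /eqP/(decr_cons _ xj)|exact: decr_size].
case: w wx => [|j w] wx.
  by move: xn; rewrite -wx sum_content.
have xj : (0 < x j)%N by rewrite -wx content_cons ffunE eqxx.
exists [seq j :: w' | w' <- words n (decr x j)].
  by apply: map_f; rewrite mem_filter xj mem_enum.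
apply: map_f; rewrite IH; last exact: decr_size.
by apply/eqP/(decr_cons _ xj).
Qed.

Lemma words_uniq n x : uniq (words n x).
Proof.
elim: n x => // n IH x /=.
have := filter_uniq (fun j => 0 < x j)%N (enum_uniq E).
elim: [seq j <- _ | _] => //= j s IHs /andP[js us].
rewrite cat_uniq map_inj_uniq ?IH ?IHs ?andbT//=; last by move=> w w' [].
apply/hasPn => w /flattenP[_ /mapP[i si ->] /mapP[w' _ ->]]; apply/negP => /mapP[w'' _ [ij _]].
by move: js; rewrite -ij si.
Qed.

(** A multinomial coefficient, by the recursion on the first letter. *)
Lemma size_words n x : (\sum_j x j = n)%N ->
  (size (words n x) * \prod_j (x j)`! = n`!)%N.
Proof.
elim: n x => [|n IH] x xn /=.
  rewrite mul1n big1// => j _; suff -> : x j = 0%N by [].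
  by apply/eqP; rewrite -leqn0 -xn (bigD1 j)//= leq_addr.
rewrite size_flatten /shape -map_comp sumnE big_map big_filter big_enum_cond /=.
rewrite big_distrl /= factS -[in RHS]xn big_distrl /=.
rewrite [RHS](bigID (fun j => 0 < x j)%N) /= [X in (_ = _ + X)%N]big1 ?addn0; last first.
  by move=> j; rewrite -eqn0Ngt => /eqP->.
apply: eq_bigr => j xj; rewrite size_map -(IH _ (decr_size xj xn)) mulnCA; congr muln.
rewrite (bigD1 j)//= [in RHS](bigD1 j)//= mulnA ffunE eqxx subn1.
congr muln; first by case: (x j) xj.
by apply: eq_bigr => l /negbTE lj; rewrite ffunE lj subn0.
Qed.

End words.

Section offspring_words.
Variables (R : realType) (d : nat).
Local Notation ty := 'I_d.+1.
Local Notation vec := {ffun ty -> nat}.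
Local Notation lat := {ffun ty -> int}.

Definition order_weight (w : seq ty) : R := (\prod_j (content w j)`!)%N%:R / (size w)`!%:R.

Lemma order_weight_ge0 w : 0 <= order_weight w.
Proof. by rewrite divr_ge0. Qed.

Lemma esum_fibers (T T' : choiceType) (c : T -> T') (f : T -> \bar R) :
  (forall w, 0 <= f w)%E ->
  (\esum_(w in [set: T]) f w =
   \esum_(x in [set: T']) \esum_(w in [set w | c w = x]) f w)%E.
Proof.
move=> f0; rewrite esum_esum//.
apply: (reindex_esum _ _ (fun z => z.2)); split=> //=.
- by move=> [x w] [x' w'] /set_mem[/= _ <-] /set_mem[/= _ <-] /= ->.
- by move=> w _; exists (c w, w).
Qed.

(** The weight of a word is one over the number of words with the same content, so the
    order of the children disappears from the sums. *)
Lemma esum_words (f : vec -> R) : (forall x, 0 <= f x) ->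
  (\esum_(w in [set: seq ty]) (order_weight w * f (content w))%:E =
   \esum_(x in [set: vec]) (f x)%:E)%E.
Proof.
move=> f0; rewrite (@esum_fibers _ _ (@content ty)); last first.
  by move=> w; rewrite lee_fin mulr_ge0// order_weight_ge0.
apply: eq_esum => x _.
set n := (\sum_j x j)%N.
have -> : [set w | content w = x] = [set` words n x].
  by apply/seteqP; split=> w /=; rewrite mem_words// => /eqP.
rewrite esum_fset; [|exact: finite_seq|]; last first.
  by move=> w _; rewrite lee_fin mulr_ge0// order_weight_ge0.
rewrite -fsbig_seq ?words_uniq//.
pose c : R := (\prod_j (x j)`!)%N%:R / n`!%:R * f x.
rewrite (eq_big_seq (fun=> c%:E)) => [|w]; last first.
  rewrite mem_words// => /eqP wx; rewrite /order_weight wx.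
  by have -> : size w = n by rewrite -sum_content wx.
rewrite sumEFin big_const_seq count_predT iter_addr_0; congr EFin.
rewrite -[LHS]mulr_natl /c mulrA mulrA -natrM size_words// divff ?mul1r//.
Qed.

Variable p : ty -> vec -> R.
Hypothesis p_ge0 : forall i x, 0 <= p i x.

Definition word_weight (i : ty) (w : seq ty) : R := order_weight w * p i (content w).

Lemma word_weight_ge0 i w : 0 <= word_weight i w.
Proof. by rewrite mulr_ge0// order_weight_ge0. Qed.

Definition list_weight (ms : seq ty) (L : seq (seq ty)) : R :=
  \prod_(z <- zip ms L) word_weight z.1 z.2.

Lemma list_weight_ge0 ms L : 0 <= list_weight ms L.
Proof. by apply: prodr_ge0 => z _; exact: word_weight_ge0. Qed.

Lemma content0 : content [::] = 0 :> vec.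
Proof. by apply/ffunP => j; rewrite !ffunE. Qed.

Lemma content_unit i w : content (i :: w) = unitv i + content w :> vec.
Proof. by apply/ffunP => j; rewrite content_cons !ffunE. Qed.

Lemma contentD w w' : content (w ++ w') = content w + content w' :> vec.
Proof. by apply/ffunP => j; rewrite content_cat !ffE. Qed.

Lemma esum_offspring (r : vec) i (k : lat) :
  (\esum_(x in [set: vec]) (p i x * progeny p (r + x) (k - tolat (unitv i)))%:E =
   (progeny p (r + unitv i) k)%:E)%E.
Proof.
rewrite (@esum_box _ _ _ `|total k|%N) => [|y|y yn]; last 2 first.
- by rewrite lee_fin mulr_ge0// progeny_ge0.
- congr EFin; apply/eqP; rewrite mulf_eq0 orbC; apply/orP; left.
  by apply: contraNT yn; apply: progeny_box; lia.
by rewrite sumEFin -progeny_kill//; lia.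
Qed.

Lemma esum_cons (T : choiceType) (n : nat) (f : seq T -> \bar R) : (forall L, 0 <= f L)%E ->
  (\esum_(L in [set L | size L = n.+1]) f L =
   \esum_(w in [set: T]) \esum_(L in [set L | size L = n]) f (w :: L))%E.
Proof.
move=> f0; rewrite esum_esum//.
rewrite (reindex_esum ([set: T] `*`` fun=> [set L | size L = n]) _ (fun z => z.1 :: z.2))//.
split=> //=.
- by move=> [w L] /= [_ ->].
- by move=> [w L] [w' L'] _ _ /= [-> ->].
- by move=> [|w L] //= [Ln]; exists (w, L).
Qed.

(** The branching property for a whole generation: its individuals, of types [ms],
    die one after the other. *)
Lemma progeny_generation (ms : seq ty) (r : vec) (k : lat) :
  (\esum_(L in [set L : seq (seq ty) | size L = size ms])
     (list_weight ms L * progeny p (r + content (flatten L)) (k - tolat (content ms)))%:E =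
   (progeny p (r + content ms) k)%:E)%E.
Proof.
elim: ms r k => [|i ms IH] r k.
  rewrite (_ : [set L | _] = [set [::]]); last first.
    by apply/seteqP; split=> L /=; [exact: size0nil|move=> ->].
  rewrite esum_set1; last by rewrite lee_fin mulr_ge0 ?list_weight_ge0// progeny_ge0.
  by rewrite /list_weight big_nil mul1r !content0 tolat0 subr0.
rewrite esum_cons => [|L]; last by rewrite lee_fin mulr_ge0 ?list_weight_ge0// progeny_ge0.
rewrite content_unit vaddA vaddAC -esum_offspring.
rewrite -(esum_words (f := fun x => p i x * _)); last first.
  by move=> x; rewrite mulr_ge0// progeny_ge0.
apply: eq_esum => w _; rewrite vaddAC.
rewrite mulrA EFinM -IH -esumZl; last 2 first.
- exact: word_weight_ge0.
- by move=> L; rewrite lee_fin mulr_ge0 ?list_weight_ge0// progeny_ge0.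
apply: eq_esum => L _; rewrite -EFinM /list_weight /= big_cons -!mulrA /=.
by rewrite contentD vaddA tolatD opprD addrA.
Qed.

End offspring_words.

(** * Extension of a tree by one generation *)

Section extension.
Variable E : choiceType.
Implicit Types (t : mtree E) (u v : seq nat * E).

Definition extend_set t h (g : seq nat * E -> seq E) : set (seq nat * E) :=
  [set v | (t v /\ (size v.1 <= h)%N) \/
     exists u, [/\ t u, size u.1 = h & v \in kid_nodes u (g u)]].

Lemma extend_subproof t h g : is_marked_tree (extend_set t h g).
Proof.
have kid v u : v \in kid_nodes u (g u) -> size v.1 = (size u.1).+1.
  by move=> /mem_kid_nodes[l [-> _]]; rewrite size_rcons.
have [[t0 tp tk] _] := nodesP t; split; last first.
  move=> v v' /= [[tv hv]|[u [tu uh vk]]] [[tv' hv']|[u' [tu' uh' vk']]] e.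
  - exact: mark_inj tv tv' e.
  - by move: hv; rewrite e (kid _ _ vk') uh' ltnn.
  - by move: hv'; rewrite -e (kid _ _ vk) uh ltnn.
  - move: vk vk' e => /mem_kid_nodes[l [v1 ol]] /mem_kid_nodes[l' [v1' ol']] e.
    have /rcons_inj[ue ll'] : rcons u.1 l.+1 = rcons u'.1 l'.+1 by rewrite -v1 -v1'.
    move: ol'; rewrite -(mark_inj tu tu' ue) -ll' ol => -[vv'].
    by case: (v) (v') e vv' => [? ?] [? ?] /= -> ->.
split.
- by case: t0 => -[w i] /= ti w0; subst w; exists ([::], i) => //; left.
- move=> w w' ww' [[w2 j] /= H e]; subst w2.
  have [hw|hw] := leqP (size w) h; last first.
    case: H => [[_ hw']|[u [tu uh vk]]].
      by move: hw; rewrite ltnNge (leq_trans (size_prefix ww') hw').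
    suff <- : w' = w by exists (w', j) => //; right; exists u.
    have sw' := kid _ _ vk; move: ww' sw' hw => /prefixP[s ->] /=.
    by case: s => [|y s]; rewrite ?cats0// size_cat uh /=; lia.
  suff [[w2 i] /= ti e] : (fst @` nodes t) w.
    by subst w2; exists (w, i) => //; left.
  case: H => [[tw' _]|[u [tu uh /mem_kid_nodes[l [/= v1 _]]]]]; first by apply: (tp _ _ ww'); exists (w', j).
  apply: (tp _ u.1); last by exists u.
  move: ww' => /prefixP[s]; rewrite v1; case: (lastP s) => [|s' y].
    by rewrite cats0 => e; move: hw; rewrite -e size_rcons uh ltnn.
  by rewrite -rcons_cat => /rcons_inj[-> _]; exact: prefix_prefix.
- move=> w [[w2 j] /= H e]; subst w2.
  have [hw|hw|hw] := ltngtP (size w) h.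
  + have tw : t (w, j) by case: H => [[]//|[u [_ uh /kid /= sw]]]; move: hw; rewrite sw uh ltnNge leqnSn.
    have [k kP] : exists k, forall l, (fst @` nodes t) (rcons w l) <-> (1 <= l <= k)%N.
      by apply: tk; exists (w, j).
    exists k => l; rewrite -kP; split=> -[v H' e].
      case: H' => [[tv _]|[u [_ uh /kid]]]; first by exists v.
      by rewrite e size_rcons uh => -[ee]; move: hw; rewrite ee ltnn.
    by exists v => //; left; rewrite e size_rcons.
  + exists 0%N => l; split; last by rewrite leqn0 lt0n => /andP[/negbTE->].
    move=> [v H' e]; case: H' => [[_]|[u [_ uh /kid]]].
      by rewrite e size_rcons => /(ltn_trans hw); rewrite ltnn.
    by rewrite e size_rcons uh => -[ee]; move: hw; rewrite ee ltnn.
  + have tw : t (w, j).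
      by case: H => [[]//|[u [_ uh /kid /= sw]]]; move: hw; rewrite sw uh => /esym/n_Sn.
    exists (size (g (w, j))) => l; split=> [[v H' e]|].
      case: H' => [[_]|[u [tu uh /mem_kid_nodes[l' [v1 ol]]]]].
        by rewrite e size_rcons hw ltnn.
      move: v1; rewrite e => /rcons_inj[ue ->] /=.
      have uE : (w, j) = u by exact: mark_inj tw tu ue.
      rewrite uE ltnNge; apply/negP => /onth_default ol'; by rewrite ol' in ol.
    case: l => //= l lg; exists (rcons w l.+1, nth j (g (w, j)) l) => //.
    right; exists (w, j); split => //; apply/mem_kid_nodes; exists l; split => //=.
    exact: onth_nthE.
Qed.

Definition extend t h g : mtree E := MTree (extend_subproof t h g).

Lemma restr_extend t h g : restr h (extend t h g) = restr h t.
Proof.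
apply: mtree_eq; apply/seteqP; split=> v /= [].
  case=> [//|[u [_ uh /mem_kid_nodes[l [-> _]]]]].
  by rewrite size_rcons uh ltnn.
by move=> tv hv; split => //; left.
Qed.

Lemma height_extend t h g : height_le h.+1 (extend t h g).
Proof.
move=> v [[_ /leqW//]|[u [_ uh /mem_kid_nodes[l [-> _]]]]].
by rewrite size_rcons uh.
Qed.

Lemma word_extend t h g u : u \in level t h -> word (extend t h g) u = g u.
Proof.
move=> /mem_level[tu uh]; have eu : extend t h g u by left; rewrite uh.
apply: eq_from_onth => l.
have H j : onth (g u) l = Some j -> onth (word (extend t h g) u) l = Some j.
  move=> gl; apply/(wordP eu); right; exists u; split => //.
  by apply/mem_kid_nodes; exists l.
case gl : (onth (g u) l) => [j|]; first by rewrite (H j).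
case wl : (onth (word _ u) l) => [j|//]; move/(wordP eu): wl => -[[_]|[u' [tu' uh']]].
  by rewrite size_rcons uh ltnn.
move=> /mem_kid_nodes[l' [/= /rcons_inj[ue [<-]]]].
by rewrite -(mark_inj tu tu' ue) gl.
Qed.

(** This turns a sum over the possible next generations into a sum over lists of words,
    to which the branching property applies. *)
Lemma extension_bij t h : height_le h t ->
  set_bij [set s | height_le h.+1 s /\ restr h s = t]
    [set L : seq (seq E) | size L = size (level t h)]
    (fun s => [seq word s u | u <- level t h]).
Proof.
move=> ht; split.
- by move=> s _ /=; rewrite size_map.
- move=> s s' /set_mem[hs rs] /set_mem[hs' rs']; exact: extension_inj.
- move=> L /= Ln; pose g u := nth [::] L (index u (level t h)).
  exists (extend t h g).
    by split; [exact: height_extend|rewrite restr_extend restr_id].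
  apply: (@eq_from_nth _ [::]); rewrite size_map// => l ll.
  rewrite (nth_map ([::], root_mark t))// word_extend ?mem_nth//.
  by rewrite /g index_uniq// level_uniq.
Qed.

End extension.

(** * Cylinders and the law of the Galton-Watson tree *)

Section cylinders.
Variables (R : realType) (E : pointedType).
Implicit Types t : mtree E.

Lemma restr_dist t t' h : tree_dist R t t' < 2 `^ (- h%:R) -> restr h t = restr h t'.
Proof.
move=> tt'; have [->//|/(tree_distE R)[n [nP e]]] := pselect (t = t').
move: tt'; rewrite e => hn; apply/nP; rewrite ltnNge; apply: contraL hn => nh.
have nh' : n%:R <= h%:R :> R by rewrite ler_nat.
by rewrite -leNgt ler_powR ?ler1n//; lra.
Qed.

Lemma dist_restr t t' h : restr h t = restr h t' -> tree_dist R t t' <= 2 `^ (- h%:R).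
Proof.
have [->|/(tree_distE R)[n [nP ->]] /nP hn] := pselect (t = t').
  by rewrite tree_distxx powR_ge0.
have hn' : h.+1%:R <= n%:R :> R by rewrite ler_nat.
by rewrite ler_powR ?ler1n//; move: hn'; rewrite -natr1; lra.
Qed.

Lemma cylinder_open (Q : mtree E -> Prop) h : open [set t : treespace R E | Q (restr h t)].
Proof.
rewrite openE => t /= Qt; apply/nbhs_ballP; exists (2 `^ (- h%:R)); first exact: powR_gt0.
by move=> t'; rewrite ballEmdist /= => /restr_dist <-.
Qed.

Lemma cylinder_measurable (Q : mtree E -> Prop) h :
  measurable [set t : treespace R E | Q (restr h t)].
Proof. by apply: sub_sigma_algebra; exact: cylinder_open. Qed.

Section partition.
Variables (c : E -> nat) (c_inj : injective c).
Context (D : measure_display) (Omega : measurableType D) (P : probability Omega R).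
Variable X : {RV P >-> treespace R E}.

Lemma cylinder_event (Q : mtree E -> Prop) h : measurable [set w | Q (restr h (X w))].
Proof.
rewrite -[X in measurable X]setTI.
exact: (measurable_funP X measurableT _ (cylinder_measurable Q h)).
Qed.

Lemma tree_code h : exists code : mtree E -> nat, forall t t',
  height_le h t -> height_le h t' -> code t = code t' -> t = t'.
Proof.
exists (fun t => choice.pickle [seq (u.1, c u.2) | u <- below t h.+1]) => t t' ht ht'.
move=> /(pcan_inj choice.pickleK)/inj_map e; apply: (tree_below_inj ht ht') => u.
by rewrite e// => -[w i] [w' i'] /= [-> /c_inj ->].
Qed.

(** Trees of height at most [h] are finite, hence countably many, so that an event which
    depends on [restr h] splits into cylinders. *)
Lemma measure_cylinders (B : set (treespace R E)) h (A : set Omega) :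
  measurable A -> (forall t, B t -> height_le h t) ->
  P ([set w | B (restr h (X w))] `&` A) =
  (\esum_(t in B) P ([set w | restr h (X w) = t] `&` A))%E.
Proof.
move=> mA hB; have [code code_inj] := tree_code h.
pose F n := [set w | B (restr h (X w)) /\ code (restr h (X w)) = n] `&` A.
have mF n : measurable (F n).
  by apply: measurableI => //; exact: (cylinder_event (fun t => B t /\ code t = n)).
have -> : [set w | B (restr h (X w))] `&` A = \bigcup_n F n.
  apply/seteqP; split=> [w [Bw Aw]|w [n _ [[Bw _] Aw]]] //.
  by exists (code (restr h (X w))).
rewrite measure_semi_bigcup//; last 2 first.
- by move=> i j _ _ [w [[[_ <-] _] [[_ <-] _]]].
- exact: bigcupT_measurable.
rewrite nneseries_esumT//.
transitivity (\esum_(n in code @` B) P (F n))%E.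
  rewrite esum_mkcond [RHS]esum_mkcond; apply: eq_esum => n _; rewrite in_setT.
  case: ifPn => // nB; suff -> : F n = set0 by rewrite measure0.
  apply/seteqP; split=> // w [[Bw cw] _]; move/negP: nB; apply; rewrite inE.
  by exists (restr h (X w)).
rewrite esum_image; last by move=> t t' /set_mem/hB ht /set_mem/hB ht'; exact: code_inj.
apply: eq_esum => t Bt; congr (P (_ `&` _)); apply/seteqP; split=> w /=.
  by move=> [Bw /code_inj]; apply; [exact: height_restr|exact: hB].
by move=> wt; rewrite wt.
Qed.

End partition.
End cylinders.

Section galton_watson.
Variables (R : realType) (d : nat).
Local Notation ty := 'I_d.+1.
Local Notation vec := {ffun ty -> nat}.
Local Notation lat := {ffun ty -> int}.
Variables (p : ty -> vec -> R) (alpha : ty -> R).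
Hypothesis p_ge0 : forall i x, 0 <= p i x.
Hypothesis alpha_ge0 : forall i, 0 <= alpha i.

Definition gw_weight h (t : mtree ty) : R :=
  alpha (root_mark t) * \prod_(u <- below t h) word_weight p u.2 (word t u).

Lemma gw_weight_ge0 h t : 0 <= gw_weight h t.
Proof. by rewrite mulr_ge0// prodr_ge0// => u _; exact: word_weight_ge0. Qed.

Lemma order_probE (t : mtree ty) u : t u -> order_prob R t u = order_weight R (word t u).
Proof. by move=> tu; rewrite /order_prob children_by_markE// nb_childrenE. Qed.

Lemma gw_weightS h t t' : restr h t' = t ->
  gw_weight h.+1 t' = gw_weight h t *
    list_weight p [seq u.2 | u <- level t h] [seq word t' u | u <- level t h].
Proof.
move=> <-; rewrite /gw_weight root_mark_restr belowS big_cat /= mulrA; congr (_ * _ * _).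
  rewrite below_restr//; apply: eq_big_seq => u /mem_below[tu uh].
  by rewrite word_restr.
by rewrite level_restr// /list_weight zip_map big_map.
Qed.

Context (D : measure_display) (Omega : measurableType D) (P : probability Omega R).
Variable tau : {RV P >-> treespace R ty}.
Hypothesis tau_gw : gw_tree p alpha tau.

Lemma gw_law h t : height_le h t -> P [set w | restr h (tau w) = t] = (gw_weight h t)%:E.
Proof.
move=> ht; rewrite tau_gw//; congr (_ * _)%:E.
rewrite (_ : [set u | _] = [set` below t h]); last first.
  by apply/seteqP; split=> u /= /mem_below.
rewrite -fsbig_seq ?below_uniq//; apply: eq_big_seq => u /mem_below[tu uh].
by rewrite order_probE// children_by_markE.
Qed.

Lemma size_event (k : vec) : measurable [set w | has_size (tau w) k].
Proof.
have -> : [set w | has_size (tau w) k] =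
    [set w | has_size (restr (vsize k) (tau w)) k].
  by apply/seteqP; split=> w /= /has_size_restr; apply.
exact: (cylinder_event tau (fun t => has_size t k)).
Qed.

Lemma ancestorsD (t : mtree ty) h : ancestors t h.+1 = ancestors t h + generation t h.
Proof. by apply/ffunP => j; rewrite ancestorsS ffvD. Qed.

Lemma ancestors_restr (t : mtree ty) h g : (g <= h.+1)%N ->
  ancestors (restr h t) g = ancestors t g.
Proof. by move=> gh; rewrite /ancestors below_restr. Qed.

(** The individuals of the last generation of [t] behave as the roots of a forest that must
    contain what is missing to [k]. By descending induction on [h]: beyond the
    size [k] there is nothing left to add, and the step sums over the extensions of [t]. *)
Lemma gw_size_joint (k : vec) h t : height_le h t ->
  P ([set w | restr h (tau w) = t] `&` [set w | has_size (tau w) k]) =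
  (gw_weight h t * progeny p (generation t h) (tolat k - tolat (ancestors t h)))%:E.
Proof.
pose H := (vsize k).+1.
have base g s : (H <= g)%N -> height_le g s ->
  P ([set w | restr g (tau w) = s] `&` [set w | has_size (tau w) k]) =
  (gw_weight g s * progeny p (generation s g) (tolat k - tolat (ancestors s g)))%:E.
  move=> Hg hs; have [sk|sk] := pselect (has_size s k).
    have sg : level s g = [::] by apply: (has_size_level sk); exact: ltnW.
    have -> : generation s g = 0 by rewrite /generation sg content0.
    have -> : ancestors s g = k by apply/(has_sizeE _ sg).
    rewrite progeny0 subrr eqxx mulr1 -gw_law//; congr (P _).
    apply/seteqP; split=> [w []//|w ws]; split => //=.
    by apply/(has_size_restr (h := g) (tau w)); [exact: ltnW|rewrite ws].
  have -> : [set w | restr g (tau w) = s] `&` [set w | has_size (tau w) k] = set0.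
    apply/seteqP; split=> w //= [ws wk]; apply: sk; rewrite -ws.
    by apply/has_size_restr => //; exact: ltnW.
  rewrite measure0; have -> : progeny p (generation s g) (tolat k - tolat (ancestors s g)) = 0.
    apply/eqP; apply: contra_notT sk => nz.
    have anc j : (ancestors s g.+1 j <= k j)%N.
      have := progeny_supp nz j; rewrite ancestorsS -lez_nat PoszD.
      by rewrite fflD fflN !tolatE lerBrDl.
    have sg : level s g = [::].
      case e : (level s g) => [//|u l]; have /size_below : level s g <> [::] by rewrite e.
      rewrite -sum_ancestors ltnNge; case/negP.
      by apply: leq_trans (leq_sum _ (fun j _ => anc j)) _; exact: ltnW.
    apply/(has_sizeE _ sg); move: nz.
    have -> : generation s g = 0 by rewrite /generation sg content0.
    rewrite progeny0 pnatr_eq0 eqb0 negbK subr_eq0 => /eqP/tolat_inj.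
    by move=> ->.
  by rewrite mulr0.
have [n] := ubnP (H - h)%N; elim: n h t => // n IH h t hn ht.
have [Hh|hH] := leqP H h; first exact: base.
transitivity (P ([set w | height_le h.+1 (restr h.+1 (tau w)) /\ restr h (restr h.+1 (tau w)) = t]
    `&` [set w | has_size (tau w) k])).
  congr (P (_ `&` _)); apply/seteqP; split=> w /=.
    by move=> wt; split; [exact: height_restr|rewrite restr_restr].
  by rewrite restr_restr// => -[].
have c_inj : injective (fun i : ty => nat_of_ord i) by exact: ord_inj.
rewrite (measure_cylinders c_inj tau (B := [set s : treespace R ty | height_le h.+1 s /\ restr h s = t]) (size_event k)); last first.
  by move=> s [].
rewrite (eq_esum (b := fun s : treespace R ty => ((gw_weight h t)%:E *
   (list_weight p [seq u.2 | u <- level t h] [seq word s u | u <- level t h] *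
    progeny p (0 + content (flatten [seq word s u | u <- level t h]))
      ((tolat k - tolat (ancestors t h)) - tolat (content [seq u.2 | u <- level t h])))%:E)%E)); last first.
  move=> s [hs st]; rewrite IH ?gw_weightS//; last by lia.
  rewrite -EFinM (gw_weightS st) -mulrA; congr (_ * (_ * progeny _ _ _))%:E.
    by rewrite vadd0 generationS -st level_restr.
  by rewrite -addrA -opprD -tolatD ancestorsD -st ancestors_restr// level_restr.
rewrite esumZl ?gw_weight_ge0//; last first.
  by move=> s; rewrite lee_fin mulr_ge0 ?progeny_ge0// list_weight_ge0.
rewrite [RHS]EFinM; congr (_ * _)%E.
rewrite -[generation t h]vadd0 -progeny_generation// size_map.
pose e (s : treespace R ty) := [seq word s u | u <- level t h].
by rewrite (@reindex_esum R (treespace R ty) (seq (seq ty)) _ _ e _ (extension_bij ht)).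
Qed.

Lemma gw_size (k : vec) :
  P [set w | has_size (tau w) k] = (\sum_i alpha i * progeny p (unitv i) (tolat k))%:E.
Proof.
pose root i : treespace R ty := MTree (single_root_subproof (i : ty)).
have rootE i : root_mark (root i) = i by have [] := root_markP (root i).
have -> : [set w | has_size (tau w) k] =
    [set w | height_le 0 (restr 0 (tau w))] `&` [set w | has_size (tau w) k].
  by apply/seteqP; split=> w /=; [move=> ?; split => //; exact: height_restr|case].
rewrite (measure_cylinders (@ord_inj _) tau (B := [set s : treespace R ty | height_le 0 s]) (size_event k))//.
rewrite (@reindex_esum R ty (treespace R ty) [set: ty] _ root); last first.
  split=> //=; first by move=> i _ u /= ->.
    by move=> i j _ _ /(congr1 (@root_mark _)); rewrite !rootE.
  move=> s /= hs; exists (root_mark s) => //; apply: mtree_eq.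
  apply/seteqP; split=> u /=; first by move=> ->; exact: root_markP.
  move=> su; have := hs _ su; rewrite leqn0 => /eqP/size0nil u0.
  by apply: mark_inj su (root_markP s) _.
have -> : [set: ty] = [set` index_enum ty].
  by apply/seteqP; split=> // i _ /=; rewrite mem_index_enum.
rewrite esum_fset//.
rewrite -fsbig_seq ?index_enum_uniq// -sumEFin; apply: eq_bigr => i _.
rewrite gw_size_joint; last by move=> u /= ->.
rewrite /gw_weight /below big_nil mulr1 rootE; congr (_ * progeny _ _ _)%:E.
  by rewrite /generation /= rootE content_unit content0 addr0.
by rewrite /ancestors /below content0 tolat0 subr0.
Qed.

End galton_watson.

(** * Kesten's tree *)

Section map_marks_levels.
Variables (E F : choiceType) (f : E -> F).
Implicit Types (s : mtree E) (u : seq nat * E).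

Definition map_node u : seq nat * F := (u.1, f u.2).

Lemma map_marksP s v : map_marks f s v <-> exists2 u, s u & map_node u = v.
Proof. by []. Qed.

Lemma mem_map_marks s u : s u -> map_marks f s (map_node u).
Proof. by move=> su; apply/map_marksP; exists u. Qed.

Lemma root_mark_map s : root_mark (map_marks f s) = f (root_mark s).
Proof.
by have [] := mark_inj (root_markP (map_marks f s)) (mem_map_marks (root_markP s)) erefl.
Qed.

Lemma word_map s u : s u -> word (map_marks f s) (map_node u) = map f (word s u).
Proof.
move=> su; have fu := mem_map_marks su; apply: eq_from_onth => l; rewrite onth_map.
case e : (onth (word s u) l) => [j|].
  by apply/(wordP fu)/map_marksP; exists (rcons u.1 l.+1, j) => //; apply/(wordP su).
case e' : (onth (word _ _) l) => [j|//].
move/(wordP fu)/map_marksP: e' => [[w i] sw [ww _]]; move: sw; rewrite ww.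
by move/(wordP su); rewrite e.
Qed.

Lemma kid_nodes_map u om : kid_nodes (map_node u) (map f om) = map map_node (kid_nodes u om).
Proof.
rewrite /kid_nodes size_map -map_comp; apply/eq_in_map => i; rewrite mem_iota /= => im.
by rewrite /map_node /= (nth_map u.2).
Qed.

Lemma level_map s h : level (map_marks f s) h = map map_node (level s h).
Proof.
elim: h => [|h IH] /=; first by rewrite root_mark_map.
rewrite IH map_flatten -!map_comp; congr flatten; apply/eq_in_map => u /mem_level[su _] /=.
by rewrite word_map// kid_nodes_map.
Qed.

Lemma restr_map s h : restr h (map_marks f s) = map_marks f (restr h s).
Proof.
apply: mtree_eq; apply/seteqP; split=> v /=.
  by move=> [[u su <-] uh]; exists u.
by move=> [u [su uh] <-]; split => //; exists u.
Qed.

End map_marks_levels.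

Section kesten.
Variables (R : realType) (d : nat).
Local Notation ty := 'I_d.+1.
Local Notation vec := {ffun ty -> nat}.
Variables (p : ty -> vec -> R) (alpha : ty -> R) (astar : 'cV[R]_d.+1).
Hypothesis p_ge0 : forall i x, 0 <= p i x.
Hypothesis alpha_ge0 : forall i, 0 <= alpha i.
Hypothesis astar_pos : forall i, 0 < astar i 0.
Implicit Types (t : mtree ty) (s : mtree (ty * bool)) (u : seq nat * (ty * bool)).

Let norm := \sum_j alpha j * astar j 0.

Definition kesten_mass h s : R :=
  (if (root_mark s).2 then alpha_hat alpha astar (root_mark s).1 else 0) *
  \prod_(u <- below s h) kesten_weight p astar s u.

(** The statuses of [s] are those of a spine leading to [v]. Ancestors are prefixes, so a
    tree with statuses is determined by its types and by [v]. *)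
Definition spine s (v : seq nat * ty) : Prop :=
  forall u, s u -> (size u.1 <= size v.1)%N -> u.2.2 = prefix u.1 v.1.

Lemma finite_children s u : s u -> finite_set (special_children s u).
Proof.
move=> su; apply: (@sub_finite_set _ _ (children s u)); first by move=> v [].
by rewrite childrenE//; exact: finite_seq.
Qed.

Lemma kesten_weight_normal s u : s u -> u.2.2 = false -> kesten_weight p astar s u != 0 ->
  special_children s u = set0 /\
  kesten_weight p astar s u = word_weight p u.2.1 (map fst (word s u)).
Proof.
move=> su u2; have su' := mem_map_marks (@fst ty bool) su.
rewrite /kesten_weight u2 order_probE// children_by_markE// word_map//=.
case: ifPn => [S0 _|_]; last by rewrite !mulr0 eqxx.
split; last by rewrite mulr1.
move: S0; rewrite cardfs_eq0 => /eqP S0.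
by rewrite -(fset_setK (finite_children su)) S0 set_fset0.
Qed.

Lemma kesten_weight_special s u : s u -> u.2.2 -> kesten_weight p astar s u != 0 ->
  exists c, special_children s u = [set c] /\
  kesten_weight p astar s u =
    word_weight p u.2.1 (map fst (word s u)) * (astar c.2.1 0 / astar u.2.1 0).
Proof.
move=> su u2; have su' := mem_map_marks (@fst ty bool) su.
rewrite /kesten_weight u2 order_probE// children_by_markE// word_map//=.
case: ifPn => [S1|_]; last by rewrite !mulr0 eqxx.
have [c Sc] := cardfs1P _ S1.
have {}Sc : special_children s u = [set c].
  by rewrite -(fset_setK (finite_children su)) Sc set_fset1.
rewrite Sc fsbig_set1 => nz; exists c; split => //.
have nz' : pairing astar (content (map fst (word s u))) != 0.
  by apply: contraNneq nz => e; rewrite /p_hat e !(mul0r, mulr0).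
by rewrite /p_hat /word_weight; field; rewrite nz' gt_eqF.
Qed.

(** A nonzero weight forces exactly one special child for each special individual, hence
    a spine. Along it the factors [astar c / astar u] telescope, and those of the root and of
    the tip [v] are left. *)
Lemma kesten_mass_spine h s : kesten_mass h s != 0 ->
  exists v, [/\ v \in level (forget_status s) h, spine s v &
    kesten_mass h s = gw_weight p alpha h (forget_status s) * (astar v.2 0 / norm)].
Proof.
elim: h => [|h IH].
  rewrite /kesten_mass /gw_weight /below !big_nil !mulr1 root_mark_map.
  case: ifPn => [r2 _|_]; last by rewrite eqxx.
  exists ([::], (root_mark s).1); split=> //=; first by rewrite root_mark_map inE.
    move=> [w j] su /=; rewrite leqn0 => /eqP/size0nil w0; subst w.
    by have [->] := mark_inj su (root_markP s) erefl.
  by rewrite /alpha_hat mulrA.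
have -> : kesten_mass h.+1 s =
    kesten_mass h s * \prod_(u <- level s h) kesten_weight p astar s u.
  by rewrite /kesten_mass belowS big_cat /= mulrA.
rewrite mulf_eq0 negb_or => /andP[/IH[v [vl vs ->]] nz].
have {}nz u : u \in level s h -> kesten_weight p astar s u != 0.
  move=> ul; apply: contraNneq nz => u0.
  by rewrite (bigD1_seq u) ?level_uniq//= u0 mul0r.
have vh : size v.1 = h by have /mem_level[] := vl.
have : v \in level (forget_status s) h by [].
rewrite level_map => /mapP[sv svl vE].
have [ssv svh] := (mem_level _ _ _).1 svl.
have v1 : v.1 = sv.1 by rewrite vE.
have sv2 : sv.2.2 by rewrite vs// v1// prefix_refl.
have [c [Sc wc]] := kesten_weight_special ssv sv2 (nz _ svl).
have [[sc [l cl]] c2] : special_children s sv c by rewrite Sc.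
have normal u : u \in level s h -> u != sv -> u.2.2 = false.
  move=> /mem_level[su uh] usv; rewrite vs ?uh ?vh//; apply: contraNF usv => uv.
  apply/eqP/(mark_inj su ssv); rewrite -v1.
  by move: uv; rewrite prefixE uh -vh take_size => /eqP ->.
exists (c.1, c.2.1); split.
- rewrite level_map; apply/mapP; exists c => //; apply/mem_level; split => //.
  by rewrite cl size_rcons svh.
- move=> u su /=; rewrite cl size_rcons svh leq_eqVlt => /orP[/eqP uh|uh]; last first.
    rewrite vs ?vh// v1 -cats1.
    by rewrite !prefixE takel_cat// svh.
  case: (u) su uh => w [j b] /= su; case: (lastP w) su => // {}w l' su; rewrite size_rcons => -[wh].
  have [u0 su0 l0] := tree_parent su.
  have ul : (w, u0) \in level s h by apply/mem_level.
  have [e|ne] := eqVneq (w, u0) sv.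
    have wsv : w = sv.1 by rewrite -e.
    apply/idP/idP => [bt|pr].
      have : special_children s sv (rcons w l', (j, b)).
        by split => //; split => //; exists l'; rewrite wsv.
      by rewrite Sc => /= ce; rewrite -cl -ce prefix_refl.
    have ce : rcons w l' = c.1.
      by move: pr; rewrite prefixE size_rcons wh -svh -(size_rcons _ l) take_size cl => /eqP.
    by move: c2; rewrite -(mark_inj su sc ce).
  have [S0 _] := kesten_weight_normal ((mem_level _ _ _).1 ul).1 (normal _ ul ne) (nz _ ul).
  have -> : b = false.
    apply/negP => bt; have : special_children s (w, u0) (rcons w l', (j, b)).
      by split => //; split => //; exists l'.
    by rewrite S0.
  apply/esym/negP; rewrite prefixE size_rcons wh -svh -(size_rcons _ l) take_size => /eqP/rcons_inj[e _].
  by move/eqP: ne; apply; exact: (mark_inj (((mem_level _ _ _).1 ul).1) ssv).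
- have -> : \prod_(u <- level s h) kesten_weight p astar s u =
    (\prod_(u <- level s h) word_weight p u.2.1 (map fst (word s u))) * (astar c.2.1 0 / astar sv.2.1 0).
    rewrite (bigD1_seq sv) ?level_uniq//= [in RHS](bigD1_seq sv) ?level_uniq//= wc.
    rewrite mulrAC; congr (_ * _ * _).
    rewrite big_seq_cond [RHS]big_seq_cond; apply: eq_bigr => u /andP[ul usv].
    by have [_ ->] := kesten_weight_normal ((mem_level _ _ _).1 ul).1 (normal _ ul usv) (nz _ ul).
  have -> : gw_weight p alpha h.+1 (forget_status s) = gw_weight p alpha h (forget_status s) *
      \prod_(u <- level s h) word_weight p u.2.1 (map fst (word s u)).
    rewrite /gw_weight belowS big_cat /= mulrA level_map big_map; congr (_ * _).
    by apply: eq_big_seq => u /mem_level[su _]; rewrite word_map.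
  have -> : v.2 = sv.2.1 by rewrite vE.
  rewrite mulrACA; congr (_ * _).
  by rewrite mulrC mulrA divfK// gt_eqF.
Qed.

Lemma spine_unique s s' (v : seq nat * ty) : forget_status s = forget_status s' ->
  height_le (size v.1) s -> height_le (size v.1) s' -> spine s v -> spine s' v -> s = s'.
Proof.
suff H r r' : forget_status r = forget_status r' ->
  height_le (size v.1) r -> height_le (size v.1) r' -> spine r v -> spine r' v ->
  forall u, r u -> r' u.
  move=> e hs hs' vs vs'; apply: mtree_eq; apply/seteqP; split=> u.
    exact: (H s s').
  exact: (H s' s).
move=> e hs hs' vs vs' u ru.
have : forget_status r' (map_node fst u) by rewrite -e; exact: mem_map_marks.
move=> /map_marksP[u' ru' []]; case: u u' ru ru' => [w [i b]] [w' [i' b']] /= ru ru' ww' ii'.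
subst w' i'; have := vs _ ru (hs _ ru); have := vs' _ ru' (hs' _ ru') => /= <- ->.
by [].
Qed.

Lemma sum_content_mul (om : seq ty) (g : ty -> R) :
  \sum_(j <- om) g j = \sum_i (content om i)%:R * g i.
Proof.
elim: om => [|j om IH]; first by rewrite big_nil big1// => i _; rewrite ffunE mul0r.
rewrite big_cons IH content_cons.
under [RHS]eq_bigr do rewrite ffunE natrD mulrDl.
rewrite big_split /=; congr (_ + _).
rewrite (bigD1 j)//= eqxx mul1r big1 ?addr0// => i /negbTE->.
by rewrite mul0r.
Qed.

Lemma sum_at_most_one (T : eqType) (r : seq T) (Q : pred T) : uniq r ->
  (forall x y, Q x -> Q y -> x = y) -> \sum_(x <- r) (Q x)%:R <= 1 :> R.
Proof.
move=> ur Q1; elim: r ur => [|x r IH] /=; first by rewrite big_nil.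
move=> /andP[xr ur]; rewrite big_cons; have [Qx|Qx] := boolP (Q x); last by rewrite add0r IH.
rewrite big_seq big1 ?addr0// => y yr.
by have [Qy|//] := boolP (Q y); rewrite (Q1 _ _ Qx Qy) yr in xr.
Qed.

Context (D : measure_display) (Omega : measurableType D) (P : probability Omega R).
Variable taustar : {RV P >-> treespace R ty}.
Hypothesis tau_kesten : kesten_tree p alpha astar taustar.

(** Sum over the possible tips of the spine in the last generation of [t]. *)
Lemma kesten_law_le h t : height_le h t ->
  (P [set w | restr h (taustar w) = t] <=
  (gw_weight p alpha h t * ((\sum_i (generation t h i)%:R * astar i 0) / norm))%:E)%E.
Proof.
move=> ht; have [sigma sigma_law tauE] := tau_kesten.
have law s : height_le h s -> P [set w | restr h (sigma w) = s] = (kesten_mass h s)%:E.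
  move=> hs; rewrite sigma_law//; congr (_ * _)%:E.
  rewrite (_ : [set u | _] = [set` below s h]); last first.
    by apply/seteqP; split=> u /= /mem_below.
  by rewrite -fsbig_seq ?below_uniq.
pose B := [set s : treespace R (ty * bool)%type | height_le h s /\ forget_status s = t].
have -> : [set w | restr h (taustar w) = t] = [set w | B (restr h (sigma w))] `&` setT.
  rewrite setIT; apply/seteqP; split=> w /=.
    by rewrite tauE restr_map => wt; split => //; exact: height_restr.
  by rewrite tauE restr_map => -[].
rewrite (@measure_cylinders _ _ (fun x : ty * bool => choice.pickle x) (pcan_inj choice.pickleK) _ _ _ sigma B h)//; last by move=> s [].
rewrite (eq_esum (b := fun s : treespace R (ty * bool)%type => (kesten_mass h s)%:E)); last first.
  by move=> s [hs _]; rewrite setIT law.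
apply: ge_ereal_sup => _ [F [finF FB] <-].
rewrite fsbig_finite//= sumEFin lee_fin.
pose Q (v : seq nat * ty) (s : treespace R (ty * bool)%type) :=
  `[< spine s v /\ B s >].
pose g (v : seq nat * ty) := gw_weight p alpha h t * (astar v.2 0 / norm).
have norm_ge0 : 0 <= norm by apply: sumr_ge0 => j _; rewrite mulr_ge0// ltW.
have g0 v : 0 <= g v by rewrite mulr_ge0 ?gw_weight_ge0// divr_ge0// ltW.
apply: (@le_trans _ _ (\sum_(s <- fset_set F) \sum_(v <- level t h) g v * (Q v s)%:R)).
  rewrite big_seq [leRHS]big_seq; apply: ler_sum => s; rewrite in_fset_set// inE => Fs.
  have Bs := FB _ Fs; have [hs st] := Bs.
  have [->|/kesten_mass_spine[v [vl vs ->]]] := eqVneq (kesten_mass h s) 0.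
    by apply: sumr_ge0 => v _; rewrite mulr_ge0.
  move: vl; rewrite st => vl; rewrite (bigD1_seq v) ?level_uniq//=.
  rewrite /Q asboolT// mulr1 lerDl; apply: sumr_ge0 => v' _; by rewrite mulr_ge0.
rewrite exchange_big /=.
apply: (@le_trans _ _ (\sum_(v <- level t h) g v)).
  rewrite big_seq [leRHS]big_seq; apply: ler_sum => v /mem_level[tv vh].
  rewrite -mulr_sumr ler_piMr//; apply: sum_at_most_one => [|s s']; first exact: fset_uniq.
  move=> /asboolP[vs [hs st]] /asboolP[vs' [hs' st']].
  by apply: (@spine_unique s s' v) => //; rewrite ?vh// st st'.
rewrite -mulr_sumr ler_wpM2l ?gw_weight_ge0//.
rewrite -mulr_suml ler_wpM2r ?invr_ge0//.
by rewrite -sum_content_mul big_map.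
Qed.

End kesten.

(** * Convergence in distribution from cylinders *)

Section portmanteau.
Variables (R : realType) (E : pointedType) (c : E -> nat) (c_inj : injective c).
Implicit Types t : mtree E.

Lemma continuous_tree_measurable (f : treespace R E -> R) : continuous f -> measurable_fun setT f.
Proof.
move=> /continuousP cf; apply: (measurability _ (measurable_realfun.RGenOpens.measurableE R)).
move=> _ [_ [a [b ->] <-]]; rewrite setTI; apply: sub_sigma_algebra.
exact/cf/interval_open.
Qed.

Section step_functions.
Context (D : measure_display) (Omega : measurableType D) (P : probability Omega R).

Let PT : (P : {measure set Omega -> \bar R}) setT = 1%E := probability_setT P.

(** A negative [m s] only weakens the bound, so each [m s] may be replaced by its positive
    part. *)
Lemma integral_step_ge (T : eqType) (r : seq T) (m : T -> R) (C : T -> set Omega) (G : Omega -> R) :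
  measurable_fun setT G -> (forall w, 0 <= G w) -> uniq r ->
  (forall s, measurable (C s)) ->
  (forall s s' w, C s w -> C s' w -> s = s') ->
  (forall s w, s \in r -> C s w -> m s <= G w) ->
  ((\sum_(s <- r) m s * fine (P (C s)))%:E <= \int[P]_w (G w)%:E)%E.
Proof.
move=> mG G0 ur mC triv mG_le.
apply: (@le_trans _ _ (\sum_(s <- r) \int[P]_w (Num.max 0 (m s) * \1_(C s) w)%:E)%E).
  rewrite -sumEFin big_seq [leRHS]big_seq; apply: lee_sum => s _.
  rewrite (integralZl_indic measurableT (fun=> C s))//; last first.
    by rewrite ltNge le_max lexx.
  rewrite integral_indic// setIT -[X in (_ * X)%E]fineK ?fin_num_measure// -EFinM lee_fin.
  by rewrite ler_wpM2r ?le_max ?lexx ?orbT// fine_ge0.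
rewrite -ge0_integral_sum//; last 2 first.
- move=> s; apply/measurable_realfun.measurable_EFinP; apply: measurable_realfun.measurable_funM => //.
- by move=> s w _; rewrite lee_fin mulr_ge0// ?le_max ?lexx// indicE.
apply: ge0_le_integral => //.
- by move=> w _; apply: sume_ge0 => s _; rewrite lee_fin mulr_ge0 ?le_max ?lexx// indicE.
- apply: emeasurable_sum => s; apply/measurable_realfun.measurable_EFinP; apply: measurable_realfun.measurable_funM => //.
- exact/measurable_realfun.measurable_EFinP.
- move=> w _; rewrite sumEFin lee_fin.
  have [[s [sr Cs]]|no] := pselect (exists s, s \in r /\ C s w).
    rewrite (bigD1_seq s)//= [X in _ + X]big1 ?addr0 => [|s' s's]; last first.
      rewrite indicE memNset ?mulr0// => Cs'.
      by move/eqP: s's; apply; exact: triv Cs' Cs.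
    by rewrite indicE mem_set// mulr1 ge_max G0 mG_le.
  rewrite big_seq big1// => s sr; rewrite indicE memNset ?mulr0// => Cs.
  by apply: no; exists s.
Qed.

Variable X : {RV P >-> treespace R E}.

Definition mean_value (f : treespace R E -> R) : R := Rintegral P setT (f \o X).

Lemma bounded_integrable (f : treespace R E -> R) (K : R) : continuous f -> (forall t : treespace R E, `|f t| <= K) ->
  P.-integrable setT (EFin \o (f \o X)).
Proof.
move=> cf fK; apply: measurable_bounded_integrable => //.
- by rewrite PT ltry.
- by apply: measurableT_comp; [exact: continuous_tree_measurable|exact: measurable_funP].
- by exists K; split; [exact: num_real|move=> M KM w _; apply: le_trans (fK _) (ltW KM)].
Qed.

Lemma expectationE (f : treespace R E -> R) (K : R) : continuous f -> (forall t : treespace R E, `|f t| <= K) ->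
  ('E_P[fun w => f (X w)] = (mean_value f)%:E)%E.
Proof.
move=> cf fK; rewrite unlock /mean_value /Rintegral fineK//.
exact: integrable_fin_num (bounded_integrable cf fK).
Qed.

Lemma mean_value_step (T : eqType) (r : seq T) (m : T -> R) (C : T -> set Omega) (f : treespace R E -> R) (K : R) :
  continuous f -> (forall t : treespace R E, `|f t| <= K) -> uniq r ->
  (forall s, measurable (C s)) ->
  (forall s s' w, C s w -> C s' w -> s = s') ->
  (forall s w, s \in r -> C s w -> m s <= f (X w)) ->
  \sum_(s <- r) (K + m s) * fine (P (C s)) <= K + mean_value f.
Proof.
move=> cf fK ur mC triv mf.
have if_ := bounded_integrable cf fK.
have iK : P.-integrable setT (EFin \o (fun=> K)).
  by apply/integrableP; split; [exact: measurable_cst|rewrite integral_cst// PT mule1 ltry].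
have -> : K + mean_value f = Rintegral P setT (fun w => K + f (X w)).
  by rewrite RintegralD// Rintegral_cst// PT mulr1.
rewrite -lee_fin /Rintegral fineK; last first.
  by apply: integrable_fin_num => //; exact: (integrableD measurableT iK if_).
apply: (@integral_step_ge _ r (fun s => K + m s)) => //.
- apply: measurable_realfun.measurable_funD => //.
  by apply: measurableT_comp; [exact: continuous_tree_measurable|exact: measurable_funP].
- by move=> w; have := fK (X w); rewrite ler_norml; lra.
- by move=> s w sr Cs; rewrite lerD2l mf.
Qed.

Lemma sum_prob_le1 (T : eqType) (r : seq T) (C : T -> set Omega) : uniq r ->
  (forall s, measurable (C s)) ->
  (forall s s' w, C s w -> C s' w -> s = s') ->
  \sum_(s <- r) fine (P (C s)) <= 1.
Proof.
move=> ur mC triv; rewrite -lee_fin.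
have := @integral_step_ge _ r (fun=> 1) C (fun=> 1) (@measurable_cst _ _ _ _ _ _) (fun=> ler01) ur mC triv (fun _ _ _ _ => lexx _).
rewrite integral_cst// PT mule1.
by under eq_bigr do rewrite mul1r.
Qed.

End step_functions.

Lemma mean_valueN (D : measure_display) (Omega : measurableType D) (P : probability Omega R)
  (X : {RV P >-> treespace R E}) (f : treespace R E -> R) (K : R) :
  continuous f -> (forall t : treespace R E, `|f t| <= K) ->
  mean_value X (fun t => - f t) = - mean_value X f.
Proof.
move=> cf fK; rewrite /mean_value -[RHS]mulN1r -RintegralZl//; last exact: bounded_integrable cf fK.
by congr Rintegral; apply/funext => w /=; rewrite mulN1r.
Qed.

Definition tight_cylinder (f : treespace R E -> R) (del : R) h t :=
  forall s s', restr h s = t -> restr h s' = t -> `|f s - f s'| <= del.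

Lemma continuous_cylinder (f : treespace R E -> R) (del : R) t : continuous f -> 0 < del ->
  exists h, tight_cylinder f del h (restr h t).
Proof.
move=> cf del0; have d2 : 0 < del / 2 by rewrite divr_gt0.
have /cvgrPdist_lt/(_ _ d2)/nbhs_ballP[e /= e0 eP] := cf t.
have [h he] : exists h : nat, 2 `^ (- h%:R) < e.
  have [n ne] : exists n : nat, e^-1 < n%:R.
    by exists (Num.Def.truncn e^-1).+1; exact: truncnS_gt.
  exists n; rewrite powRN powR_mulrn// invf_plt ?posrE ?exprn_gt0//.
  by apply: lt_le_trans ne _; rewrite -natrX ler_nat ltnW// ltn_expl.
have close s : restr h s = restr h t -> `|f t - f s| < del / 2.
  move=> st; apply: eP; rewrite ballEmdist /=.
  by apply: le_lt_trans he; apply: dist_restr.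
exists h => s s' /close hs /close hs'.
have -> : f s - f s' = (f t - f s') - (f t - f s) by ring.
rewrite (le_trans (ler_normB _ _))// [del]splitr lerD// ltW//.
Qed.

Context (D' : measure_display) (Omega' : measurableType D') (P' : probability Omega' R).
Variable Y : {RV P' >-> treespace R E}.

(** By continuity every tree lies in a cylinder on which [f] varies little; the union of
    these cylinders at height [h] increases to the whole space with [h], and it is a
    countable union, so that finitely many of them carry almost all the mass. *)
Lemma finite_cylinders (f : treespace R E -> R) (del : R) : continuous f -> 0 < del ->
  exists h (r : seq (treespace R E)), [/\ uniq r,
    forall s, s \in r -> height_le h s /\ tight_cylinder f del h s &
    1 - del <= \sum_(s <- r) fine (P' [set w | restr h (Y w) = s])].
Proof.
move=> cf del0.
pose A h := [set w | tight_cylinder f del h (restr h (Y w))].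
have mA h : measurable (A h) by exact: (cylinder_event Y (tight_cylinder f del h)).
have ndA : nondecreasing_seq A.
  move=> h h' hh'; apply/subsetPset => w /= Aw s s' sw s'w.
  by apply: Aw; apply: restr_le hh' _.
have UA : \bigcup_h A h = setT.
  by apply/seteqP; split=> // w _; have [h] := continuous_cylinder (Y w) cf del0; exists h.
have cvA : P' \o A @ \oo --> 1%E.
  by rewrite -(probability_setT P') -UA; apply: nondecreasing_cvg_mu => //; rewrite UA.
have [h hA] : exists h, ((1 - del)%:E < P' (A h))%E.
  apply: contrapT => /forallNP no.
  have : (1 <= (1 - del)%:E :> \bar R)%E.
    rewrite -(cvg_lim _ cvA)//; apply: lime_le; first by apply/cvg_ex; exists 1%E.
    by apply: nearW => h; rewrite leNgt; apply/negP; exact: no.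
  by rewrite lee_fin; lra.
pose B := [set s : treespace R E | height_le h s /\ tight_cylinder f del h s].
have AE : A h = [set w | B (restr h (Y w))] `&` setT.
  rewrite setIT; apply/seteqP; split=> w /=; last by case.
  by move=> Aw; split => //; exact: height_restr.
move: hA; rewrite AE (measure_cylinders c_inj Y (B := B) (h := h))//; last by move=> s [].
move=> /ereal_sup_gt[_ [F [finF FB] <-] dF].
exists h, (fset_set F); split; first exact: fset_uniq.
  by move=> s; rewrite in_fset_set// inE => /FB.
move: dF; rewrite fsbig_finite//=.
rewrite (eq_bigr (fun s => (fine (P' [set w | restr h (Y w) = s]))%:E)).
  by rewrite sumEFin lte_fin => /ltW.
by move=> s _; rewrite setIT fineK// fin_num_measure//; exact: (cylinder_event Y (fun t => t = s)).
Qed.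

Context (F : set_system nat) (FF : Filter F).
Context (D : nat -> measure_display) (Omega : forall n, measurableType (D n))
  (P : forall n, probability (Omega n) R) (X : forall n, {RV (P n) >-> treespace R E}).

Hypothesis cylinder_lower : forall h t (eps : R), height_le h t -> 0 < eps ->
  \forall n \near F, fine (P' [set w | restr h (Y w) = t]) - eps <=
    fine (P n [set w | restr h (X n w) = t]).

(** Step functions bound [K + f] from below under the law of [X n] and [K - f] from
    below under the law of [Y]. Adding the two bounds, the values of [f] cancel and the
    mass of the cylinders remains. *)
Lemma mean_value_lower (f : treespace R E -> R) (K eps : R) : continuous f ->
  (forall t : treespace R E, `|f t| <= K) -> 0 < eps ->
  \forall n \near F, mean_value Y f - eps <= mean_value (X n) f.
Proof.
move=> cf fK e0; have K0 : 0 <= K by apply: le_trans (fK point); exact: normr_ge0.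
pose del := eps / (4 * K + 2).
have del0 : 0 < del by rewrite divr_gt0//; lra.
have [h [r [ur hr mass]]] := finite_cylinders cf del0.
pose C' s := [set w | restr h (Y w) = s].
pose C n s := [set w | restr h (X n w) = s].
have mC' s : measurable (C' s) by exact: (cylinder_event Y (fun t => t = s)).
have mC n s : measurable (C n s) by exact: (cylinder_event (X n) (fun t => t = s)).
have [del' del'0 del'r] : exists2 del', 0 < del' & del' * (size r)%:R <= del.
  exists (del / (size r).+1%:R); first by rewrite divr_gt0.
  by rewrite mulrAC ler_pdivrMr// ler_wpM2l ?(ltW del0)// ler_nat.
have lower : \forall n \near F, forall s, s \in r ->
    fine (P' (C' s)) - del' <= fine (P n (C n s)).
  by apply: near_seq => s /hr[hs _]; exact: cylinder_lower.
near=> n; have low : forall s, s \in r -> fine (P' (C' s)) - del' <= fine (P n (C n s)).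
  by near: n.
have tight s t : s \in r -> restr h t = s -> `|f s - f t| <= del.
  by move=> /hr[hs ts] st; apply: ts => //; exact: restr_id.
have cNf : continuous (fun t : treespace R E => - f t) by move=> t; exact: (cvgN (cf t)).
have NfK t : `|- f t| <= K by rewrite normrN.
have I1 : \sum_(s <- r) (K + (f s - del)) * fine (P n (C n s)) <= K + mean_value (X n) f.
  apply: mean_value_step => // [s s' w <- <-//|s w sr Cs].
  by have := tight _ _ sr Cs; rewrite ler_norml; lra.
have I2 : \sum_(s <- r) (K + (- f s - del)) * fine (P' (C' s)) <= K - mean_value Y f.
  rewrite -(mean_valueN Y cf fK); apply: mean_value_step => // [s s' w <- <-//|s w sr Cs].
  by have := tight _ _ sr Cs; rewrite ler_norml; lra.
have S1 : \sum_(s <- r) fine (P n (C n s)) <= 1 by apply: sum_prob_le1 => // s s' w <- <-.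
have S2 : \sum_(s <- r) fine (P' (C' s)) <= 1 by apply: sum_prob_le1 => // s s' w <- <-.
have : \sum_(s <- r) (2 * K * fine (P' (C' s)) - 2 * K * del' - del * fine (P n (C n s)) - del * fine (P' (C' s)))
   <= \sum_(s <- r) ((K + (f s - del)) * fine (P n (C n s)) + (K + (- f s - del)) * fine (P' (C' s))).
  rewrite big_seq [leRHS]big_seq; apply: ler_sum => s sr.
  have := low s sr; have := fK s; rewrite ler_norml => /andP[f1 f2] l.
  set x := fine _ in l *; set y := fine _ in l *.
  have : 0 <= (K + f s) * (y - (x - del')) by rewrite mulr_ge0//; lra.
  have : 0 <= (K - f s) * del' by rewrite mulr_ge0 ?(ltW del'0)//; lra.
  by move=> h1 h2; lra.
rewrite !sumrB -!mulr_sumr [X in _ <= X -> _]big_split /=.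
have -> : \sum_(s <- r) del' = del' * (size r)%:R.
  by rewrite big_const_seq count_predT iter_addr_0 mulr_natr.
have : 2 * K * (del' * (size r)%:R) <= 2 * K * del by rewrite ler_wpM2l ?mulr_ge0.
have eE : eps = del * (4 * K + 2) by rewrite /del divfK// gt_eqF//; lra.
move: S1 S2 mass I1 I2; rewrite -/(C' _).
set x := \sum_(s <- r) fine (P n _); set y := \sum_(s <- r) fine (P' _).
move=> S1 S2 mass I1 I2 h1 h2.
have : del * x <= del * 1 by rewrite ler_pM2l.
have : del * y <= del * 1 by rewrite ler_pM2l.
have : 2 * K * (1 - del) <= 2 * K * y by rewrite ler_wpM2l ?mulr_ge0.
by move=> h3 h4 h5; rewrite eE; lra.
Unshelve. all: by end_near. Qed.

(** No mass can be lost, the cylinders of a given height having total mass one under the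
    limit: lower bounds on all the cylinders are enough. *)
Lemma cvg_in_distribution_cylinders : cvg_in_distribution F X Y.
Proof.
move=> f cf [K fK].
have cNf : continuous (fun t : treespace R E => - f t) by move=> t; exact: (cvgN (cf t)).
have NfK t : `|- f t| <= K by rewrite normrN.
rewrite (expectationE Y cf fK).
under eq_fun do rewrite (expectationE _ cf fK).
apply: cvg_EFin; first exact: nearW.
apply/cvgrPdist_le => e e0.
have L1 := mean_value_lower cf fK e0.
have L2 := mean_value_lower cNf NfK e0.
near=> n; rewrite /= ler_norml.
have : mean_value Y f - e <= mean_value (X n) f by near: n.
have : mean_value Y (fun t => - f t) - e <= mean_value (X n) (fun t => - f t) by near: n.
by rewrite !(mean_valueN _ cf fK) => h1 h2; apply/andP; split; lra.
Unshelve. all: by end_near. Qed.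

End portmanteau.

(** * Galton-Watson trees conditioned by their size *)

Section convergence.
Variables (R : realType) (d : nat).
Local Notation ty := 'I_d.+1.
Local Notation vec := {ffun ty -> nat}.
Variables (p : ty -> vec -> R) (a : 'rV[R]_d.+1) (astar : 'cV[R]_d.+1).
Hypothesis p_offspring : is_offspring p.
Hypothesis p_primitive : primitive p.
Hypothesis p_aperiodic : aperiodic p.
Hypothesis a_pos : forall i, 0 < a 0 i.
Hypothesis a_eigen : a *m mean_mx p = a.
Hypothesis astar_pos : forall i, 0 < astar i 0.
Hypothesis astar_eigen : mean_mx p *m astar = astar.
Variable k : nat -> vec.
Hypothesis k_infty : (\sum_i k n i)%N @[n --> \oo] --> \oo.
Hypothesis k_ratio : forall i,
  (k n i)%:R / (\sum_j k n j)%:R @[n --> \oo] --> a 0 i.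
Variable alpha : ty -> R.
Hypothesis alpha_distribution : is_distribution alpha.

Let norm := \sum_j alpha j * astar j 0.

Let norm_gt0 : 0 < norm.
Proof.
have [al0 al1] := alpha_distribution.
have term0 j : 0 <= alpha j * astar j 0 by rewrite mulr_ge0// ltW.
rewrite lt_neqAle sumr_ge0// andbT eq_sym; apply/eqP => n0.
have /psumr_eq0P h : norm = 0 by [].
have : \sum_i alpha i = 0 :> R.
  apply: big1 => i _; apply/eqP.
  by have /eqP := h (fun i _ => term0 i) i isT; rewrite mulf_eq0 (gt_eqF (astar_pos i)) orbF.
by rewrite al1 => /eqP; rewrite oner_eq0.
Qed.

(** The ratio limit for each root type [i], multiplied by [alpha i * astar i] and summed. *)
Lemma size_ratio_lower (r : vec) (c : {ffun ty -> int}) (eps : R) : 0 < eps ->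
  \forall n \near \oo,
    ((\sum_i (r i)%:R * astar i 0) / norm - eps) *
      (\sum_i alpha i * progeny p (unitv i) (tolat (k n))) <=
    progeny p r (tolat (k n) - c).
Proof.
move=> e0; have [al0 al1] := alpha_distribution.
have p_ge0 i x : 0 <= p i x by case: (p_offspring i).
pose C := \sum_j astar j 0.
have C_ge i : astar i 0 <= C by rewrite /C (bigD1 i)//= lerDl sumr_ge0// => j _; exact: ltW.
have C0 : 0 < C by apply: lt_le_trans (C_ge ord0).
pose e1 := eps * norm / C.
have e10 : 0 < e1 by rewrite divr_gt0// mulr_gt0.
have H i := progeny_ratio_lower p_offspring p_primitive p_aperiodic a_pos a_eigen
  astar_pos astar_eigen k_infty k_ratio i r c e10.
have := @near_seq \oo eventually_filter ty (index_enum ty) _ (fun i _ => H i).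
apply: filterS => n h.
set S := \sum_i (r i)%:R * astar i 0 in h *; set Fr := progeny p r _ in h *.
set Z := \sum_i _.
have : (S - e1 * C) * Z <= norm * Fr.
  rewrite /Z /norm mulr_sumr mulr_suml; apply: ler_sum => i _.
  have := h i (mem_index_enum _); set Fi := progeny p (unitv i) _.
  have Fi0 : 0 <= Fi by exact: progeny_ge0.
  move=> hi; rewrite -(ler_pM2l (astar_pos i)) in hi.
  have hC : e1 * astar i 0 * Fi <= e1 * C * Fi by rewrite ler_wpM2r// ler_pM2l.
  have -> : alpha i * astar i 0 * Fr = alpha i * (astar i 0 * Fr) by rewrite mulrA.
  rewrite mulrCA ler_wpM2l//; apply: le_trans hi.
  have -> : astar i 0 * ((S / astar i 0 - e1) * Fi) = S * Fi - e1 * astar i 0 * Fi.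
    by field; rewrite gt_eqF.
  by rewrite mulrBl lerD2l lerN2.
move=> hZ; rewrite -(ler_pM2l norm_gt0); apply: le_trans hZ.
by rewrite mulrA mulrBr mulrCA divff ?gt_eqF// mulr1 /e1 divfK ?gt_eqF// (mulrC eps).
Qed.

Context (D : measure_display) (Omega : measurableType D) (P : probability Omega R).
Variable tau : {RV P >-> treespace R ty}.
Hypothesis tau_gw : gw_tree p alpha tau.
Context (Dn : nat -> measure_display) (Omegan : forall n, measurableType (Dn n))
  (Pn : forall n, probability (Omegan n) R).
Variable taun : forall n, {RV (Pn n) >-> treespace R ty}.
Hypothesis taun_law : forall n, (1 <= n)%N ->
  (0 < P [set w | has_size (tau w) (k n)])%E ->
  forall A : set (treespace R ty), measurable A ->
    Pn n (taun n @^-1` A) = cond_prob P (tau @^-1` A) [set w | has_size (tau w) (k n)].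
Context (D' : measure_display) (Omega' : measurableType D') (P' : probability Omega' R).
Variable taustar : {RV P' >-> treespace R ty}.
Hypothesis taustar_kesten : kesten_tree p alpha astar taustar.

Lemma conditioned_cylinder_lower h (t : mtree ty) (eps : R) : height_le h t -> 0 < eps ->
  \forall n \near within [set n | (0 < P [set w | has_size (tau w) (k n)])%E] \oo,
    fine (P' [set w | restr h (taustar w) = t]) - eps <=
    fine (Pn n [set w | restr h (taun n w) = t]).
Proof.
move=> ht e0; have [al0 al1] := alpha_distribution.
have p_ge0 i x : 0 <= p i x by case: (p_offspring i).
set W := gw_weight p alpha h t; have W0 : 0 <= W by exact: gw_weight_ge0.
pose e1 := eps / (W + 1).
have e10 : 0 < e1 by rewrite divr_gt0// ltr_wpDl.
have lower := size_ratio_lower (generation t h) (tolat (ancestors t h)) e10.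
have large : \forall n \near \oo, (1 <= n)%N by exists 1%N.
rewrite near_withinE; near=> n => /= pos.
have n1 : (1 <= n)%N by near: n.
have := taun_law n1 pos (@cylinder_measurable R _ (fun s => s = t) h).
rewrite /preimage /cond_prob /= => ->.
rewrite (gw_size_joint p_ge0 al0 tau_gw _ ht) -/W.
move: pos; rewrite /= (gw_size p_ge0 al0 tau_gw) lte_fin.
have : ((\sum_i (generation t h i)%:R * astar i 0) / norm - e1) *
      (\sum_i alpha i * progeny p (unitv i) (tolat (k n))) <=
    progeny p (generation t h) (tolat (k n) - tolat (ancestors t h)) by near: n.
set S := \sum_i _ * astar i 0; set Z := \sum_i _; set Fr := progeny _ _ _ => hS Z0.
rewrite /= -mulrA; apply: (@le_trans _ _ (W * (S / norm) - eps)).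
  rewrite lerD2r -lee_fin fineK; last first.
    by apply: fin_num_measure; exact: (cylinder_event taustar (fun s => s = t)).
  exact: (kesten_law_le p_ge0 al0 astar_pos taustar_kesten ht).
apply: (@le_trans _ _ (W * (S / norm - e1))); last first.
  by rewrite ler_wpM2l// ler_pdivlMr.
rewrite mulrBr lerD2l lerN2 /e1 mulrA ler_pdivrMr ?ltr_wpDl//.
by rewrite mulrC ler_pM2l// lerDl.
Unshelve. all: by end_near. Qed.

End convergence.

Theorem theorem3p1 (R : realType) (d : nat)
  (p : 'I_d.+1 -> {ffun 'I_d.+1 -> nat} -> R)
  (p_offspring : is_offspring p)
  (p_primitive : primitive p)
  (p_critical : critical p)
  (p_nonsingular : nonsingular p)
  (p_aperiodic : aperiodic p)
  (a : 'rV[R]_d.+1) (astar : 'cV[R]_d.+1)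
  (a_pos : forall i, 0 < a 0 i)
  (a_eigen : a *m mean_mx p = a)
  (a_sum : \sum_i a 0 i = 1)
  (astar_pos : forall i, 0 < astar i 0)
  (astar_eigen : mean_mx p *m astar = astar)
  (astar_norm : \sum_i a 0 i * astar i 0 = 1)
  (k : nat -> {ffun 'I_d.+1 -> nat})
  (k_infty : (\sum_i k n i)%N @[n --> \oo] --> \oo)
  (k_ratio : forall i,
     (k n i)%:R / (\sum_j k n j)%:R @[n --> \oo] --> a 0 i)
  (alpha : 'I_d.+1 -> R)
  (alpha_distribution : is_distribution alpha)
  (D : measure_display) (Omega : measurableType D)
  (P : probability Omega R)
  (tau : {RV P >-> treespace R 'I_d.+1})
  (tau_gw : gw_tree p alpha tau)
  (Dn : nat -> measure_display) (Omegan : forall n, measurableType (Dn n))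
  (Pn : forall n, probability (Omegan n) R)
  (taun : forall n, {RV (Pn n) >-> treespace R 'I_d.+1})
  (taun_law : forall n, (1 <= n)%N ->
     (0 < P [set w | has_size (tau w) (k n)])%E ->
     forall A : set (treespace R 'I_d.+1), measurable A ->
       Pn n (taun n @^-1` A) =
       cond_prob P (tau @^-1` A) [set w | has_size (tau w) (k n)])
  (D' : measure_display) (Omega' : measurableType D')
  (P' : probability Omega' R)
  (taustar : {RV P' >-> treespace R 'I_d.+1})
  (taustar_kesten : kesten_tree p alpha astar taustar) :
  cvg_in_distribution
    (within [set n | (0 < P [set w | has_size (tau w) (k n)])%E] \oo)
    taun taustar.
Proof.
apply: (cvg_in_distribution_cylinders (@ord_inj d.+1)) => h t eps ht e0.
exact: (conditioned_cylinder_lower p_offspring p_primitive p_aperiodic a_pos a_eigen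
  astar_pos astar_eigen k_infty k_ratio alpha_distribution tau_gw taun_law taustar_kesten ht e0).
Qed.
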